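(* Let $\lambda>0$. For every uniform mesh $\mathcal{T}$ of $\Omega=(0,1)\times(0,1)$ of step $h$ ($1/h$ a positive integer) and every $\boldsymbol{f}\in L^2(\Omega)^2$, there exists a unique pair $(\boldsymbol{u},p)\in X_{\mathcal{T}}^2\times\bar X_{\mathcal{T}}$ such that, for all $K\in\mathcal{T}$, $$(-\Delta_{\mathcal{T}}\boldsymbol{u})_K+(\nabla_{\mathcal{T}}p)_K=\boldsymbol{f}_K,\qquad (\mathrm{div}_{\mathcal{T}}\boldsymbol{u})_K+\lambda\,h^2\,(-\Delta_S p)_K=0.$$ Moreover, there exists a real number $c$ independent of $h$ (and of $\boldsymbol{f}$) such that this solution satisfies $$\|\boldsymbol{u}\|_{\mathcal{T}}+\|p\|_{L^2(\Omega)}\le c\,\|\boldsymbol{f}\|_{L^2(\Omega)^2}.$$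
   Context: Let $\Omega=(0,1)\times(0,1)$. For $h>0$ with $1/h$ a positive integer, $\mathcal{T}$ is the uniform structured mesh of $\Omega$ made of the $h^{-2}$ square control volumes (cells) of side $h$. $\mathcal{E}_{\rm int}$ (resp. $\mathcal{E}_{\rm ext}$) is the set of internal edges (resp. edges on $\partial\Omega$), $\mathcal{E}(K)$ is the set of the edges of the cell $K$; $\sigma=K|L$ denotes the common edge of two neighbouring cells $K$ and $L$, and $\boldsymbol{n}_{K|L}$ is the unit normal to $K|L$ oriented from $K$ to $L$. For $\sigma\in\mathcal{E}_{\rm ext}$, $\boldsymbol{n}_\sigma$ is the unit normal to $\sigma$ outward $\Omega$. $X_{\mathcal{T}}\subset L^2(\Omega)$ is the space of functions which are constant over each cell, $v_K$ denotes the value of $v\in X_{\mathcal{T}}$ on $K$, and $\bar X_{\mathcal{T}}$ is the subspace of functions of $X_{\mathcal{T}}$ with zero mean value over $\Omega$. Discrete $H^1$ norm: for $v\in X_{\mathcal{T}}$, $$\|v\|_{\mathcal{T}}^2=\sum_{\sigma=K|L\in\mathcal{E}_{\rm int}}(v_K-v_L)^2+\sum_{\sigma\in\mathcal{E}_{\rm ext},\,\sigma\in\mathcal{E}(K)}2\,v_K^2,$$ and for $\boldsymbol{v}=(v^{(1)},v^{(2)})\in X_{\mathcal{T}}^2$, $\|\boldsymbol{v}\|_{\mathcal{T}}^2=\|v^{(1)}\|_{\mathcal{T}}^2+\|v^{(2)}\|_{\mathcal{T}}^2$. Discrete operators: for $\boldsymbol{u}\in X_{\mathcal{T}}^2$,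 $p\in X_{\mathcal{T}}$ and $K\in\mathcal{T}$ (sums indexed by $\sigma=K|L$ run over the internal edges of $K$), $$(-\Delta_{\mathcal{T}}\boldsymbol{u})_K=\frac1{h^2}\sum_{\sigma=K|L}(\boldsymbol{u}_K-\boldsymbol{u}_L)+\frac2{h^2}\sum_{\sigma\in\mathcal{E}(K)\cap\mathcal{E}_{\rm ext}}\boldsymbol{u}_K,$$ $$(\nabla_{\mathcal{T}} p)_K=\frac1{h^2}\sum_{\sigma=K|L}h\,\frac{p_K+p_L}{2}\,\boldsymbol{n}_{K|L}+\frac1{h^2}\sum_{\sigma\in\mathcal{E}(K)\cap\mathcal{E}_{\rm ext}}h\,p_K\,\boldsymbol{n}_\sigma,$$ $$(\mathrm{div}_{\mathcal{T}}\boldsymbol{u})_K=\frac1{h^2}\sum_{\sigma=K|L}h\,\frac{\boldsymbol{u}_K+\boldsymbol{u}_L}{2}\cdot\boldsymbol{n}_{K|L},\qquad (-\Delta_S p)_K=\frac1{h^2}\sum_{\sigma=K|L}(p_K-p_L).$$ $\boldsymbol{f}_K$ denotes the mean value of $\boldsymbol{f}$ over $K$. The parameter $\lambda$ is fixed independently of $h$; the constant $c$ may depend on $\lambda$. *)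

(* Defs.v *)
From mathcomp Require Import all_boot all_order all_algebra.
From mathcomp Require Import all_classical all_reals all_analysis.

Set Implicit Arguments.
Unset Strict Implicit.
Unset Printing Implicit Defensive.

Import Order.TTheory GRing.Theory Num.Theory.

Local Open Scope classical_set_scope.
Local Open Scope ring_scope.

Notation plane R := (measurableTypeR R * measurableTypeR R)%type.

Definition lebesgue2 (R : realType) : {measure set plane R -> \bar R} :=
  (@lebesgue_measure R \x @lebesgue_measure R)%E.

Definition Omega {R : realType} : set (plane R) := `]0, 1[ `*` `]0, 1[.

(* A function on the plane stands for its restriction to Omega *)
Definition zero_extension (R : realType) (g : plane R -> R) : plane R -> R :=
  fun x => g x * \1_Omega x.

Definition L2 (R : realType) (g : plane R -> R) : Prop :=
  zero_extension g \in Lfun (lebesgue2 R) 2%:E.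

Definition L2norm (R : realType) (g : plane R -> R) : R :=
  fine ('N[lebesgue2 R]_2%:E[EFin \o zero_extension g])%E.

Definition component (R : realType) (T : Type) (f : T -> 'rV[R]_2) (c : 'I_2)
  : T -> R := fun x => f x ord0 c.

Definition L2vec (R : realType) (f : plane R -> 'rV[R]_2) : Prop :=
  forall c : 'I_2, L2 (component f c).

Definition L2vec_norm (R : realType) (f : plane R -> 'rV[R]_2) : R :=
  Num.sqrt (\sum_(c < 2) L2norm (component f c) ^+ 2).

(* The mesh of step 1/n; a cell is named by its column and its row *)
Notation cell n := ('I_n * 'I_n)%type.

Definition step (R : realType) (n : nat) : R := n%:R^-1.

Definition control_volume {R : realType} (n : nat) (K : cell n)
  : set (plane R) :=
  `](K.1)%:R * step R n, (K.1).+1%:R * step R n[ `*`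
  `](K.2)%:R * step R n, (K.2).+1%:R * step R n[.

(* An edge of K is named by the side of K it is. It is internal when
   [neighbour] returns the cell across it, external when it returns None *)
Inductive side : Type := West | East | South | North.

Definition sides : seq side := [:: West; East; South; North].

Definition ord_succ (n : nat) (i : 'I_n) : option 'I_n := insub i.+1.

Definition ord_prec (n : nat) (i : 'I_n) : option 'I_n :=
  if (i : nat) is i'.+1 then insub i' else None.

Definition neighbour (n : nat) (K : cell n) (s : side) : option (cell n) :=
  match s with
  | West => omap (fun i => (i, K.2)) (ord_prec K.1)
  | East => omap (fun i => (i, K.2)) (ord_succ K.1)
  | South => omap (fun j => (K.1, j)) (ord_prec K.2)
  | North => omap (fun j => (K.1, j)) (ord_succ K.2)
  end.

(* Unit normal to a side, outward to its cell: it is n_{K|L} on an internal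
   edge and n_sigma on an external one *)
Definition outward_normal (R : realType) (s : side) : 'rV[R]_2 :=
  match s with
  | West => - delta_mx ord0 ord0
  | East => delta_mx ord0 ord0
  | South => - delta_mx ord0 ord_max
  | North => delta_mx ord0 ord_max
  end.

Definition dot (R : realType) (x y : 'rV[R]_2) : R := (x *m y^T) ord0 ord0.

(* The element of X_T with cell values v, as a function of the plane; it is
   set to 0 on the negligible complement of the cells *)
Definition piecewise_constant (R : realType) (n : nat) (v : {ffun cell n -> R})
  : plane R -> R :=
  fun x => \sum_(K : cell n) v K * \1_(control_volume K) x.

Definition zero_mean (R : realType) (n : nat) (v : {ffun cell n -> R})
  : Prop :=
  \int[lebesgue2 R]_(x in Omega) piecewise_constant v x = 0.

(* Each internal edge is the East or North side of exactly one of its two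
   cells, hence it is counted once in the first sum *)
Definition discrete_H1_sq (R : realType) (n : nat) (v : cell n -> R) : R :=
  \sum_(K : cell n) \sum_(s <- [:: East; North])
     (if neighbour K s is Some L then (v K - v L) ^+ 2 else 0)
  + \sum_(K : cell n) \sum_(s <- sides | neighbour K s == None)
     2 * v K ^+ 2.

Definition discrete_H1_norm (R : realType) (n : nat)
    (u : {ffun cell n -> 'rV[R]_2}) : R :=
  Num.sqrt (\sum_(c < 2) discrete_H1_sq (component u c)).

Definition neg_laplacian (R : realType) (n : nat)
    (u : {ffun cell n -> 'rV[R]_2}) (K : cell n) : 'rV[R]_2 :=
  (1 / step R n ^+ 2) *: (\sum_(s <- sides)
     (if neighbour K s is Some L then u K - u L else 0))
  + (2 / step R n ^+ 2) *: (\sum_(s <- sides | neighbour K s == None) u K).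

Definition gradient (R : realType) (n : nat)
    (p : {ffun cell n -> R}) (K : cell n) : 'rV[R]_2 :=
  (1 / step R n ^+ 2) *: (\sum_(s <- sides)
     (if neighbour K s is Some L
      then (step R n * ((p K + p L) / 2)) *: outward_normal R s else 0))
  + (1 / step R n ^+ 2) *: (\sum_(s <- sides | neighbour K s == None)
     (step R n * p K) *: outward_normal R s).

Definition divergence (R : realType) (n : nat)
    (u : {ffun cell n -> 'rV[R]_2}) (K : cell n) : R :=
  (1 / step R n ^+ 2) * (\sum_(s <- sides)
     (if neighbour K s is Some L
      then step R n * dot (2^-1 *: (u K + u L)) (outward_normal R s) else 0)).

Definition neg_laplacian_S (R : realType) (n : nat)
    (p : {ffun cell n -> R}) (K : cell n) : R :=
  (1 / step R n ^+ 2) * (\sum_(s <- sides)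
     (if neighbour K s is Some L then p K - p L else 0)).

Definition cell_mean (R : realType) (n : nat) (f : plane R -> 'rV[R]_2)
    (K : cell n) : 'rV[R]_2 :=
  \row_(c < 2) ((fine (lebesgue2 R (control_volume K)))^-1 *
    \int[lebesgue2 R]_(x in control_volume K) component f c x).

Definition stokes_solution (R : realType) (n : nat) (lambda : R)
    (f : plane R -> 'rV[R]_2)
    (u : {ffun cell n -> 'rV[R]_2}) (p : {ffun cell n -> R}) : Prop :=
  zero_mean p /\
  forall K : cell n,
    neg_laplacian u K + gradient p K = cell_mean f K /\
    divergence u K + lambda * step R n ^+ 2 * neg_laplacian_S p K = 0.

(* Main.v *)
From HB Require Import structures.
Require Import Defs.
From mathcomp Require Import all_boot all_order all_algebra.
From mathcomp Require Import all_classical all_reals all_analysis.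
From mathcomp Require Import measurable_realfun.
From mathcomp Require Import zify ring lra.

(** Testing the momentum equation with the velocity and the mass equation with
    the pressure makes the gradient and divergence terms cancel, by summation by
    parts, and leaves [|u|_T^2 + lambda h^2 |p|_S^2 = (f, u)], where [|p|_S] is
    the discrete H1 seminorm of the pressure.  Discrete Poincare then bounds the
    velocity and [h |p|_S] by the data ([grid_energy]).

    The pressure itself needs an inf-sup argument.  The collocated divergence is
    not surjective in a stable way, because it does not see checkerboards, but
    the divergence of the staggered scheme, whose unknowns are the fluxes
    through the edges, is: each zero-mean [p] is the staggered divergence of an
    edge field [W] whose discrete H1 seminorm is at most [C ||p||]
    ([staggered_right_inverse]).  Averaging the two fluxes of a cell gives a
    collocated velocity [v]; its discrete divergence differs from that of [W]
    by second differences of [W], so pairing with [p] costs only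
    [h |p|_S ||W||] ([mean_divergence_error]), which the stabilisation already
    controls.  Testing the momentum equation with [v] gives
    [||p||^2 <= C ||f|| ||p||] ([grid_estimate]).

    The staggered right inverse is built level by level, by explicit formulas.
    Split the grid into nearly dyadic boxes, whose side lengths at a
    given level differ by at most one cell, and halve them alternately in the
    two directions.  The zero-mean [p] is then a sum of Haar functions, each
    proportional to [1_A / |A| - 1_B / |B|] for the two halves of a box.  Such a
    function is the divergence of a field supported in the box
    ([boxable_haar]): an explicit flow ([tile_x], [tile_y]) drains a rectangle
    and sends its mass sideways, and the same flow read backwards from the other
    half receives it.  All the pieces of this field are piecewise linear with a
    bounded number of breaks, so that the total variation of the slopes along
    every line, called the bend below, is bounded by the size of the Haar
    coefficient.

    The sum of the fields over the levels must be bounded in H1 without losing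
    the number of levels, about [log n].  This is an almost
    orthogonality statement ([multilevel_energy]): summing by parts puts the
    second difference on the coarser of two fields; it has bounded mass on each
    coarse box, whereas the finer field is small, being of the order of the
    width of the fine boxes.  The interaction of levels [i] and [j] thus decays
    like [(3/4)^|i - j|], and the H1 energy is at most a constant times the sum
    of the squares of the Haar coefficients, that is [||p||^2] by Pythagoras
    ([average_energy_step]).

    Existence and uniqueness follow from the same estimates: the system is
    square and linear once the sum of the pressure is added to the mass
    equation, and the estimates with zero data show that it is injective.
    Finally the norms of cell functions are Lebesgue norms of piecewise constant
    functions ([L2norm_piecewise]), and taking cell means does not increase the
    L2 norm ([cell_mean_energy]). *)

Set Implicit Arguments.
Unset Strict Implicit.
Unset Printing Implicit Defensive.

Import Order.TTheory GRing.Theory Num.Theory.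

Local Open Scope ring_scope.

(** * Sequences of bounded bend *)

Definition slope (R : realFieldType) (g : nat -> R) (k : nat) : R := g k.+1 - g k.

(** The term [`|d 0|] counts the jump from an implicit zero before index 0, so
    that bounded variation implies boundedness. *)
Definition variation_sum (R : realFieldType) (d : nat -> R) (n : nat) : R :=
  `|d 0%N| + \sum_(0 <= k < n) `|d k.+1 - d k|.

Definition variation_le (R : realFieldType) (d : nat -> R) (C : R) : Prop :=
  forall n, variation_sum d n <= C.

(** The slope rather than the function: the total mass of the second difference
    is what summation by parts needs, and it is bounded independently of the
    length scale for piecewise linear profiles. *)
Definition bend_le (R : realFieldType) (g : nat -> R) (C : R) : Prop :=
  variation_le (slope g) C.

Lemma variation_le_ext (R : realFieldType) (d e : nat -> R) C :
  d =1 e -> variation_le d C -> variation_le e C.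
Proof.
move=> de dC n; apply: le_trans (dC n); rewrite /variation_sum -de lerD2l.
by apply: ler_sum => k _; rewrite -!de.
Qed.

Lemma variation_le_weak (R : realFieldType) (d : nat -> R) C D :
  C <= D -> variation_le d C -> variation_le d D.
Proof. by move=> CD dC n; apply: le_trans CD. Qed.

Lemma variation_le0 (R : realFieldType) : variation_le (fun _ => 0 : R) 0.
Proof.
by move=> n; rewrite /variation_sum normr0 add0r big1// => k _; rewrite subrr normr0.
Qed.

Lemma variation_leD (R : realFieldType) (d e : nat -> R) C D :
  variation_le d C -> variation_le e D -> variation_le (fun k => d k + e k) (C + D).
Proof.
move=> dC eD n; apply: le_trans (lerD (dC n) (eD n)); rewrite /variation_sum.
rewrite addrACA -big_split/= lerD ?ler_normD//.
by apply: ler_sum => k _; rewrite opprD addrACA ler_normD.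
Qed.

Lemma variation_leZ (R : realFieldType) (d : nat -> R) C c :
  variation_le d C -> variation_le (fun k => c * d k) (`|c| * C).
Proof.
move=> dC n; apply: le_trans (ler_wpM2l (normr_ge0 c) (dC n)).
rewrite /variation_sum mulrDr -normrM mulr_sumr lerD2l.
by apply: ler_sum => k _; rewrite -mulrBr normrM.
Qed.

Lemma variation_leB (R : realFieldType) (d e : nat -> R) C D :
  variation_le d C -> variation_le e D -> variation_le (fun k => d k - e k) (C + D).
Proof.
move=> dC eD; apply: (variation_le_ext (d := fun k => d k + (-1) * e k)).
  by move=> k; rewrite mulN1r.
by apply: variation_leD => //; have := variation_leZ (-1) eD; rewrite normrN1 mul1r.
Qed.

(** Extending by zero on the left costs nothing, since the jump at the origin
    is already counted. *)
Lemma variation_le_shift (R : realFieldType) (d : nat -> R) C m :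
  variation_le d C -> variation_le (fun k => if (m <= k)%N then d (k - m)%N else 0) C.
Proof.
move=> dC; elim: m => [|m IHm].
  by apply: variation_le_ext dC => k; rewrite leq0n subn0.
move=> [|n]; first by rewrite /variation_sum big_nil addr0 normr0 (le_trans _ (dC 0%N)) ?addr_ge0 ?normr_ge0 ?sumr_ge0.
apply: le_trans (IHm n); rewrite /variation_sum /= normr0 add0r big_nat_recl//=.
by rewrite subr0 ltnS subSS.
Qed.

Lemma variation_le_ge0 (R : realFieldType) (d : nat -> R) C : variation_le d C -> 0 <= C.
Proof. by move/(_ 0%N); apply: le_trans; rewrite /variation_sum big_nil addr0. Qed.

Lemma variation_le_bound (R : realFieldType) (d : nat -> R) C k :
  variation_le d C -> `|d k| <= C.
Proof.
move=> /(_ k); apply: le_trans; rewrite /variation_sum.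
elim: k => [|k IHk]; first by rewrite big_nil addr0.
rewrite big_nat_recr//= addrA; apply: le_trans (lerD IHk (lexx _)).
by apply: le_trans (ler_normD _ _); rewrite addrC subrK.
Qed.

Definition convex_pred (P : pred nat) : Prop :=
  forall i j k, (i <= j)%N -> (j <= k)%N -> P i -> P k -> P j.

(** A convex set of indices is entered at most once and left at most once.
    Every bend bound below reduces to this count. *)
Lemma variation_le_indicator (R : realFieldType) (P : pred nat) :
  convex_pred P -> variation_le (fun k => (P k)%:R : R) 2.
Proof.
move=> cvP n.
suff [H1 H2] : variation_sum (fun k => (P k)%:R : R) n <= 2 - (P n)%:R /\
    ((forall k, (k <= n)%N -> ~~ P k) -> variation_sum (fun k => (P k)%:R : R) n = 0).
  by apply: le_trans H1 _; case: (P n) => /=; lra.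
elim: n => [|n [IH1 IH2]].
  rewrite /variation_sum big_nil addr0 normr_nat; split; first by case: (P 0%N) => /=; lra.
  by move=> /(_ 0%N isT); case: (P 0%N).
have E : variation_sum (fun k => (P k)%:R : R) n.+1 =
   variation_sum (fun k => (P k)%:R : R) n + `|(P n.+1)%:R - (P n)%:R|.
  by rewrite /variation_sum big_nat_recr//= addrA.
rewrite E; split; last first.
  move=> H; rewrite IH2 => [|k kn]; last by apply: H; lia.
  by rewrite (negPf (H n.+1 _))// (negPf (H n _))// subrr normr0 addr0.
case Pn: (P n); case PSn: (P n.+1) => /=.
- by rewrite subrr normr0 addr0; move: IH1; rewrite Pn /=.
- by rewrite sub0r normrN normr1; move: IH1; rewrite Pn /=; lra.
- rewrite subr0 normr1 IH2; first lra.
  move=> k kn; apply/negP => Pk; move/negP: Pn; apply.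
  by apply: (cvP k n n.+1).
- by rewrite subrr normr0 addr0; move: IH1; rewrite Pn /=.
Qed.

Lemma bend_leD (R : realFieldType) (g h : nat -> R) C D :
  bend_le g C -> bend_le h D -> bend_le (fun k => g k + h k) (C + D).
Proof.
move=> gC hD; apply: variation_le_ext (variation_leD gC hD) => k.
by rewrite /slope opprD addrACA.
Qed.

Lemma bend_leZ (R : realFieldType) (g : nat -> R) C c :
  bend_le g C -> bend_le (fun k => c * g k) (`|c| * C).
Proof.
by move=> gC; apply: variation_le_ext (variation_leZ c gC) => k; rewrite /slope mulrBr.
Qed.

(** Truncated subtraction freezes the profile before index [m], which is a
    translation with slope zero on the left. *)
Lemma bend_le_shift (R : realFieldType) (g : nat -> R) C m :
  bend_le g C -> bend_le (fun k => g (k - m)%N) C.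
Proof.
move=> gC; apply: variation_le_ext (variation_le_shift m gC) => k; rewrite /slope.
case: leqP => mk; first by rewrite subSn.
have -> : (k.+1 - m = k - m)%N by lia.
by rewrite subrr.
Qed.

(** * An explicit flow draining a rectangle *)

(** Distance from [s] to the complement of the interval from 0 to [w]. *)
Definition depth (w s : nat) : nat := minn s (w - s).

(** Vertical flux of the tile.  In each column it rises with slope 1 from the
    bottom side up to the depth of the column, returns to 0 at mid-height, and is
    antisymmetric in the upper half up to rounding: both horizontal sides see slope 1, which is the
    divergence prescribed inside.  The horizontal flux, which carries what
    remains, therefore starts from 0 at those sides without a jump.  The cap at
    the depth makes the flux vanish on the vertical sides. *)
Definition tile_y (R : realFieldType) (w Y s y : nat) : R :=
  (minn (depth w s) y)%:R + (minn (depth w s) (Y./2 - y))%:R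
  - (minn (depth w s) (y - Y./2))%:R - (minn (depth w s) (Y - y))%:R.

(** Horizontal flux, obtained by integrating from the left the part of the
    prescribed divergence that the vertical flux does not carry.  On the right of the tile it
    is an outflow profile that depends only on [w] and [Y]; it cancels against
    the profile of a translated tile. *)
Definition tile_x (R : realFieldType) (w Y t y : nat) : R :=
  \sum_(0 <= s < t) (((s < w) && (0 < y <= Y))%N%:R
     - (tile_y R w Y s.+1 y - tile_y R w Y s.+1 y.-1)).

Lemma tile_divergence (R : realFieldType) (w Y t y : nat) :
  tile_x R w Y t.+1 y.+1 - tile_x R w Y t y.+1
  + (tile_y R w Y t.+1 y.+1 - tile_y R w Y t.+1 y) = ((t < w) && (y < Y))%N%:R.
Proof. by rewrite /tile_x big_nat_recr//=; lra. Qed.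

(** Brings differences of casts to an equation without subtraction between
    natural numbers. *)
Lemma natr_cross (R : realFieldType) (a b c d : nat) :
  (a + b = c + d)%N -> a%:R - c%:R = d%:R - b%:R :> R.
Proof. by move=> /(congr1 (fun k => k%:R : R)); rewrite !natrD; lra. Qed.

(** The truncated depth goes up, stays flat and goes down: its slope is
    a difference of two indicators of intervals. *)
Lemma bend_le_ramp_s (R : realFieldType) (w z : nat) :
  bend_le (fun s => (minn (depth w s) z)%:R : R) 4.
Proof.
apply: (variation_le_ext (d := fun s => ((s < z) && (s.*2.+2 <= w))%N%:R
   - ([&& s < w, w <= s.*2 & w <= s + z])%N%:R)).
  by move=> s; rewrite /slope; apply/esym/natr_cross; rewrite /depth; lia.
have -> : 4 = 2 + 2 :> R by lra.
by apply: variation_leB; apply: variation_le_indicator => i j k ij jk; lia.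
Qed.

Lemma tile_y_bend_s (R : realFieldType) (w Y y : nat) :
  bend_le (fun s => tile_y R w Y s y) 16.
Proof.
apply: (variation_le_ext (d := fun s =>
   slope (fun s => (minn (depth w s) y)%:R : R) s
   + slope (fun s => (minn (depth w s) (Y./2 - y))%:R) s
   - slope (fun s => (minn (depth w s) (y - Y./2))%:R) s
   - slope (fun s => (minn (depth w s) (Y - y))%:R) s)).
  by move=> s; rewrite /slope /tile_y; lra.
have -> : 16 = 4 + 4 + 4 + 4 :> R by lra.
apply: variation_leB; [apply: variation_leB; [apply: variation_leD|]|]; exact: bend_le_ramp_s.
Qed.

(** The slope of a capped ramp is nonzero only on an interval, where it is 1 in
    absolute value. *)
Lemma slope_tile_y (R : realFieldType) (w Y s y : nat) :
  tile_y R w Y s y.+1 - tile_y R w Y s y =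
  (y < depth w s)%N%:R - ((y < Y./2) && (Y./2 <= y + depth w s))%N%:R
  - ((Y./2 <= y) && (y < Y./2 + depth w s))%N%:R
  + ((y < Y) && (Y <= y + depth w s))%N%:R.
Proof.
rewrite /tile_y; set d := depth w s.
have H1 : (minn d y.+1)%:R - (minn d y)%:R = (y < d)%N%:R :> R.
  by rewrite (@natr_cross R _ 0 _ (y < d)%N) ?subr0//; lia.
have H2 : (minn d (Y./2 - y.+1))%:R - (minn d (Y./2 - y))%:R = - ((y < Y./2) && (Y./2 <= y + d))%N%:R :> R.
  by rewrite (@natr_cross R _ ((y < Y./2) && (Y./2 <= y + d))%N _ 0) ?sub0r//; lia.
have H3 : (minn d (y.+1 - Y./2))%:R - (minn d (y - Y./2))%:R = ((Y./2 <= y) && (y < Y./2 + d))%N%:R :> R.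
  by rewrite (@natr_cross R _ 0 _ ((Y./2 <= y) && (y < Y./2 + d))%N) ?subr0//; lia.
have H4 : (minn d (Y - y.+1))%:R - (minn d (Y - y))%:R = - ((y < Y) && (Y <= y + d))%N%:R :> R.
  by rewrite (@natr_cross R _ ((y < Y) && (Y <= y + d))%N _ 0) ?sub0r//; lia.
by lra.
Qed.

Lemma tile_y_bend_y (R : realFieldType) (w Y s : nat) :
  bend_le (fun y => tile_y R w Y s y) 8.
Proof.
apply: (variation_le_ext (fun y => esym (slope_tile_y R w Y s y))).
have -> : 8 = 2 + 2 + 2 + 2 :> R by lra.
by do ![apply: variation_leB | apply: variation_leD]; apply: variation_le_indicator => i j k ij jk; lia.
Qed.

(** In a fixed row the slope of the horizontal flux is the prescribed divergence
    minus a vertical slope, hence a sum of indicators of intervals. *)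
Lemma tile_x_bend_t (R : realFieldType) (w Y y : nat) :
  bend_le (fun t => tile_x R w Y t y) 10.
Proof.
case: y => [|y].
  apply: (@variation_le_weak _ _ 0); first by lra.
  apply: variation_le_ext (@variation_le0 R) => t.
  rewrite /slope /tile_x !big1 ?subrr// => s _; rewrite subrr subr0 andbF//.
apply: (variation_le_ext (d := fun t => ((t < w) && (0 < y.+1 <= Y))%N%:R - (
  (y < depth w t.+1)%N%:R - ((y < Y./2) && (Y./2 <= y + depth w t.+1))%N%:R
  - ((Y./2 <= y) && (y < Y./2 + depth w t.+1))%N%:R
  + ((y < Y) && (Y <= y + depth w t.+1))%N%:R))).
  move=> t; rewrite /slope /tile_x big_nat_recr//= slope_tile_y.
  by rewrite [RHS]addrAC subrr add0r.
have -> : 10 = 2 + (2 + 2 + 2 + 2) :> R by lra.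
do ![apply: variation_leB | apply: variation_leD]; apply: variation_le_indicator => i j k ij jk; rewrite /depth; lia.
Qed.

(** A given depth is reached once on the way up and once on the way down.  This
    turns a sum over columns into two indicators, whatever the width. *)
Lemma depth_level_count (w t k : nat) :
  (\sum_(0 <= s < t) ((0 < k) && (depth w s.+1 == k)) =
   [&& 0 < k, k <= t & k.*2 <= w] + [&& 0 < k, w <= k + t & k.*2 < w])%N.
Proof.
elim: t => [|t IHt]; first by rewrite big_nil; lia.
by rewrite big_nat_recr//= IHt /depth; lia.
Qed.

Lemma indicator_leS (p q : bool) (w t : nat) :
  [&& p, q, 0 < w & w <= t.+1]%N
  = ([&& p, q, 0 < w & w <= t]%N + [&& p, q & t.+1 == w])%N :> nat.
Proof. case: p; case: q => //=; lia. Qed.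

(** The vertical second difference of [tile_y] consists of unit masses at the
    heights where a capped ramp starts or ends.  Those at the two sides cancel
    the jumps of the prescribed divergence, except in the column where the depth
    is 0; the others sit at a distance from a side or from mid-height equal to
    the depth of the column.  Summing over the columns counts columns of given
    depth.  The tile must not be wider than high, for otherwise the ramps would
    meet; width 1 is harmless because the depth is then 0. *)
Lemma slope_tile_x_y (R : realFieldType) (w Y t y : nat) :
  (w <= Y)%N \/ (w <= 1)%N ->
  slope (fun y => tile_x R w Y t y) y =
  ([&& y == 0, 0 < Y, 0 < w & w <= t])%N%:R - ([&& y == Y, 0 < Y, 0 < w & w <= t])%N%:R
  + (\sum_(0 <= s < t) ((0 < y) && (depth w s.+1 == y)))%N%:R
  + (\sum_(0 <= s < t) ((0 < Y./2 - y) && (depth w s.+1 == Y./2 - y)))%N%:R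
  - (\sum_(0 <= s < t) ((0 < y - Y./2) && (depth w s.+1 == y - Y./2)))%N%:R
  - (\sum_(0 <= s < t) ((0 < Y - y) && (depth w s.+1 == Y - y)))%N%:R.
Proof.
move=> wY; rewrite /slope /tile_x.
elim: t => [|t IHt].
  rewrite !big_nil.
  have -> : [&& y == 0, 0 < Y, 0 < w & w <= 0]%N = false by lia.
  have -> : [&& y == Y, 0 < Y, 0 < w & w <= 0]%N = false by lia.
  by rewrite !subr0 !addr0.
rewrite !big_nat_recr//= !natrD.
set d := depth w t.+1.
have dc : (d <= Y./2)%N by rewrite /d /depth; lia.
have dw : (t < w)%N = ((0 < d) || (t.+1 == w))%N by rewrite /d /depth; lia.
have dw' : (t.+1 == w)%N -> d = 0%N by rewrite /d /depth; lia.
rewrite !indicator_leS !natrD.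
move: IHt; set u := \sum_(_ <= _ < _) _; set v := \sum_(_ <= _ < _) _ => IHt.
rewrite /= in u v IHt *.
suff H : ((t < w) && (0 < y.+1 <= Y))%N%:R
     - (tile_y R w Y t.+1 y.+1 - tile_y R w Y t.+1 y)
   - (((t < w) && (0 < y <= Y))%N%:R
     - (tile_y R w Y t.+1 y - tile_y R w Y t.+1 y.-1)) =
   [&& y == 0, 0 < Y & t.+1 == w]%N%:R - [&& y == Y, 0 < Y & t.+1 == w]%N%:R
   + ((0 < y) && (d == y))%N%:R + ((0 < Y./2 - y) && (d == Y./2 - y))%N%:R
   - ((0 < y - Y./2) && (d == y - Y./2))%N%:R - ((0 < Y - y) && (d == Y - y))%N%:R :> R.
  by move: IHt H; rewrite /d; lra.
clear IHt u v.
have slope_d k := slope_tile_y R w Y t.+1 k; rewrite -/d in slope_d.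
rewrite slope_d.
set c := Y./2 in dc slope_d *.
have cY : (c.*2 <= Y)%N by rewrite /c; lia.
clearbody d; clear wY.
clearbody c.
case: y => [|y].
  have -> : [&& t < w, 0 < 1 & 0 < Y]%N%:R
      = ((0 < Y) && (t.+1 == w))%N%:R + (0 < d)%N%:R :> R.
    by rewrite -natrD; congr _%:R; rewrite dw; lia.
  have -> : ((0 < c) && (c <= 0 + d))%N = ((0 < c) && (d == c))%N by lia.
  have -> : ((c <= 0) && (0 < c + d))%N = false by lia.
  have -> : ((0 < Y) && (Y <= 0 + d))%N = ((0 < Y) && (d == Y))%N by lia.
  have -> : [&& 0 == Y, 0 < Y & t.+1 == w]%N = false by lia.
  rewrite /= !subn0 subrr andbF ?sub0n ?ltnn /=; lra.
rewrite [y.+1.-1]/= slope_d.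
have H1 : [&& t < w, 0 < y.+2 & y.+2 <= Y]%N%:R - [&& t < w, 0 < y.+1 & y.+1 <= Y]%N%:R
    = - ((y.+1 == Y) && (t < w))%N%:R :> R.
  rewrite (@natr_cross R _ ((y.+1 == Y) && (t < w))%N _ 0) ?sub0r//; lia.
have H2 : (y.+1 < d)%N%:R - (y < d)%N%:R = - ((0 < y.+1) && (d == y.+1))%N%:R :> R.
  rewrite (@natr_cross R _ ((0 < y.+1) && (d == y.+1))%N _ 0) ?sub0r//; lia.
have H3 : ((y.+1 < c) && (c <= y.+1 + d))%N%:R - ((y < c) && (c <= y + d))%N%:R
    = ((0 < c - y.+1) && (d == c - y.+1))%N%:R - ((c == y.+1) && (0 < d))%N%:R :> R.
  apply: natr_cross; lia.
have H4 : ((c <= y.+1) && (y.+1 < c + d))%N%:R - ((c <= y) && (y < c + d))%N%:R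
    = ((c == y.+1) && (0 < d))%N%:R - ((0 < y.+1 - c) && (d == y.+1 - c))%N%:R :> R.
  apply: natr_cross; lia.
have H5 : ((y.+1 < Y) && (Y <= y.+1 + d))%N%:R - ((y < Y) && (Y <= y + d))%N%:R
    = ((0 < Y - y.+1) && (d == Y - y.+1))%N%:R - ((y.+1 == Y) && (0 < d))%N%:R :> R.
  apply: natr_cross; lia.
have H6 : ((y.+1 == Y) && (t < w))%N%:R = ((y.+1 == Y) && (0 < d))%N%:R
    + [&& y.+1 == Y, 0 < Y & t.+1 == w]%N%:R :> R.
  by rewrite -natrD; congr _%:R; rewrite dw; lia.
have -> : [&& y.+1 == 0, 0 < Y & t.+1 == w]%N = false by lia.
move: H1 H2 H3 H4 H5 H6; clear; rewrite /=.
lra.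
Qed.

Lemma tile_x_bend_y (R : realFieldType) (w Y t : nat) :
  (w <= Y)%N \/ (w <= 1)%N -> bend_le (fun y => tile_x R w Y t y) 20.
Proof.
move=> wY; rewrite /bend_le; have E y := esym (slope_tile_x_y R t y wY).
apply: (variation_le_ext E).
have count (f : nat -> nat) : 
  (forall a b, convex_pred (fun y => [&& 0 < f y, f y <= a & (f y).*2 <= b]%N)) ->
  (forall a b, convex_pred (fun y => [&& 0 < f y, w <= f y + a & (f y).*2 < b]%N)) ->
  variation_le (fun y => (\sum_(0 <= s < t) ((0 < f y) && (depth w s.+1 == f y)))%N%:R : R) 4.
  move=> cv1 cv2.
  have -> : 4 = 2 + 2 :> R by lra.
  apply: (variation_le_ext (d := fun y => [&& 0 < f y, f y <= t & (f y).*2 <= w]%N%:R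
      + [&& 0 < f y, w <= f y + t & (f y).*2 < w]%N%:R)).
    by move=> y; rewrite depth_level_count natrD.
  by apply: variation_leD; apply: variation_le_indicator.
have -> : 20 = 2 + 2 + 4 + 4 + 4 + 4 :> R by lra.
apply: variation_leB; [apply: variation_leB; [apply: variation_leD; [apply: variation_leD;
  [apply: variation_leB|]|]|]|].
- by apply: variation_le_indicator => i j k ij jk; lia.
- by apply: variation_le_indicator => i j k ij jk; lia.
- by apply: (count (fun y => y)) => a b i j k ij jk; lia.
- by apply: (count (fun y => Y./2 - y)%N) => a b i j k ij jk; lia.
- by apply: (count (fun y => y - Y./2)%N) => a b i j k ij jk; lia.
- by apply: (count (fun y => Y - y)%N) => a b i j k ij jk; lia.
Qed.

(** * Flows confined to a box *)

Lemma bend_le0 (R : realFieldType) : bend_le (fun _ => 0 : R) 0.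
Proof. by apply: variation_le_ext (@variation_le0 R) => k; rewrite /slope subrr. Qed.

Lemma bend_leB (R : realFieldType) (g h : nat -> R) C D :
  bend_le g C -> bend_le h D -> bend_le (fun k => g k - h k) (C + D).
Proof.
move=> gC hD; apply: variation_le_ext (variation_leB gC hD) => k.
by rewrite /slope; lra.
Qed.

(** A pair of fluxes through the edges of the grid: [F x y] is the flux
    through the left side of the cell [(x, y - 1)], [G x y] through the bottom
    side of the cell [(x - 1, y)].  The shift by one in the transverse direction makes
    room for a row of zeros around the grid.  The first two clauses say that no
    flux crosses or leaves the boundary of the box. *)
Definition box_field (R : realFieldType) (x0 x1 y0 y1 : nat)
    (q : nat -> nat -> R) (C : R) (F G : nat -> nat -> R) : Prop :=
  [/\ forall x y, ~~ ((x0 < x < x1) && (y0 < y <= y1))%N -> F x y = 0,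
      forall x y, ~~ ((x0 < x <= x1) && (y0 < y < y1))%N -> G x y = 0,
      forall i j, F i.+1 j.+1 - F i j.+1 + (G i.+1 j.+1 - G i.+1 j) = q i j,
      forall x, bend_le (F x) C /\ bend_le (G x) C
    & forall y, bend_le (F^~ y) C /\ bend_le (G^~ y) C].

Definition boxable (R : realFieldType) x0 x1 y0 y1 (q : nat -> nat -> R) C :=
  exists F G, box_field x0 x1 y0 y1 q C F G.

Lemma boxable0 (R : realFieldType) x0 x1 y0 y1 :
  @boxable R x0 x1 y0 y1 (fun _ _ => 0) 0.
Proof.
exists (fun _ _ => 0), (fun _ _ => 0); split=> //.
- by move=> i j; rewrite !subrr addr0.
- by move=> x; split; apply: bend_le0.
- by move=> x; split; apply: bend_le0.
Qed.

Lemma boxableD (R : realFieldType) x0 x1 y0 y1 (q r : nat -> nat -> R) C D :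
  boxable x0 x1 y0 y1 q C -> boxable x0 x1 y0 y1 r D ->
  boxable x0 x1 y0 y1 (fun i j => q i j + r i j) (C + D).
Proof.
move=> [F [G [F0 G0 dq bx by_]]] [F' [G' [F0' G0' dq' bx' by']]].
exists (fun x y => F x y + F' x y), (fun x y => G x y + G' x y); split.
- by move=> x y xy; rewrite F0// F0'// addr0.
- by move=> x y xy; rewrite G0// G0'// addr0.
- by move=> i j; rewrite -dq -dq'; ring.
- by move=> x; have [? ?] := bx x; have [? ?] := bx' x; split; apply: bend_leD.
- by move=> y; have [? ?] := by_ y; have [? ?] := by' y; split; apply: bend_leD.
Qed.

Lemma boxableZ (R : realFieldType) x0 x1 y0 y1 (q : nat -> nat -> R) C c :
  boxable x0 x1 y0 y1 q C ->
  boxable x0 x1 y0 y1 (fun i j => c * q i j) (`|c| * C).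
Proof.
move=> [F [G [F0 G0 dq bx by_]]].
exists (fun x y => c * F x y), (fun x y => c * G x y); split.
- by move=> x y xy; rewrite F0// mulr0.
- by move=> x y xy; rewrite G0// mulr0.
- by move=> i j; rewrite -dq; ring.
- by move=> x; have [? ?] := bx x; split; apply: bend_leZ.
- by move=> y; have [? ?] := by_ y; split; apply: bend_leZ.
Qed.

Lemma boxable_ext (R : realFieldType) x0 x1 y0 y1 (q r : nat -> nat -> R) C D :
  (forall i j, q i j = r i j) -> C <= D ->
  boxable x0 x1 y0 y1 q C -> boxable x0 x1 y0 y1 r D.
Proof.
move=> qr CD [F [G [F0 G0 dq bx by_]]]; exists F, G; split=> //.
- by move=> i j; rewrite dq.
- by move=> x; have [? ?] := bx x; split; apply: variation_le_weak CD _.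
- by move=> y; have [? ?] := by_ y; split; apply: variation_le_weak CD _.
Qed.

Lemma boxable_sum (R : realFieldType) x0 x1 y0 y1 m (q : nat -> nat -> nat -> R) C :
  (forall s, (s < m)%N -> boxable x0 x1 y0 y1 (q s) C) ->
  boxable x0 x1 y0 y1 (fun i j => \sum_(0 <= s < m) q s i j) (m%:R * C).
Proof.
elim: m => [|m IHm] H.
  by apply: boxable_ext (boxable0 R _ _ _ _) => [i j|]; rewrite ?big_nil ?mul0r.
apply: boxable_ext (boxableD (IHm _) (H m _)) => //.
- by move=> i j; rewrite big_nat_recr.
- by rewrite -natr1 mulrDl mul1r.
- by move=> s sm; apply: H; lia.
Qed.

(** Beyond the two horizontal sides the four ramps cancel pairwise, because the
    depth is at most half of the height. *)
Lemma tile_y_out (R : realFieldType) w Y s y : (w <= Y)%N \/ (w <= 1)%N ->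
  y = 0%N \/ (Y <= y)%N -> tile_y R w Y s y = 0.
Proof.
move=> wY yY; rewrite /tile_y.
have dc : (depth w s <= Y./2)%N by rewrite /depth; lia.
case: yY => [->|yY].
  rewrite ?sub0n !minn0 !subn0.
  by rewrite (minn_idPl dc) (minn_idPl _) ?subr0 ?add0r ?subrr//; lia.
have -> : minn (depth w s) y = depth w s by lia.
have -> : minn (depth w s) (y - Y./2) = depth w s by lia.
have -> : (Y./2 - y = 0)%N by lia.
have -> : (Y - y = 0)%N by lia.
by rewrite minn0 addr0 subrr subr0.
Qed.

Lemma tile_y_out_s (R : realFieldType) w Y s y : s = 0%N \/ (w <= s)%N ->
  tile_y R w Y s y = 0.
Proof.
move=> ws; rewrite /tile_y; have -> : depth w s = 0%N by rewrite /depth; lia.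
by rewrite !min0n; lra.
Qed.

Lemma tile_x_out_t (R : realFieldType) w Y t y : (w <= t)%N ->
  tile_x R w Y t y = tile_x R w Y w y.
Proof.
move=> wt; rewrite /tile_x (big_cat_nat (leq0n w) wt)//=.
rewrite [X in _ + X]big_nat_cond [X in _ + X]big1 ?addr0// => s /andP[/andP[ws _] _].
by rewrite !tile_y_out_s 1?ltnNge ?ws ?subrr//; right; lia.
Qed.

Lemma tile_x_out (R : realFieldType) w Y t y : (w <= Y)%N \/ (w <= 1)%N ->
  y = 0%N \/ (Y < y)%N -> tile_x R w Y t y = 0.
Proof.
move=> wY yY; rewrite /tile_x big1// => s _.
have [H1 H2] : (y = 0%N \/ (Y <= y)%N) /\ (y.-1 = 0%N \/ (Y <= y.-1)%N).
  by case: yY => [->|yY]; split; (try by left); right; lia.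
have -> : (0 < y <= Y)%N = false by case: yY => [->|yY]; lia.
by rewrite andbF !tile_y_out// !subr0.
Qed.

(** The strip of [w] columns from [u] that spans the full height of the box. *)
Definition strip (R : realFieldType) (u w y0 y1 i j : nat) : R :=
  ((u <= i < u + w) && (y0 <= j < y1))%N%:R.

Lemma shifted_tile_divergence (R : realFieldType) w u y0 y1 i j :
  (w <= y1 - y0)%N \/ (w <= 1)%N ->
  tile_x R w (y1 - y0) (i.+1 - u) (j.+1 - y0)
    - tile_x R w (y1 - y0) (i - u) (j.+1 - y0)
  + (tile_y R w (y1 - y0) (i.+1 - u) (j.+1 - y0)
     - tile_y R w (y1 - y0) (i.+1 - u) (j - y0)) = strip R u w y0 y1 i j.
Proof.
move=> wY; rewrite /strip.
have [jy|jy] := ltnP j y0.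
  have -> : (j.+1 - y0 = 0)%N by lia.
  have -> : (j - y0 = 0)%N by lia.
  rewrite !tile_x_out ?tile_y_out//; try by left.
  by rewrite andbF !subrr addr0.
rewrite (subSn jy).
have [iu|iu] := ltnP i u.
  have -> : (i.+1 - u = i - u)%N by lia.
  have -> : (i - u = 0)%N by lia.
  by rewrite /= !tile_y_out_s ?subrr ?addr0//; left.
rewrite (subSn iu) tile_divergence; congr (_%:R); lia.
Qed.

(** Drain the first strip and run backwards the flow that drains the second one.
    The two outflow profiles on the right are the same and cancel. *)
Lemma boxable_transport (R : realFieldType) x0 x1 y0 y1 u v w :
  (w <= y1 - y0)%N \/ (w <= 1)%N ->
  (x0 <= u)%N -> (u + w <= x1)%N -> (x0 <= v)%N -> (v + w <= x1)%N ->
  boxable x0 x1 y0 y1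
    (fun i j => strip R u w y0 y1 i j - strip R v w y0 y1 i j) 40.
Proof.
move=> wY xu ux xv vx.
exists (fun x y => tile_x R w (y1 - y0) (x - u) (y - y0)
                 - tile_x R w (y1 - y0) (x - v) (y - y0)).
exists (fun x y => tile_y R w (y1 - y0) (x - u) (y - y0)
                 - tile_y R w (y1 - y0) (x - v) (y - y0)).
have C40 C : C <= 20 -> C + C <= 40 :> R by lra.
split.
- move=> x y; rewrite negb_and => /orP[H|H]; last first.
    by rewrite !tile_x_out ?subrr//; lia.
  have [xx|xx] := leqP x x0.
    have -> : (x - u = x - v)%N by lia.
    by rewrite subrr.
  by rewrite !(@tile_x_out_t _ w _ (x - _)) ?subrr//; lia.
- move=> x y; rewrite negb_and => /orP[H|H]; last first.
    by rewrite !tile_y_out ?subrr//; lia.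
  by rewrite !tile_y_out_s ?subrr//; lia.
- move=> i j.
  by rewrite -(shifted_tile_divergence R u i j wY) -(shifted_tile_divergence R v i j wY); ring.
- move=> x; split.
    apply: (@variation_le_weak _ _ (20 + 20)); first by lra.
    by apply: bend_leB; apply: (bend_le_shift (g := tile_x R w (y1 - y0) _)); apply: tile_x_bend_y.
  apply: (@variation_le_weak _ _ (8 + 8)); first by lra.
  by apply: bend_leB; apply: (bend_le_shift (g := tile_y R w (y1 - y0) _)); apply: tile_y_bend_y.
- move=> y; split.
    apply: (@variation_le_weak _ _ (10 + 10)); first by lra.
    by apply: bend_leB; apply: (bend_le_shift (g := fun t => tile_x R w (y1 - y0) t _)); apply: tile_x_bend_t.
  apply: (@variation_le_weak _ _ (16 + 16)); first by lra.
  by apply: bend_leB; apply: (bend_le_shift (g := fun t => tile_y R w (y1 - y0) t _)); apply: tile_y_bend_s.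
Qed.

(** * Haar functions as divergences *)

Lemma strip_cat (R : realFieldType) u w w' y0 y1 i j :
  strip R u (w + w') y0 y1 i j = strip R u w y0 y1 i j + strip R (u + w) w' y0 y1 i j.
Proof. by rewrite /strip -natrD; congr _%:R; lia. Qed.

Lemma sum_strip1 (R : realFieldType) u m y0 y1 i j :
  \sum_(0 <= s < m) strip R (u + s) 1 y0 y1 i j = strip R u m y0 y1 i j.
Proof.
elim: m => [|m IHm]; last by rewrite big_nat_recr//= IHm -strip_cat addn1.
by rewrite big_nil /strip addn0; case: ltngtP => //; rewrite ?andbF.
Qed.

(** Passing from [m] to [m + 1] columns moves a density of order [1 / m^2] from
    each of the [m] columns to the extra one, so the total cost is of order
    [1 / m], like that of a Haar function. *)
Lemma boxable_shrink (R : realFieldType) x0 x1 y0 y1 u m e : (0 < m)%N ->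
  (x0 <= u)%N -> (u + m <= x1)%N -> (x0 <= e < x1)%N ->
  boxable x0 x1 y0 y1
    (fun i j => (strip R u m y0 y1 i j + strip R e 1 y0 y1 i j) / m.+1%:R
                - strip R u m y0 y1 i j / m%:R) (40 / m.+1%:R).
Proof.
move=> m0 xu ux ex.
have H s : (s < m)%N -> boxable x0 x1 y0 y1 (fun i j =>
    strip R e 1 y0 y1 i j - strip R (u + s) 1 y0 y1 i j) 40.
  by move=> sm; apply: boxable_transport; lia.
have mN : m%:R != 0 :> R by rewrite pnatr_eq0; lia.
have mN1 : m%:R + 1 != 0 :> R by rewrite natr1 pnatr_eq0.
apply: boxable_ext (boxableZ ((m%:R * m.+1%:R)^-1) (boxable_sum H)).
- move=> i j; rewrite big_split/= sumrN sum_strip1 sumr_const_nat subn0 -natr1 -mulr_natl; field.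
  by rewrite ?[1 + _]addrC mN1 mN.
- rewrite ger0_norm ?invr_ge0 ?mulr_ge0// -natr1 le_eqVlt; apply/orP; left; apply/eqP; field.
  by rewrite ?[1 + _]addrC mN1 mN.
Qed.

Definition haar (R : realFieldType) (x0 xm x1 y0 y1 i j : nat) : R :=
  strip R x0 (xm - x0) y0 y1 i j / (xm - x0)%:R
  - strip R xm (x1 - xm) y0 y1 i j / (x1 - xm)%:R.

(** The two halves are strips of the same height whose widths differ by at most
    one column.  The bulk is moved by tiles, the odd column by
    [boxable_shrink]. *)
Lemma boxable_haar (R : realFieldType) x0 xm x1 y0 y1 :
  (x0 < xm < x1)%N -> (xm - x0 <= (x1 - xm).+1)%N -> (x1 - xm <= (xm - x0).+1)%N ->
  (xm - x0 <= (y1 - y0).+1)%N ->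
  boxable x0 x1 y0 y1 (haar R x0 xm x1 y0 y1)
    (120 * ((xm - x0)%:R^-1 + (x1 - xm)%:R^-1)).
Proof.
move=> xmx ab ba aY; rewrite /haar.
(* the halves are compared with strips of the common width m; each of these is
   moved in two parts, because a tile may not be wider than high *)
pose m := minn (xm - x0) (x1 - xm).
pose w := minn m (y1 - y0).
have m0 : (0 < m)%N by rewrite /m; lia.
have Hm : boxable x0 x1 y0 y1 (fun i j => m%:R^-1 *
    (strip R (xm - m) m y0 y1 i j - strip R xm m y0 y1 i j)) (m%:R^-1 * 80).
  have H1 : boxable x0 x1 y0 y1 (fun i j =>
      strip R (xm - m) w y0 y1 i j - strip R xm w y0 y1 i j) 40.
    by apply: boxable_transport; rewrite /w /m; lia.
  have H2 : boxable x0 x1 y0 y1 (fun i j =>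
      strip R (xm - m + w) (m - w) y0 y1 i j - strip R (xm + w) (m - w) y0 y1 i j) 40.
    by apply: boxable_transport; rewrite /w /m; lia.
  apply: boxable_ext (boxableZ m%:R^-1 (boxableD H1 H2)).
    move=> i j.
    have E u : strip R u m y0 y1 i j =
        strip R u w y0 y1 i j + strip R (u + w) (m - w) y0 y1 i j.
      by rewrite -strip_cat subnKC// geq_minl.
    by rewrite !E; ring.
  by rewrite ger0_norm ?invr_ge0//; lra.
have HA : boxable x0 x1 y0 y1 (fun i j =>
    strip R x0 (xm - x0) y0 y1 i j / (xm - x0)%:R
    - strip R (xm - m) m y0 y1 i j / m%:R) (40 / (xm - x0)%:R).
  have [am|am] := eqVneq m (xm - x0)%N.
    apply: boxable_ext (boxable0 R _ _ _ _); last by rewrite divr_ge0.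
    by move=> i j; rewrite am (_ : xm - (xm - x0) = x0)%N ?subrr//; lia.
  have am1 : (xm - x0 = m.+1)%N by rewrite /m in am *; lia.
  rewrite am1; apply: boxable_ext (@boxable_shrink R x0 x1 y0 y1 x0.+1 m x0 _ _ _ _) => //; try lia.
  move=> i j; have -> : (xm - m = x0.+1)%N by lia.
  by rewrite -[m.+1]add1n strip_cat addn1 [_ + strip _ x0 _ _ _ _ _]addrC.
have HB : boxable x0 x1 y0 y1 (fun i j =>
    strip R xm (x1 - xm) y0 y1 i j / (x1 - xm)%:R
    - strip R xm m y0 y1 i j / m%:R) (40 / (x1 - xm)%:R).
  have [bm|bm] := eqVneq m (x1 - xm)%N.
    apply: boxable_ext (boxable0 R _ _ _ _); last by rewrite divr_ge0.
    by move=> i j; rewrite bm subrr.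
  have bm1 : (x1 - xm = m.+1)%N by rewrite /m in bm *; lia.
  rewrite bm1; apply: boxable_ext (@boxable_shrink R x0 x1 y0 y1 xm m (xm + m) _ _ _ _) => //; try lia.
  by move=> i j; rewrite -[m.+1]addn1 strip_cat.
apply: boxable_ext (boxableD Hm (boxableD HA (boxableZ (-1) HB))).
  by move=> i j; lra.
rewrite normrN1 mul1r.
have : m%:R^-1 <= (xm - x0)%:R^-1 + (x1 - xm)%:R^-1 :> R.
  have [E|E] : m = (xm - x0)%N \/ m = (x1 - xm)%N by rewrite /m; lia.
    by rewrite E lerDl invr_ge0.
  by rewrite E lerDr invr_ge0.
by lra.
Qed.

(** * Almost orthogonality of levels *)

Lemma sum_by_label (R : realFieldType) (n L : nat) (mu : nat -> nat) (F : nat -> R) :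
  (forall k, (k < n)%N -> (mu k < L)%N) ->
  \sum_(0 <= k < n) F k = \sum_(0 <= l < L) \sum_(0 <= k < n | mu k == l) F k.
Proof.
move=> muL; rewrite (exchange_big_dep_nat predT)//=.
rewrite big_nat_cond [RHS]big_nat_cond; apply: eq_bigr => k /andP[/andP[_ kn] _].
rewrite (eq_bigl (fun l => l == mu k)); last by move=> l; rewrite eq_sym.
by rewrite big_nat1_eq leq0n muL.
Qed.

(** The zero values of [h] at both ends remove the boundary terms. *)
Lemma sum_by_parts (R : realFieldType) n (g h : nat -> R) :
  h 0%N = 0 -> h n.+1 = 0 ->
  \sum_(0 <= k < n.+1) slope g k * slope h k
  = - \sum_(0 <= k < n) (slope g k.+1 - slope g k) * h k.+1.
Proof.
move=> h0 hn.
suff H m : \sum_(0 <= k < m.+1) slope g k * slope h k =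
   slope g m * h m.+1 - \sum_(0 <= k < m) (slope g k.+1 - slope g k) * h k.+1.
  by rewrite H hn mulr0 sub0r.
elim: m => [|m IHm].
  by rewrite big_nat1 big_nil subr0 /slope h0 subr0.
by rewrite big_nat_recr//= IHm big_nat_recr//= /slope; ring.
Qed.

(** A monotone label leaves each of its values at most once. *)
Lemma count_last (n l : nat) (mu : nat -> nat) :
  {homo mu : i j / (i <= j)%N} ->
  (\sum_(0 <= k < n | mu k == l) (mu k.+1 != mu k) <= 1)%N.
Proof.
move=> mu_homo; suff : (\sum_(0 <= k < n | mu k == l) (mu k.+1 != mu k) <= (l < mu n))%N.
  by move=> /leq_trans; apply; case: (_ < _)%N.
rewrite big_mkcond; elim: n => [|n IHn]; first by rewrite big_nil.
have := mu_homo n n.+1 (leqnSn n).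
rewrite big_nat_recr//=; move: IHn; set s := \sum_(_ <= _ < _) _.
by case: (mu n =P l); lia.
Qed.

(** A monotone label enters each of its values at most once. *)
Lemma count_first (n l : nat) (mu : nat -> nat) :
  {homo mu : i j / (i <= j)%N} ->
  (\sum_(0 <= k < n | mu k == l) ((0 < k) && (mu k.-1 != mu k)) <= 1)%N.
Proof.
move=> mu_homo; suff : (\sum_(0 <= k < n | mu k == l) ((0 < k) && (mu k.-1 != mu k))
    <= ((0 < n) && (l <= mu n.-1)))%N.
  by move=> /leq_trans; apply; case: (_ && _)%N.
rewrite big_mkcond; elim: n => [|n IHn]; first by rewrite big_nil.
have := mu_homo n.-1 n (leq_pred n).
rewrite big_nat_recr//=; case: n IHn => [|n] IHn.
  by rewrite big_nil; case: eqP; lia.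
by case: eqP; move: IHn => /=; lia.
Qed.

Lemma sum_pick_le (R : realFieldType) (L m : nat) (x : R) : 0 <= x ->
  \sum_(0 <= l < L) (l == m)%:R * x <= x.
Proof.
move=> x0; rewrite (eq_bigr (fun l => if l == m then x else 0)); last first.
  by move=> l _; case: eqP => _; rewrite ?mul1r ?mul0r.
by rewrite -big_mkcond big_nat1_eq; case: ifP.
Qed.

(** Summation by parts puts the second difference on the coarse field, which has
    total mass at most [C * A l] on the coarse piece [l].  The product is split by Young's
    inequality with weight the absolute second difference: one half sums to the
    [A l ^+ 2], the other is the square of [h] against a measure whose mass on
    each fine piece is at most [3 * C], since a fine piece lies in one coarse
    piece and is touched only at its two ends by the neighbouring ones. *)
Lemma coarse_fine_coupling (R : realFieldType) (n L L' : nat)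
    (lam mu : nat -> nat) (g : nat -> nat -> R) (h A H : nat -> R) (C tau : R) :
  {homo lam : i j / (i <= j)%N} -> {homo mu : i j / (i <= j)%N} ->
  (forall i j, mu i = mu j -> lam i = lam j) ->
  (forall k, (k < n)%N -> (lam k < L)%N) -> (forall k, (k < n)%N -> (mu k < L')%N) ->
  (forall l y, ~~ [&& 0 < y, y <= n & lam y.-1 == l]%N -> g l y = 0) ->
  (forall l, 0 <= A l) -> (forall l, bend_le (g l) (C * A l)) ->
  h 0%N = 0 -> h n.+1 = 0 -> (forall k, (k < n)%N -> `|h k.+1| <= H (mu k)) ->
  0 <= C -> 0 < tau ->
  `| \sum_(0 <= k < n.+1) slope (fun y => \sum_(0 <= l < L) g l y) k * slope h k |
  <= C / 2 * (tau * \sum_(0 <= l < L) A l ^+ 2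
              + 3 / tau * \sum_(0 <= l < L') H l ^+ 2).
Proof.
move=> lam_homo mu_homo nested lamL muL g0 A0 gC h0 hn hH C0 tau0.
pose D l k := slope (g l) k.+1 - slope (g l) k.
have DS k : slope (fun y => \sum_(0 <= l < L) g l y) k.+1
    - slope (fun y => \sum_(0 <= l < L) g l y) k = \sum_(0 <= l < L) D l k.
  by rewrite /slope -!sumrB.
rewrite sum_by_parts// normrN.
under eq_bigr do rewrite DS mulr_suml.
have Dsum l : \sum_(0 <= k < n) `|D l k| <= C * A l.
  by apply: le_trans (gC l n); rewrite lerDr.
have Dbound l k : `|D l k| <= C * A l.
  apply: le_trans (gC l k.+1).
  by rewrite /variation_sum big_nat_recr//= addrA lerDr addr_ge0// sumr_ge0.
have gbound l k : `|slope (g l) k| <= C * A l by apply: variation_le_bound (gC l).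
(* second differences normalised by the size of their coarse piece *)
pose W l k := `|D l k| / A l.
have AM l k x : `|D l k * x| <= 2^-1 * (tau * (A l * `|D l k|) + tau^-1 * (W l k * x ^+ 2)).
  rewrite normrM /W; have [Al|Al] := eqVneq (A l) 0.
    have := Dbound l k; rewrite Al mulr0 normr_le0 => /eqP ->.
    by rewrite normr0 !(mul0r, mulr0, addr0).
  have Alp : 0 < A l by rewrite lt_neqAle eq_sym Al A0.
  have -> : x ^+ 2 = `|x| ^+ 2 by rewrite real_normK ?num_real.
  rewrite -subr_ge0.
  have -> : 2^-1 * (tau * (A l * `|D l k|) + tau^-1 * (`|D l k| / A l * `|x| ^+ 2))
     - `|D l k| * `|x| = 2^-1 * `|D l k| * (tau * A l)^-1 * (tau * A l - `|x|) ^+ 2.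
    by field; rewrite Al (gt_eqF tau0).
  apply: mulr_ge0; last exact: sqr_ge0.
  by apply: mulr_ge0; rewrite ?invr_ge0 mulr_ge0 ?invr_ge0 ?(ltW tau0).
have W0 l k : 0 <= W l k by rewrite /W divr_ge0.
have Wk k : (k < n)%N -> \sum_(0 <= l < L) W l k <= W (lam k) k
    + C * (lam k.+1 != lam k)%:R + C * ((0 < k)%N && (lam k.-1 != lam k))%:R.
  move=> kn; apply: (@le_trans _ _ (\sum_(0 <= l < L) ((l == lam k)%:R * W (lam k) k
    + (l == lam k.+1)%:R * (C * (lam k.+1 != lam k)%:R)
    + (l == lam k.-1)%:R * (C * ((0 < k)%N && (lam k.-1 != lam k))%:R)))); last first.
    rewrite !big_split/=; apply: lerD; [apply: lerD|]; apply: sum_pick_le; by [exact: W0|apply: mulr_ge0].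
  apply: ler_sum => l _; have [->|lk] := eqVneq l (lam k).
    by rewrite mul1r -addrA lerDl addr_ge0// !mulr_ge0.
  rewrite mul0r add0r.
  have gk : g l k.+1 = 0 by rewrite g0// eq_sym (negPf lk) !andbF.
  have gSk : `|g l k.+2| <= C * A l * ((l == lam k.+1) && (lam k.+1 != lam k))%:R.
    have [E|E] := boolP (l == lam k.+1); last first.
      by rewrite mulr0 normr_le0 g0// eq_sym (negPf E) !andbF.
    rewrite -(eqP E) lk mulr1.
    by have := gbound l k.+1; rewrite /slope gk subr0.
  have gPk : `|g l k| <= C * A l * ((l == lam k.-1) && ((0 < k)%N && (lam k.-1 != lam k)))%:R.
    have [E|E] := boolP ((0 < k)%N && (l == lam k.-1)); last first.
      rewrite g0 ?normr0 ?mulr_ge0//; apply: contra E => /and3P[-> _ /eqP ->].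
      by rewrite eqxx.
    move: E => /andP[-> /eqP E]; rewrite -E eqxx lk mulr1.
    by have := gbound l k; rewrite /slope gk sub0r normrN.
  have DA : `|D l k| <= A l * ((l == lam k.+1)%:R * (C * (lam k.+1 != lam k)%:R)
    + (l == lam k.-1)%:R * (C * ((0 < k)%N && (lam k.-1 != lam k))%:R)).
    have -> : D l k = g l k.+2 + g l k by rewrite /D /slope gk subr0 sub0r opprK.
    apply: le_trans (ler_normD _ _) _; apply: le_trans (lerD gSk gPk) _.
    rewrite -!mulnb !natrM le_eqVlt; apply/orP; left; apply/eqP; ring.
  rewrite /W; have [Al|Al] := eqVneq (A l) 0.
    by rewrite Al invr0 mulr0 addr_ge0// !mulr_ge0.
  by rewrite ler_pdivrMr 1?mulrC// lt_neqAle eq_sym Al A0.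
have Wsum l' : \sum_(0 <= k < n | mu k == l') \sum_(0 <= l < L) W l k <= 3 * C.
  apply: (@le_trans _ _ (\sum_(0 <= k < n | mu k == l') (W (lam k) k
    + C * (lam k.+1 != lam k)%:R + C * ((0 < k)%N && (lam k.-1 != lam k))%:R))).
    by rewrite big_nat_cond [leRHS]big_nat_cond; apply: ler_sum => k /andP[/andP[_ kn] _]; apply: Wk.
  have -> : 3 * C = C + C * 1 + C * 1 by ring.
  rewrite !big_split/= -!mulr_sumr !lerD ?ler_wpM2l//; last 2 first.
  - apply: (@le_trans _ _ (\sum_(0 <= k < n | mu k == l') (mu k.+1 != mu k))%N%:R).
      rewrite natr_sum; apply: ler_sum => k _; rewrite ler_nat.
      by case: (eqVneq (mu k.+1) (mu k)) => [/nested ->|_]; rewrite ?eqxx ?leq_b1.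
    by rewrite (ler_nat _ _ 1) count_last.
  - apply: (@le_trans _ _ (\sum_(0 <= k < n | mu k == l') ((0 < k) && (mu k.-1 != mu k)))%N%:R).
      rewrite natr_sum; apply: ler_sum => k _; rewrite ler_nat.
      by case: (eqVneq (mu k.-1) (mu k)) => [/nested ->|_]; rewrite ?eqxx ?andbF//; case: (0 < k)%N; rewrite /= ?leq_b1.
    by rewrite (ler_nat _ _ 1) count_first.
  have [/existsP[k0 /eqP k0l]|/existsPn noK] := boolP [exists k : 'I_n, mu k == l'].
    apply: (@le_trans _ _ (\sum_(0 <= k < n | mu k == l') W (lam k0) k)).
      by apply: ler_sum => k /eqP kl; rewrite (nested k k0)// kl k0l.
    apply: (@le_trans _ _ (\sum_(0 <= k < n) W (lam k0) k)).
      by rewrite big_mkcond; apply: ler_sum => k _; case: ifP.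
    rewrite -mulr_suml; have [Al|Al] := eqVneq (A (lam k0)) 0.
      by rewrite Al invr0 mulr0.
    by rewrite ler_pdivrMr ?Dsum// lt_neqAle eq_sym Al A0.
  rewrite big_nat_cond big1// => k /andP[/andP[_ kn] kl].
  by have := noK (Ordinal kn); rewrite kl.
apply: le_trans (ler_norm_sum _ _ _) _.
apply: (@le_trans _ _ (\sum_(0 <= k < n) \sum_(0 <= l < L)
   2^-1 * (tau * (A l * `|D l k|) + tau^-1 * (W l k * h k.+1 ^+ 2)))).
  apply: ler_sum => k _; apply: le_trans (ler_norm_sum _ _ _) _.
  by apply: ler_sum => l _; apply: AM.
under eq_bigr do rewrite -mulr_sumr big_split/= -!mulr_sumr.
rewrite -mulr_sumr big_split/= -!mulr_sumr.
set Y := (X in C / 2 * X); have -> : C / 2 * Y = 2^-1 * (C * Y) by ring.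
rewrite ler_wpM2l ?invr_ge0// /Y {Y}.
rewrite mulrDr lerD//.
  rewrite mulrCA ler_wpM2l ?(ltW tau0)// exchange_big/= mulr_sumr.
  apply: ler_sum => l _; rewrite -mulr_sumr expr2 mulrCA ler_wpM2l//.
have -> : C * (3 / tau * \sum_(0 <= l < L') H l ^+ 2) = tau^-1 * \sum_(0 <= l < L') 3 * C * H l ^+ 2.
  by rewrite -mulr_sumr; ring.
rewrite ler_wpM2l ?invr_ge0 ?(ltW tau0)// (sum_by_label (L := L') (mu := mu))//.
apply: ler_sum => l _.
apply: (@le_trans _ _ (\sum_(0 <= k < n | mu k == l) (\sum_(0 <= l0 < L) W l0 k) * H l ^+ 2)).
  rewrite big_nat_cond [leRHS]big_nat_cond; apply: ler_sum => k /andP[/andP[_ kn] /eqP kl].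
  rewrite -mulr_suml ler_wpM2l ?sumr_ge0//.
  rewrite -[h _ ^+ 2]real_normK ?num_real// lerXn2r ?nnegrE// -?kl ?hH//.
  exact: le_trans (hH _ kn).
by rewrite -mulr_suml ler_wpM2r ?sqr_ge0.
Qed.

Lemma sum_geometric_dist (R : realFieldType) (J i : nat) :
  \sum_(0 <= j < J) (3 / 4) ^+ (i - j + (j - i)) <= 8 :> R.
Proof.
have q0 (k : nat) : 0 <= (3 / 4) ^+ k :> R by rewrite exprn_ge0//; lra.
have H1 m : (m <= i.+1)%N ->
    \sum_(0 <= j < m) (3 / 4) ^+ (i - j + (j - i)) <= 4 * (3 / 4) ^+ (i.+1 - m) :> R.
  elim: m => [|m IHm] mi; first by rewrite big_nil mulr_ge0.
  rewrite big_nat_recr//=; apply: le_trans (lerD (IHm _) (lexx _)) _; first by lia.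
  have -> : (i - m + (m - i) = i - m)%N by lia.
  have -> : (i.+1 - m = (i - m).+1)%N by lia.
  by rewrite subSS exprS; have := q0 (i - m)%N; lra.
have H2 d : \sum_(0 <= j < i.+1 + d) (3 / 4) ^+ (i - j + (j - i)) <= 8 - 4 * (3 / 4) ^+ d :> R.
  elim: d => [|d IHd].
    by rewrite addn0; apply: le_trans (H1 _ _) _; rewrite // subnn expr0; lra.
  rewrite addnS big_nat_recr//=; apply: le_trans (lerD IHd (lexx _)) _.
  have -> : (i - (i.+1 + d) + (i.+1 + d - i) = d.+1)%N by lia.
  by rewrite exprS; have := q0 d; lra.
have [Ji|iJ] := leqP J i.+1.
  apply: le_trans (H1 _ Ji) _.
  have : (3 / 4) ^+ (i.+1 - J) <= 1 :> R by rewrite exprn_ile1//; lra.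
  by lra.
have := H2 (J - i.+1)%N; rewrite subnKC ?(ltnW iJ)//.
by have := q0 (J - i.+1)%N; lra.
Qed.

(** The slopes of different levels are almost orthogonal: by
    [coarse_fine_coupling] the interaction of levels [i] and [i + d] is at most
    a constant times [(3 / 4) ^+ d] times the sum of their energies, and the
    rows of this matrix have bounded sums.  A field on a piece of length [ell]
    with slope of order [A] has size [ell * A], which is where the powers of 2
    are gained. *)
Lemma multilevel_energy (R : realFieldType) (n J : nat) (L : nat -> nat)
    (lam : nat -> nat -> nat) (g : nat -> nat -> nat -> R) (A : nat -> nat -> R)
    (ell : nat -> R) (C C2 : R) :
  (forall j, {homo lam j : x y / (x <= y)%N}) ->
  (forall i j x y, (i <= j)%N -> lam j x = lam j y -> lam i x = lam i y) ->
  (forall j k, (k < n)%N -> (lam j k < L j)%N) ->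
  (forall j l y, ~~ [&& 0 < y, y <= n & lam j y.-1 == l]%N -> g j l y = 0) ->
  (forall j l, 0 <= A j l) -> (forall j l, bend_le (g j l) (C * A j l)) ->
  (forall j k, (k < n)%N -> `|g j (lam j k) k.+1| <= C2 * ell j * A j (lam j k)) ->
  0 <= C -> 1 <= C2 -> (forall j, 0 < ell j) ->
  (forall i d, ell i = 2 ^+ d * ell (i + d)%N) ->
  \sum_(0 <= k < n.+1)
    slope (fun y => \sum_(0 <= j < J) \sum_(0 <= l < L j) g j l y) k ^+ 2
  <= 24 * C * C2 ^+ 2 * \sum_(0 <= j < J) ell j * \sum_(0 <= l < L j) A j l ^+ 2.
Proof.
move=> homo nested lamL g0 A0 gC gC2 C0 C21 ell0 ellE.
pose G j y := \sum_(0 <= l < L j) g j l y.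
pose a j := ell j * \sum_(0 <= l < L j) A j l ^+ 2.
have a0 j : 0 <= a j.
  by rewrite mulr_ge0 ?(ltW (ell0 j))// sumr_ge0// => l _; rewrite sqr_ge0.
have G_at j k : (k < n)%N -> G j k.+1 = g j (lam j k) k.+1.
  move=> kn; rewrite /G (bigD1_seq (lam j k)) ?iota_uniq ?mem_index_iota ?lamL//=.
  by rewrite big1 ?addr0// => l lk; rewrite g0//= eq_sym (negPf lk) andbF.
have G_0 j y : ~~ (0 < y <= n)%N -> G j y = 0.
  move=> yn; rewrite /G big1// => l _; rewrite g0//.
  by apply: contra yn => /and3P[-> ->].
have pair i d : `| \sum_(0 <= k < n.+1) slope (G i) k * slope (G (i + d)%N) k |
    <= 3 / 2 * C * C2 ^+ 2 * (3 / 4) ^+ d * (a i + a (i + d)%N).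
  (* any weight between ell (i + d) and ell i = 2^d ell (i + d) gives a geometric
     gain on both sides; the base 3/2 yields the ratios 3/4 and 2/3 *)
  have tau0 : 0 < (3 / 2) ^+ d * ell (i + d)%N by rewrite mulr_gt0// exprn_gt0//; lra.
  have := @coarse_fine_coupling R n (L i) (L (i + d)%N) (lam i) (lam (i + d)%N) (g i)
    (G (i + d)%N) (A i) (fun l => C2 * ell (i + d)%N * A (i + d)%N l) C _
    (homo i) (homo (i + d)%N) (fun x y => nested i (i + d)%N x y (leq_addr d i))
    (lamL i) (lamL (i + d)%N) (g0 i) (A0 i) (gC i) _ _ _ C0 tau0.
  move=> /(_ (G_0 _ _ _) (G_0 _ _ _) _)/le_trans; apply => //.
  - by rewrite ltnn andbF.
  - by move=> k kn; rewrite G_at// gC2.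
  have -> : \sum_(0 <= l < L (i + d)%N) (C2 * ell (i + d)%N * A (i + d)%N l) ^+ 2
      = (C2 * ell (i + d)%N) ^+ 2 * \sum_(0 <= l < L (i + d)%N) A (i + d)%N l ^+ 2.
    by rewrite mulr_sumr; apply: eq_bigr => l _; rewrite exprMn.
  have := a0 i; have := a0 (i + d)%N; rewrite /a.
  set S := \sum_(_ <= _ < L i) _; set S' := \sum_(_ <= _ < _) _; set e := ell (i + d)%N in tau0 *.
  rewrite (ellE i d) -/e => aid ai.
  have e0 : 0 < e by apply: ell0.
  have p2 : 0 < 2 ^+ d :> R by rewrite exprn_gt0.
  have p3 : 0 < 3 ^+ d :> R by rewrite exprn_gt0.
  have p4 : 4 ^+ d = 2 ^+ d * 2 ^+ d :> R by rewrite -exprMn; congr (_ ^+ _); ring.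
  have -> : (3 / 2) ^+ d * e * S = (3 / 4) ^+ d * (2 ^+ d * e * S).
    by rewrite !expr_div_n p4; field; rewrite gt_eqF.
  have -> : 3 / ((3 / 2) ^+ d * e) * ((C2 * e) ^+ 2 * S') = 3 * C2 ^+ 2 * (2 / 3) ^+ d * (e * S').
    by rewrite !expr_div_n; field; rewrite !gt_eqF.
  have r23 : (2 / 3) ^+ d <= (3 / 4) ^+ d :> R by apply: lerXn2r; rewrite ?nnegrE; lra.
  have C22 : 1 <= C2 ^+ 2 by rewrite exprn_ege1.
  set x := (3 / 4) ^+ d in r23 *.
  have x0 : 0 <= x by rewrite exprn_ge0//; lra.
  have -> : 3 / 2 * C * C2 ^+ 2 * x * (2 ^+ d * e * S + e * S') =
     C / 2 * (3 * C2 ^+ 2 * (x * (2 ^+ d * e * S)) + 3 * C2 ^+ 2 * x * (e * S')) by field.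
  rewrite ler_wpM2l ?divr_ge0// lerD//.
    by apply: ler_peMl; [exact: mulr_ge0|lra].
  by rewrite ler_wpM2r// ler_wpM2l//; lra.
have pair' i j : `| \sum_(0 <= k < n.+1) slope (G i) k * slope (G j) k |
    <= 3 / 2 * C * C2 ^+ 2 * (3 / 4) ^+ (i - j + (j - i)) * (a i + a j).
  have [ij|/ltnW ji] := leqP i j.
    have := pair i (j - i)%N; rewrite subnKC//.
    by have -> : (i - j + (j - i) = j - i)%N by lia.
  have := pair j (i - j)%N; rewrite subnKC//.
  have -> : (i - j + (j - i) = i - j)%N by lia.
  by rewrite [a j + _]addrC; under eq_bigr do rewrite mulrC.
have -> : \sum_(0 <= k < n.+1)
    slope (fun y => \sum_(0 <= j < J) \sum_(0 <= l < L j) g j l y) k ^+ 2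
  = \sum_(0 <= i < J) \sum_(0 <= j < J) \sum_(0 <= k < n.+1) slope (G i) k * slope (G j) k.
  under [RHS]eq_bigr do rewrite exchange_big/=.
  rewrite exchange_big/=; apply: eq_bigr => k _.
  rewrite expr2 /slope -!sumrB mulr_suml; apply: eq_bigr => i _.
  by rewrite mulr_sumr.
apply: (@le_trans _ _ (\sum_(0 <= i < J) \sum_(0 <= j < J)
   3 / 2 * C * C2 ^+ 2 * ((3 / 4) ^+ (i - j + (j - i)) * a i + (3 / 4) ^+ (j - i + (i - j)) * a j))).
  apply: ler_sum => i _; apply: ler_sum => j _; apply: le_trans (ler_norm _) _.
  by apply: le_trans (pair' i j) _; rewrite [(j - i + _)%N]addnC -mulrDr mulrA.
under eq_bigr do rewrite -mulr_sumr big_split/= -mulr_suml.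
rewrite -mulr_sumr big_split/= [X in _ + X]exchange_big/=.
under [X in _ + X]eq_bigr do rewrite -mulr_suml.
have -> : 24 * C * C2 ^+ 2 * (\sum_(0 <= j < J) a j) =
   3 / 2 * C * C2 ^+ 2 * ((\sum_(0 <= j < J) 8 * a j) + (\sum_(0 <= j < J) 8 * a j)).
  by rewrite -!mulr_sumr; field.
apply: ler_wpM2l; first by rewrite mulr_ge0 ?sqr_ge0// mulr_ge0// divr_ge0.
by apply: lerD; apply: ler_sum => i _; apply: ler_wpM2r; rewrite ?sum_geometric_dist ?a0.
Qed.

(** * Nearly dyadic partitions of an interval of integers *)

(** The dyadic interval of length [2^-j] that contains [k / n].  Such labels are
    nested for every [n], and not only for powers of 2. *)
Definition dyadic_label (n j k : nat) : nat := ((k * 2 ^ j) %/ n)%N.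

(** The rounded up quotient of [l * n] by [2 ^ j], the first point with label [l]. *)
Definition dyadic_break (n j l : nat) : nat := ((l * n + 2 ^ j).-1 %/ 2 ^ j)%N.

Lemma pow2_gt0 j : (0 < 2 ^ j)%N. Proof. by rewrite expn_gt0. Qed.

(** Galois connection between labels and first points. *)
Lemma leq_dyadic_label n j k l : (0 < n)%N -> (l <= dyadic_label n j k)%N = (dyadic_break n j l <= k)%N.
Proof.
move=> n0; have j0 := pow2_gt0 j.
by rewrite /dyadic_label /dyadic_break leq_divRL// -[RHS]ltnS ltn_divLR// mulSn; lia.
Qed.

Lemma dyadic_label_eq n j k l : (0 < n)%N ->
  (dyadic_label n j k == l) = (dyadic_break n j l <= k < dyadic_break n j l.+1)%N.
Proof.
by move=> n0; rewrite -leq_dyadic_label// ltnNge -leq_dyadic_label// -ltnNge ltnS andbC eqn_leq.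
Qed.

Lemma dyadic_label_homo n j : {homo dyadic_label n j : x y / (x <= y)%N}.
Proof. by move=> x y xy; rewrite /dyadic_label leq_div2r// leq_mul2r xy orbT. Qed.

Lemma dyadic_label_half n j k : (dyadic_label n j.+1 k %/ 2 = dyadic_label n j k)%N.
Proof. by rewrite /dyadic_label -divnMA expnSr mulnA divnMr. Qed.

Lemma dyadic_label_nested n i j x y : (i <= j)%N -> dyadic_label n j x = dyadic_label n j y ->
  dyadic_label n i x = dyadic_label n i y.
Proof.
move=> ij; rewrite -(subnKC ij); elim: (j - i)%N => [|d IHd].
  by rewrite addn0.
by rewrite addnS => E; apply: IHd; rewrite -[LHS]dyadic_label_half -[RHS]dyadic_label_half E.
Qed.

Lemma dyadic_label_lt n j k : (k < n)%N -> (dyadic_label n j k < 2 ^ j)%N.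
Proof.
move=> kn; rewrite /dyadic_label ltn_divLR; last by lia.
by rewrite mulnC ltn_pmul2l ?pow2_gt0.
Qed.

Lemma dyadic_break0 n j : dyadic_break n j 0 = 0%N.
Proof. by rewrite /dyadic_break mul0n add0n divn_small// prednK ?pow2_gt0. Qed.

Lemma dyadic_break_double n j l : dyadic_break n j.+1 l.*2 = dyadic_break n j l.
Proof.
have j0 := pow2_gt0 j.
rewrite /dyadic_break expnS -[X in _ = X](divnMl (p := 2))//.
have -> : ((l.*2 * n + 2 * 2 ^ j).-1 = (l * n + 2 ^ j).-1 * 2 + 1)%N by lia.
by rewrite divnMA divnDl ?dvdn_mull// mulnK// addn0 divnMl.
Qed.

(** The lengths of the intervals of one level differ by at most one; this is
    what keeps all constants independent of [n]. *)
Lemma dyadic_break_size n j l : (0 < n)%N ->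
  (dyadic_break n j l + n %/ 2 ^ j <= dyadic_break n j l.+1 <= dyadic_break n j l + (n %/ 2 ^ j).+1)%N.
Proof.
move=> n0; have j0 := pow2_gt0 j; rewrite /dyadic_break.
have E : ((l.+1 * n + 2 ^ j).-1 = (l * n + 2 ^ j).-1 + n)%N by lia.
rewrite E; move: (l * n + 2 ^ j).-1%N => a; rewrite divnD//.
by case: (2 ^ j <= a %% 2 ^ j + n %% 2 ^ j)%N; rewrite /= ?addn0 ?addn1; lia.
Qed.

Lemma dyadic_break_max n j : dyadic_break n j (2 ^ j) = n.
Proof.
have j0 := pow2_gt0 j; rewrite /dyadic_break.
have -> : ((2 ^ j * n + 2 ^ j).-1 = n * 2 ^ j + (2 ^ j).-1)%N by lia.
by rewrite divnMDl// divn_small ?addn0// prednK.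
Qed.

Lemma card_dyadic_label (R : realFieldType) n j (F : nat -> R) : (0 < n)%N ->
  \sum_(0 <= k < n) F (dyadic_label n j k)
  = \sum_(0 <= l < 2 ^ j) (dyadic_break n j l.+1 - dyadic_break n j l)%:R * F l.
Proof.
move=> n0.
have homo : {homo dyadic_break n j : x y / (x <= y)%N}.
  apply: homo_leq => // [x y z|l]; first exact: leq_trans.
  by have /andP[H _] := dyadic_break_size j l n0; apply: leq_trans H; apply: leq_addr.
have H m : (m <= 2 ^ j)%N -> \sum_(0 <= k < dyadic_break n j m) F (dyadic_label n j k)
    = \sum_(0 <= l < m) (dyadic_break n j l.+1 - dyadic_break n j l)%:R * F l.
  elim: m => [|m IHm] mj; first by rewrite dyadic_break0 !big_nil.
  rewrite big_nat_recr//= -IHm ?(ltnW mj)//.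
  rewrite (big_cat_nat (leq0n (dyadic_break n j m)) (homo _ _ (leqnSn m)))/=; congr (_ + _).
  rewrite mulr_natl -sumr_const_nat big_nat_cond [RHS]big_nat_cond.
  apply: eq_bigr => k /andP[km _]; congr F; apply/eqP; rewrite dyadic_label_eq//.
by rewrite -H// dyadic_break_max.
Qed.

(** On a given line only one column of boxes per level is met, so that the
    two-dimensional family reduces to the one-dimensional [multilevel_energy]. *)
Lemma family_energy (R : realFieldType) (n J : nat) (La Lb : nat -> nat)
    (al be : nat -> nat -> nat) (H : nat -> nat -> nat -> nat -> nat -> R)
    (A : nat -> nat -> nat -> R) (ell : nat -> R) (C C2 : R) :
  (forall j, {homo be j : x y / (x <= y)%N}) ->
  (forall i j x y, (i <= j)%N -> be j x = be j y -> be i x = be i y) ->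
  (forall j k, (k < n)%N -> (al j k < La j)%N) ->
  (forall j k, (k < n)%N -> (be j k < Lb j)%N) ->
  (forall j l m x y, ~~ [&& 0 < x, x <= n, al j x.-1 == l, 0 < y, y <= n & be j y.-1 == m]%N ->
     H j l m x y = 0) ->
  (forall j l m, 0 <= A j l m) ->
  (forall j l m x, bend_le (H j l m x) (C * A j l m)) ->
  (forall j l m x y, `|H j l m x y| <= C2 * ell j * A j l m) ->
  0 <= C -> 1 <= C2 -> (forall j, 0 < ell j) ->
  (forall i d, ell i = 2 ^+ d * ell (i + d)%N) ->
  \sum_(0 <= x < n) \sum_(0 <= k < n.+1)
    slope (fun y => \sum_(0 <= j < J) \sum_(0 <= l < La j) \sum_(0 <= m < Lb j) H j l m x.+1 y) k ^+ 2
  <= 24 * C * C2 ^+ 2 * \sum_(0 <= x < n) \sum_(0 <= j < J)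
        ell j * \sum_(0 <= m < Lb j) A j (al j x) m ^+ 2.
Proof.
move=> homo nested alL beL H0 A0 HC HC2 C0 C21 ell0 ellE.
rewrite mulr_sumr big_nat_cond [leRHS]big_nat_cond.
apply: ler_sum => x /andP[/andP[_ xn] _].
have S j m y : ~~ [&& 0 < y, y <= n & be j y.-1 == m]%N -> H j (al j x) m x.+1 y = 0.
  by move=> ym; apply: H0; apply: contra ym => /and5P[_ _ _ -> /andP[-> ->]].
have := @multilevel_energy R n J Lb be (fun j m => H j (al j x) m x.+1) (fun j m => A j (al j x) m) ell C C2
  homo nested beL S (fun j m => A0 j (al j x) m) (fun j m => HC j (al j x) m x.+1)
  (fun j k _ => HC2 _ _ _ _ _) C0 C21 ell0 ellE.
move=> /(le_trans _); apply.
rewrite le_eqVlt; apply/orP; left; apply/eqP; apply: eq_bigr => k _.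
congr (_ ^+ 2); rewrite /slope; congr (_ - _); apply: eq_bigr => j _.
- rewrite (bigD1_seq (al j x)) ?iota_uniq ?mem_index_iota ?alL//=.
  by rewrite [X in _ + X]big1 ?addr0// => l lx; rewrite big1// => m _; rewrite H0//= eq_sym (negPf lx) andbF.
- rewrite (bigD1_seq (al j x)) ?iota_uniq ?mem_index_iota ?alL//=.
  by rewrite [X in _ + X]big1 ?addr0// => l lx; rewrite big1// => m _; rewrite H0//= eq_sym (negPf lx) andbF.
Qed.

(** * Haar decomposition of box averages *)

Definition boxsum (R : realFieldType) (p : nat -> nat -> R) x0 x1 y0 y1 : R :=
  \sum_(x0 <= i < x1) \sum_(y0 <= k < y1) p i k.

Definition block_size (R : realFieldType) (n j l : nat) : R :=
  (dyadic_break n j l.+1 - dyadic_break n j l)%:R.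

Definition box_mass (R : realFieldType) (p : nat -> nat -> R) n j k l m : R :=
  boxsum p (dyadic_break n j l) (dyadic_break n j l.+1) (dyadic_break n k m) (dyadic_break n k m.+1).

Definition box_average (R : realFieldType) (p : nat -> nat -> R) n j k (x y : nat) : R :=
  box_mass p n j k (dyadic_label n j x) (dyadic_label n k y)
  / (block_size R n j (dyadic_label n j x) * block_size R n k (dyadic_label n k y)).

Definition average_energy (R : realFieldType) (p : nat -> nat -> R) n j k : R :=
  \sum_(0 <= l < 2 ^ j) \sum_(0 <= m < 2 ^ k)
     box_mass p n j k l m ^+ 2 / (block_size R n j l * block_size R n k m).

(** Coefficient of [haar_at] in the difference of the averages of [p] before and
    after the box is halved.  It vanishes when a half is empty, because the
    mass of the empty half and the other factor [a] or [b] do. *)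
Definition haar_coef (R : realFieldType) (p : nat -> nat -> R) n j k l m : R :=
  let a := block_size R n j.+1 l.*2 in let b := block_size R n j.+1 l.*2.+1 in
  (b * box_mass p n j.+1 k l.*2 m - a * box_mass p n j.+1 k l.*2.+1 m)
  / ((a + b) * block_size R n k m).

(** Size of the bends of the field that generates the Haar component, up to the
    factor of [boxable_haar]. *)
Definition haar_amp (R : realFieldType) (p : nat -> nat -> R) n j k l m : R :=
  `|haar_coef p n j k l m|
  * ((block_size R n j.+1 l.*2)^-1 + (block_size R n j.+1 l.*2.+1)^-1).

Lemma dyadic_break_doubleS n j l : dyadic_break n j.+1 l.*2.+2 = dyadic_break n j l.+1.
Proof. by rewrite -doubleS dyadic_break_double. Qed.

Lemma dyadic_break_homo n j : (0 < n)%N -> {homo dyadic_break n j : x y / (x <= y)%N}.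
Proof.
move=> n0; apply: homo_leq => // [x y z|l]; first exact: leq_trans.
by have /andP[H _] := dyadic_break_size j l n0; apply: leq_trans H; apply: leq_addr.
Qed.

Lemma block_size_split (R : realFieldType) n j l : (0 < n)%N ->
  block_size R n j l = block_size R n j.+1 l.*2 + block_size R n j.+1 l.*2.+1.
Proof.
move=> n0; rewrite /block_size dyadic_break_doubleS dyadic_break_double -natrD; congr _%:R.
have := dyadic_break_homo j.+1 n0 (leqnSn l.*2.+1); have := dyadic_break_homo j.+1 n0 (leqnSn l.*2).
by rewrite dyadic_break_doubleS dyadic_break_double; lia.
Qed.

Lemma box_mass_split (R : realFieldType) (p : nat -> nat -> R) n j k l m : (0 < n)%N ->
  box_mass p n j k l m = box_mass p n j.+1 k l.*2 m + box_mass p n j.+1 k l.*2.+1 m.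
Proof.
move=> n0; rewrite /box_mass /boxsum dyadic_break_doubleS dyadic_break_double.
have H1 := dyadic_break_homo j.+1 n0 (leqnSn l.*2.+1); have H2 := dyadic_break_homo j.+1 n0 (leqnSn l.*2).
by rewrite dyadic_break_doubleS in H1; rewrite dyadic_break_double in H2; rewrite -big_cat_nat.
Qed.

Lemma box_mass0x (R : realFieldType) (p : nat -> nat -> R) n j k l m :
  block_size R n j l = 0 -> box_mass p n j k l m = 0.
Proof.
move=> /eqP; rewrite pnatr_eq0 subn_eq0 => H.
by rewrite /box_mass /boxsum big_geq.
Qed.

Lemma box_mass0y (R : realFieldType) (p : nat -> nat -> R) n j k l m :
  block_size R n k m = 0 -> box_mass p n j k l m = 0.
Proof.
move=> /eqP; rewrite pnatr_eq0 subn_eq0 => H.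
by rewrite /box_mass /boxsum big1// => i _; rewrite big_geq.
Qed.

Lemma block_size_ge0 (R : realFieldType) n j l : 0 <= block_size R n j l.
Proof. exact: ler0n. Qed.

Definition haar_energy (R : realFieldType) (p : nat -> nat -> R) n j k l m : R :=
  haar_coef p n j k l m ^+ 2 * block_size R n k m
  * ((block_size R n j.+1 l.*2)^-1 + (block_size R n j.+1 l.*2.+1)^-1).

(** Pythagoras: halving a box adds to the energy of the averages exactly the
    squared norm of the corresponding Haar component. *)
Lemma average_energy_step (R : realFieldType) (p : nat -> nat -> R) n j k : (0 < n)%N ->
  average_energy p n j.+1 k - average_energy p n j k
  = \sum_(0 <= l < 2 ^ j) \sum_(0 <= m < 2 ^ k) haar_energy p n j k l m.
Proof.
move=> n0; rewrite /average_energy.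
have dbl M (F : nat -> R) : \sum_(0 <= l < M.*2) F l = \sum_(0 <= l < M) (F l.*2 + F l.*2.+1).
  elim: M => [|M IHM]; first by rewrite !big_nil.
  by rewrite doubleS !big_nat_recr//= IHM addrA.
rewrite expnS mul2n dbl -sumrB; apply: eq_bigr => l _.
rewrite -big_split -sumrB; apply: eq_bigr => m _ /=.
rewrite (box_mass_split p j k l m n0) (block_size_split R j l n0) /haar_energy /haar_coef.
have [Y0|Y0] := eqVneq (block_size R n k m) 0.
  by rewrite Y0 !mulr0 !invr0 !mulr0 mul0r; lra.
have [a0|a0] := eqVneq (block_size R n j.+1 l.*2) 0.
  by rewrite (box_mass0x p k m a0) a0 !(mulr0, mul0r, expr0n, add0r, addr0, subrr, oppr0).
have [b0|b0] := eqVneq (block_size R n j.+1 l.*2.+1) 0.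
  by rewrite (box_mass0x p k m b0) b0 !(mulr0, mul0r, expr0n, add0r, addr0, subrr, oppr0).
have ab0 : block_size R n j.+1 l.*2 + block_size R n j.+1 l.*2.+1 != 0.
  by rewrite paddr_eq0 ?block_size_ge0// negb_and a0.
by field; rewrite ab0 a0 b0 Y0.
Qed.

Definition haar_at (R : realFieldType) n j k l m : nat -> nat -> R :=
  haar R (dyadic_break n j l) (dyadic_break n j.+1 l.*2.+1) (dyadic_break n j l.+1) (dyadic_break n k m) (dyadic_break n k m.+1).

(** Only the box that contains [(x, y)] contributes. *)
Lemma box_average_step (R : realFieldType) (p : nat -> nat -> R) n j k x y :
  (x < n)%N -> (y < n)%N ->
  \sum_(0 <= l < 2 ^ j) \sum_(0 <= m < 2 ^ k) haar_coef p n j k l m * haar_at R n j k l m x y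
  = box_average p n j.+1 k x y - box_average p n j k x y.
Proof.
move=> xn yn; have n0 : (0 < n)%N by lia.
rewrite (bigD1_seq (dyadic_label n j x)) ?iota_uniq ?mem_index_iota ?dyadic_label_lt//=.
rewrite [X in _ + X]big1 ?addr0; last first.
  move=> l lx; rewrite big1// => m _; rewrite /haar_at /haar /strip.
  have := dyadic_label_eq j x l n0; rewrite eq_sym (negPf lx) => /esym xl.
  have := dyadic_break_homo j.+1 n0 (leqnSn l.*2.+1); have := dyadic_break_homo j.+1 n0 (leqnSn l.*2).
  rewrite dyadic_break_doubleS dyadic_break_double => H1 H2.
  have S u w : (dyadic_break n j l <= u)%N -> (u + w <= dyadic_break n j l.+1)%N ->
      (u <= x < u + w)%N = false by lia.
  by rewrite !S ?subnKC// !mul0r subrr mulr0.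
rewrite (bigD1_seq (dyadic_label n k y)) ?iota_uniq ?mem_index_iota ?dyadic_label_lt//=.
rewrite [X in _ + X]big1 ?addr0; last first.
  move=> m ym; rewrite /haar_at /haar /strip.
  have := dyadic_label_eq k y m n0; rewrite eq_sym (negPf ym) => /esym ->.
  by rewrite !andbF !mul0r subrr mulr0.
set l := dyadic_label n j x; set m := dyadic_label n k y.
have lx : (dyadic_break n j l <= x < dyadic_break n j l.+1)%N by rewrite -dyadic_label_eq.
have my : (dyadic_break n k m <= y < dyadic_break n k m.+1)%N by rewrite -dyadic_label_eq.
rewrite /box_average -/l -/m (box_mass_split p j k l m n0) (block_size_split R j l n0).
have Y0 : block_size R n k m != 0 by rewrite pnatr_eq0; lia.
rewrite /haar_at /haar /haar_coef /strip my !andbT.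
have H1 := dyadic_break_homo j.+1 n0 (leqnSn l.*2); have H2 := dyadic_break_homo j.+1 n0 (leqnSn l.*2.+1).
rewrite dyadic_break_double in H1; rewrite dyadic_break_doubleS in H2.
have Ea : (dyadic_break n j.+1 l.*2.+1 - dyadic_break n j l)%:R = block_size R n j.+1 l.*2.
  by rewrite /block_size dyadic_break_double.
have Eb : (dyadic_break n j l.+1 - dyadic_break n j.+1 l.*2.+1)%:R = block_size R n j.+1 l.*2.+1.
  by rewrite /block_size dyadic_break_doubleS.
rewrite Ea Eb (subnKC H1) (subnKC H2).
have lab2 : dyadic_label n j.+1 x = (l.*2 + (dyadic_break n j.+1 l.*2.+1 <= x))%N.
  apply/eqP; rewrite dyadic_label_eq//; case: (leqP (dyadic_break n j.+1 l.*2.+1) x) => xm /=.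
    by rewrite addn1 xm dyadic_break_doubleS; lia.
  by rewrite addn0 dyadic_break_double; lia.
rewrite lab2; move: lx; set xm := dyadic_break n j.+1 l.*2.+1 => lx.
set a := block_size R n j.+1 l.*2; set b := block_size R n j.+1 l.*2.+1.
case: (leqP xm x) => xmx /=.
  have -> : (x < dyadic_break n j l.+1)%N by lia.
  rewrite andbF.
  have b0 : b != 0 by rewrite /b /block_size pnatr_eq0 dyadic_break_doubleS -/xm; lia.
  have ab0 : a + b != 0 by rewrite paddr_eq0 ?block_size_ge0// negb_and b0 orbT.
  by rewrite addn1 -/b mul0r mulr1n; field; rewrite ab0 b0 Y0.
have -> : (dyadic_break n j l <= x)%N by lia.
rewrite /=.
have a0 : a != 0 by rewrite /a /block_size pnatr_eq0 dyadic_break_double -/xm; lia.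
have ab0 : a + b != 0 by rewrite paddr_eq0 ?block_size_ge0// negb_and a0.
by rewrite addn0 /= -/a mul0r mulr1n; field; rewrite ab0 a0 Y0.
Qed.

(** From 0, with slopes at most [C], a function cannot exceed [C] times the
    length of its support. *)
Lemma bend_support_bound (R : realFieldType) (g : nat -> R) C y0 y1 y :
  (forall y, ~~ (y0 < y <= y1)%N -> g y = 0) -> bend_le g C ->
  `|g y| <= (y1 - y0)%:R * C.
Proof.
move=> g0 gC; have C0 := variation_le_ge0 gC.
have [yn|yn] := boolP (y0 < y <= y1)%N; last by rewrite g0// normr0 mulr_ge0.
have H d : `|g (y0 + d)%N| <= d%:R * C.
  elim: d => [|d IHd]; first by rewrite addn0 g0 ?ltnn// normr0 mul0r.
  rewrite -natr1 mulrDl mul1r addnS; have -> : g (y0 + d).+1 = g (y0 + d)%N + slope g (y0 + d).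
    by rewrite /slope; lra.
  by apply: le_trans (ler_normD _ _) _; apply: lerD => //; apply: variation_le_bound.
rewrite -(subnKC (n := y) (m := y0)); last by lia.
apply: le_trans (H _) _; rewrite ler_wpM2r// ler_nat; lia.
Qed.

Lemma haar_coef0 (R : realFieldType) (p : nat -> nat -> R) n j k l m : (0 < n)%N ->
  ~~ (dyadic_break n j l < dyadic_break n j.+1 l.*2.+1 < dyadic_break n j l.+1)%N || (dyadic_break n k m.+1 <= dyadic_break n k m)%N ->
  haar_coef p n j k l m = 0.
Proof.
move=> n0; have H1 := dyadic_break_homo j.+1 n0 (leqnSn l.*2).
have H2 := dyadic_break_homo j.+1 n0 (leqnSn l.*2.+1).
rewrite /haar_coef => H.
have [H3|[H3|H3]] : block_size R n j.+1 l.*2 = 0 \/ block_size R n j.+1 l.*2.+1 = 0 \/ block_size R n k m = 0.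
  case/orP: H => [|H]; last by right; right; rewrite /block_size (_ : (_ - _ = 0)%N)//; lia.
  rewrite negb_and -!leqNgt => /orP[] H; [left|right; left];
    rewrite /block_size (_ : (_ - _ = 0)%N)//; rewrite ?dyadic_break_double ?dyadic_break_doubleS in H1 H2 *; lia.
- by rewrite H3 (box_mass0x p k m H3) mulr0 mul0r subrr mul0r.
- by rewrite H3 (box_mass0x p k m H3) mulr0 mul0r subrr mul0r.
- by rewrite H3 mulr0 invr0 mulr0.
Qed.

Lemma haar_amp_ge0 (R : realFieldType) (p : nat -> nat -> R) n j k l m :
  0 <= haar_amp p n j k l m.
Proof. by rewrite /haar_amp mulr_ge0// addr_ge0// invr_ge0. Qed.

(** The boxes to be halved are about square when [e] is 0, and have already been
    halved in the other direction when [e] is 1; in both cases a half is at most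
    one column wider than high. *)
Lemma boxable_level (R : realFieldType) (p : nat -> nat -> R) n j e l m :
  (0 < n)%N -> (e <= 1)%N ->
  boxable (dyadic_break n j l) (dyadic_break n j l.+1) (dyadic_break n (j + e) m) (dyadic_break n (j + e) m.+1)
    (fun x y => haar_coef p n j (j + e) l m * haar_at R n j (j + e) l m x y)
    (120 * haar_amp p n j (j + e) l m).
Proof.
move=> n0 e1.
have [H|H] := boolP (~~ (dyadic_break n j l < dyadic_break n j.+1 l.*2.+1 < dyadic_break n j l.+1)%N || (dyadic_break n (j + e) m.+1 <= dyadic_break n (j + e) m)%N).
  apply: boxable_ext (boxable0 R _ _ _ _); last by rewrite mulr_ge0// haar_amp_ge0.
  by move=> x y; rewrite haar_coef0// mul0r.
move: H; rewrite negb_or negbK => /andP[xm _].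
have S1 := dyadic_break_size j.+1 l.*2 n0; have S2 := dyadic_break_size j.+1 l.*2.+1 n0.
have S3 := dyadic_break_size (j + e) m n0.
have D : (n %/ 2 ^ j.+1 <= n %/ 2 ^ (j + e))%N.
  by apply: leq_div2l; rewrite ?expn_gt0// leq_exp2l//; lia.
rewrite dyadic_break_double in S1; rewrite dyadic_break_doubleS in S2.
have := @boxable_haar R (dyadic_break n j l) (dyadic_break n j.+1 l.*2.+1) (dyadic_break n j l.+1) (dyadic_break n (j + e) m) (dyadic_break n (j + e) m.+1) xm.
move=> /(_ _ _ _)/(boxableZ (haar_coef p n j (j + e) l m)) H.
apply: boxable_ext (H _ _ _) => //; try lia.
by rewrite /haar_amp /block_size dyadic_break_double dyadic_break_doubleS mulrCA.
Qed.

(** A nonzero Haar coefficient forces both halves to be nonempty; this bounds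
    the relative rounding error, so that both sides of the box are comparable to
    [n / 2 ^ j]. *)
Lemma level_sizes (R : realFieldType) (p : nat -> nat -> R) n j e l m :
  (0 < n)%N -> (e <= 1)%N -> haar_amp p n j (j + e) l m != 0 ->
  let ell := n%:R / 2 ^+ j : R in
  [/\ block_size R n j l <= 2 * ell, block_size R n (j + e) m <= 2 * ell,
      ell <= 4 * block_size R n j l & ell <= 4 * block_size R n (j + e) m].
Proof.
move=> n0 e1 A0 /=.
have : ~~ (~~ (dyadic_break n j l < dyadic_break n j.+1 l.*2.+1 < dyadic_break n j l.+1)%N || (dyadic_break n (j + e) m.+1 <= dyadic_break n (j + e) m)%N).
  by apply: contraNN A0 => H; rewrite /haar_amp haar_coef0// normr0 mul0r.
rewrite negb_or negbK -ltnNge => /andP[xm ym].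
have S1 := dyadic_break_size j l n0; have S3 := dyadic_break_size (j + e) m n0.
have P0 := pow2_gt0 j; have Pe := pow2_gt0 (j + e).
have pR : 2 ^+ j = (2 ^ j)%:R :> R by rewrite natrX.
have pR0 : 0 < (2 ^ j)%:R :> R by rewrite ltr0n.
have D1 := divn_eq n (2 ^ j); have D2 := divn_eq n (2 ^ (j + e)).
have M1 := ltn_pmod n P0; have M2 := ltn_pmod n Pe.
have Epe : (2 ^ (j + e) = 2 ^ j \/ 2 ^ (j + e) = 2 * 2 ^ j)%N.
  by case: e e1 {A0 ym S3 Pe D2 M2} => [|[|//]] _; [left; rewrite addn0|right; rewrite addn1 expnS].
rewrite pR /block_size !mulrA -!natrM !ler_pdivlMr// !ler_pdivrMr// -!natrM !ler_nat.
move: S1 S3 D1 D2 M1 M2 xm ym.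
move: (n %/ 2 ^ j)%N (n %% 2 ^ j)%N (n %/ 2 ^ (j + e))%N (n %% 2 ^ (j + e))%N => d r d' r'.
set X0 := dyadic_break n j l; set X1 := dyadic_break n j l.+1; set Y0 := dyadic_break _ _ m; set Y1 := dyadic_break _ _ m.+1.
move=> S1 S3 D1 D2 M1 M2 xm ym.
have X2 : (2 <= X1 - X0)%N by lia.
have dX : (d <= X1 - X0 <= d.+1)%N by lia.
have dY : (d' <= Y1 - Y0 <= d'.+1)%N by lia.
have Y2 : (1 <= Y1 - Y0)%N by lia.
have d1 : (1 <= d)%N by lia.
move: X2 dX dY Y2; move: (X1 - X0)%N (Y1 - Y0)%N => X Y {S1 S3 xm ym X0 X1 Y0 Y1} X2 dX dY Y2.
by case: Epe => Epe; rewrite Epe in D2 M2 Pe; move: (2 ^ j)%N P0 D1 D2 M1 M2 {Epe Pe pR pR0} => P *; split; nia.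
Qed.

(** The two halves have comparable widths, [a <= 2 * b] and [b <= 2 * a], hence
    [(a + b) * (a^-1 + b^-1) <= 9 / 2]; the remaining factor 4 comes from
    [level_sizes]. *)
Lemma amp_energy (R : realFieldType) (p : nat -> nat -> R) n j e l m :
  (0 < n)%N -> (e <= 1)%N ->
  let ell := n%:R / 2 ^+ j : R in
  block_size R n j l * (ell * haar_amp p n j (j + e) l m ^+ 2) <= 18 * haar_energy p n j (j + e) l m
  /\ block_size R n (j + e) m * (ell * haar_amp p n j (j + e) l m ^+ 2) <= 18 * haar_energy p n j (j + e) l m.
Proof.
move=> n0 e1 ell; have ell0 : 0 <= ell by rewrite divr_ge0 ?exprn_ge0.
have he0 : 0 <= haar_energy p n j (j + e) l m.
  by rewrite mulr_ge0 ?addr_ge0 ?invr_ge0 ?block_size_ge0// mulr_ge0 ?sqr_ge0 ?block_size_ge0.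
have [A0|A0] := eqVneq (haar_amp p n j (j + e) l m) 0.
  by rewrite A0 expr0n !mulr0 mulr_ge0.
have [_ _ H1 H2] := level_sizes n0 e1 A0; rewrite -/ell in H1 H2.
suff main : block_size R n j l * block_size R n (j + e) m * haar_amp p n j (j + e) l m ^+ 2
    <= 9 / 2 * haar_energy p n j (j + e) l m.
  split.
    apply: (@le_trans _ _ (4 * (block_size R n j l * block_size R n (j + e) m * haar_amp p n j (j + e) l m ^+ 2))).
      have -> : 4 * (block_size R n j l * block_size R n (j + e) m * haar_amp p n j (j + e) l m ^+ 2) =
        block_size R n j l * ((4 * block_size R n (j + e) m) * haar_amp p n j (j + e) l m ^+ 2) by ring.
      by rewrite ler_wpM2l ?block_size_ge0// ler_wpM2r ?sqr_ge0.
    by lra.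
  apply: (@le_trans _ _ (4 * (block_size R n j l * block_size R n (j + e) m * haar_amp p n j (j + e) l m ^+ 2))).
    have -> : 4 * (block_size R n j l * block_size R n (j + e) m * haar_amp p n j (j + e) l m ^+ 2) =
      block_size R n (j + e) m * ((4 * block_size R n j l) * haar_amp p n j (j + e) l m ^+ 2) by ring.
    by rewrite ler_wpM2l ?block_size_ge0// ler_wpM2r ?sqr_ge0.
  by lra.
have : ~~ (~~ (dyadic_break n j l < dyadic_break n j.+1 l.*2.+1 < dyadic_break n j l.+1)%N || (dyadic_break n (j + e) m.+1 <= dyadic_break n (j + e) m)%N).
  by apply: contraNN A0 => H; rewrite /haar_amp haar_coef0// normr0 mul0r.
rewrite negb_or negbK -ltnNge => /andP[xm _].
have S1 := dyadic_break_size j.+1 l.*2 n0; have S2 := dyadic_break_size j.+1 l.*2.+1 n0.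
rewrite dyadic_break_double in S1; rewrite dyadic_break_doubleS in S2.
rewrite /haar_energy /haar_amp (block_size_split R j l n0) exprMn real_normK ?num_real//.
have ab : block_size R n j.+1 l.*2 <= 2 * block_size R n j.+1 l.*2.+1.
  by rewrite /block_size dyadic_break_doubleS dyadic_break_double -natrM ler_nat; lia.
have ba : block_size R n j.+1 l.*2.+1 <= 2 * block_size R n j.+1 l.*2.
  by rewrite /block_size dyadic_break_doubleS dyadic_break_double -natrM ler_nat; lia.
have a0 : 0 < block_size R n j.+1 l.*2 by rewrite /block_size dyadic_break_double ltr0n; lia.
have b0 : 0 < block_size R n j.+1 l.*2.+1 by rewrite /block_size dyadic_break_doubleS ltr0n; lia.
have Y0 := block_size_ge0 R n (j + e) m; have K0 := sqr_ge0 (haar_coef p n j (j + e) l m).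
move: (block_size R n (j + e) m) (haar_coef p n j (j + e) l m ^+ 2) Y0 K0 => Y K Y0 K0.
move: (block_size R n j.+1 l.*2) (block_size R n j.+1 l.*2.+1) ab ba a0 b0 => a b ab ba a0 b0.
rewrite -subr_ge0.
have -> : 9 / 2 * (K * Y * (a^-1 + b^-1)) - (a + b) * Y * (K * (a^-1 + b^-1) ^+ 2)
   = K * Y * (a^-1 + b^-1) * (a * b)^-1 * ((2 * b - a) * (2 * a - b) / 2).
  by field; rewrite !gt_eqF.
apply: mulr_ge0; last by rewrite divr_ge0// mulr_ge0 ?subr_ge0.
apply: mulr_ge0; last by rewrite invr_ge0 mulr_ge0 ?(ltW a0) ?(ltW b0).
by apply: mulr_ge0; [exact: mulr_ge0|rewrite addr_ge0 ?invr_ge0 ?(ltW a0) ?(ltW b0)].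
Qed.

(** * A stable right inverse of the staggered divergence *)

(** All differences along rows and columns, including those towards the zeros
    around the grid. *)
Definition padded_energy (R : realFieldType) (n : nat) (W : nat -> nat -> R) : R :=
  \sum_(0 <= x < n) \sum_(0 <= k < n.+1) slope (W x.+1) k ^+ 2
  + \sum_(0 <= y < n) \sum_(0 <= k < n.+1) slope (W^~ y.+1) k ^+ 2.

(** One family of halvings: the fields of [boxable_level] are added over all
    boxes and levels, and [family_energy] is applied along rows and along
    columns.  The constant is [24 * 120 * 240 ^+ 2] from there, with the bend
    constant 120 and the amplitude constant [2 * 120], times 18 from
    [amp_energy], once for each of the two directions. *)
Lemma level_field (R : realFieldType) (p : nat -> nat -> R) (n J e : nat) :
  (0 < n)%N -> (e <= 1)%N ->
  let Delta := \sum_(0 <= j < J) (average_energy p n j.+1 (j + e) - average_energy p n j (j + e)) in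
  exists W1 W2 : nat -> nat -> R,
  [/\ forall x y, ~~ ((0 < x < n) && (0 < y <= n))%N -> W1 x y = 0,
      forall x y, ~~ ((0 < x <= n) && (0 < y < n))%N -> W2 x y = 0,
      forall x y, (x < n)%N -> (y < n)%N ->
        W1 x.+1 y.+1 - W1 x y.+1 + (W2 x.+1 y.+1 - W2 x.+1 y)
        = \sum_(0 <= j < J) (box_average p n j.+1 (j + e) x y - box_average p n j (j + e) x y),
      padded_energy n W1 <= 864 * 120 * 240 ^+ 2 * Delta
    & padded_energy n W2 <= 864 * 120 * 240 ^+ 2 * Delta].
Proof.
move=> n0 e1 Delta.
pose inr (t : nat * nat * nat) := ((t.1.2 < 2 ^ t.1.1) && (t.2 < 2 ^ (t.1.1 + e)))%N.
pose spec (t : nat * nat * nat) (FG : (nat -> nat -> R) * (nat -> nat -> R)) :=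
  let j := t.1.1 in let l := t.1.2 in let m := t.2 in
    (inr t -> box_field (dyadic_break n j l) (dyadic_break n j l.+1) (dyadic_break n (j + e) m) (dyadic_break n (j + e) m.+1)
      (fun x y => haar_coef p n j (j + e) l m * haar_at R n j (j + e) l m x y)
      (120 * haar_amp p n j (j + e) l m) FG.1 FG.2)
    /\ (~~ inr t -> FG.1 = (fun _ _ => 0) /\ FG.2 = (fun _ _ => 0)).
have [t|FG HFG] := @choice _ _ spec.
  have [it|nit] := boolP (inr t); last by exists (fun _ _ => 0, fun _ _ => 0); split; rewrite // (negPf nit).
  have [F [G FGb]] := boxable_level p t.1.1 t.1.2 t.2 n0 e1.
  by exists (F, G); split; rewrite // it.
pose F j l m := (FG (j, l, m)).1; pose G j l m := (FG (j, l, m)).2.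
have inrE j l m : inr (j, l, m) = ((l < 2 ^ j) && (m < 2 ^ (j + e)))%N by [].
have FGin j l m : (l < 2 ^ j)%N -> (m < 2 ^ (j + e))%N ->
    box_field (dyadic_break n j l) (dyadic_break n j l.+1) (dyadic_break n (j + e) m) (dyadic_break n (j + e) m.+1)
      (fun x y => haar_coef p n j (j + e) l m * haar_at R n j (j + e) l m x y)
      (120 * haar_amp p n j (j + e) l m) (F j l m) (G j l m).
  by move=> lj mj; have [H _] := HFG (j, l, m); apply: H; rewrite inrE lj.
pose sup (H : nat -> nat -> nat -> nat -> nat -> R) := forall j l m x y,
  ~~ [&& l < 2 ^ j, dyadic_break n j l < x, x <= dyadic_break n j l.+1,
         m < 2 ^ (j + e), dyadic_break n (j + e) m < y & y <= dyadic_break n (j + e) m.+1]%N -> H j l m x y = 0.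
pose bnd (H : nat -> nat -> nat -> nat -> nat -> R) := forall j l m,
  (forall x, bend_le (H j l m x) (120 * haar_amp p n j (j + e) l m))
  /\ (forall y, bend_le ((H j l m)^~ y) (120 * haar_amp p n j (j + e) l m)).
have A0 j l m : 0 <= haar_amp p n j (j + e) l m := haar_amp_ge0 p n j (j + e) l m.
have bend00 j l m : bend_le (fun _ => 0 : R) (120 * haar_amp p n j (j + e) l m).
  by apply: variation_le_weak (bend_le0 R); rewrite mulr_ge0.
have FGout j l m : ~~ ((l < 2 ^ j) && (m < 2 ^ (j + e)))%N ->
    F j l m = (fun _ _ => 0) /\ G j l m = (fun _ _ => 0).
  by have [_ H] := HFG (j, l, m).
have supF : sup F.
  move=> j l m x y; have [/andP[lj mj]|out _] := boolP ((l < 2 ^ j) && (m < 2 ^ (j + e)))%N; last first.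
    by have [-> _] := FGout _ _ _ out.
  have [H _ _ _ _] := FGin j l m lj mj; rewrite lj mj => xy; apply: H; lia.
have supG : sup G.
  move=> j l m x y; have [/andP[lj mj]|out _] := boolP ((l < 2 ^ j) && (m < 2 ^ (j + e)))%N; last first.
    by have [_ ->] := FGout _ _ _ out.
  have [_ H _ _ _] := FGin j l m lj mj; rewrite lj mj => xy; apply: H; lia.
have bndF : bnd F.
  move=> j l m; have [/andP[lj mj]|out] := boolP ((l < 2 ^ j) && (m < 2 ^ (j + e)))%N; last first.
    by have [-> _] := FGout _ _ _ out; split=> x; exact: bend00.
  by have [_ _ _ H1 H2] := FGin j l m lj mj; split=> x; [case: (H1 x)|case: (H2 x)].
have bndG : bnd G.
  move=> j l m; have [/andP[lj mj]|out] := boolP ((l < 2 ^ j) && (m < 2 ^ (j + e)))%N; last first.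
    by have [_ ->] := FGout _ _ _ out; split=> x; exact: bend00.
  by have [_ _ _ H1 H2] := FGin j l m lj mj; split=> x; [case: (H1 x)|case: (H2 x)].
pose ell j : R := n%:R / 2 ^+ j.
have ell0 j : 0 < ell j by rewrite divr_gt0 ?exprn_gt0 ?ltr0n.
have ellE i d : ell i = 2 ^+ d * ell (i + d)%N.
  by rewrite /ell exprD; field; rewrite !gt_eqF ?exprn_gt0.
have key H : sup H -> bnd H ->
    padded_energy n (fun x y => \sum_(0 <= j < J) \sum_(0 <= l < 2 ^ j)
       \sum_(0 <= m < 2 ^ (j + e)) H j l m x y) <= 864 * 120 * 240 ^+ 2 * Delta.
  move=> Hsup Hbnd.
  have K0 : 0 <= 24 * 120 * 240 ^+ 2 :> R by lra.
  have DeltaE : Delta = \sum_(0 <= j < J) \sum_(0 <= l < 2 ^ j) \sum_(0 <= m < 2 ^ (j + e))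
      haar_energy p n j (j + e) l m.
    by apply: eq_bigr => j _; rewrite average_energy_step.
  have box j l m x y : ~~ [&& 0 < x, x <= n, dyadic_label n j x.-1 == l, 0 < y, y <= n & dyadic_label n (j + e) y.-1 == m]%N ->
      H j l m x y = 0.
    move=> xy; apply: Hsup; apply: contra xy => /and5P[lj xl xr mj /andP[ym yr]].
    have := dyadic_break_homo j n0 lj; have := dyadic_break_homo (j + e) n0 mj; rewrite !dyadic_break_max !dyadic_label_eq//; lia.
  have bound j l m x y : `|H j l m x y| <= 240 * ell j * haar_amp p n j (j + e) l m.
    have [Hx _] := Hbnd j l m.
    apply: (@le_trans _ _ (block_size R n (j + e) m * (120 * haar_amp p n j (j + e) l m))).
      apply: bend_support_bound (Hx x) => y' y'm; apply: Hsup.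
      by apply: contra y'm => /and5P[_ _ _ _ ->].
    have [->|An] := eqVneq (haar_amp p n j (j + e) l m) 0; first by rewrite !mulr0.
    have [_ Y2 _ _] := level_sizes n0 e1 An; rewrite -/(ell j) in Y2.
    have -> : 240 * ell j * haar_amp p n j (j + e) l m = (2 * ell j) * (120 * haar_amp p n j (j + e) l m) by ring.
    by rewrite ler_wpM2r// mulr_ge0.
  have -> : 864 * 120 * 240 ^+ 2 * Delta = 24 * 120 * 240 ^+ 2 * (18 * Delta)
      + 24 * 120 * 240 ^+ 2 * (18 * Delta) by ring.
  apply: lerD.
    apply: le_trans (@family_energy R n J (fun j => 2 ^ j)%N (fun j => 2 ^ (j + e))%N
      (dyadic_label n) (fun j => dyadic_label n (j + e)) H (fun j l m => haar_amp p n j (j + e) l m) ell 120 240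
      (fun j => @dyadic_label_homo n (j + e)) _ _ _ box A0 (fun j l m => (Hbnd j l m).1)
      bound _ _ ell0 ellE) _ => //.
    - by move=> i j x y ij; apply: dyadic_label_nested; rewrite leq_add2r.
    - by move=> j k; apply: dyadic_label_lt.
    - by move=> j k; apply: dyadic_label_lt.
    - by lra.
    apply: (ler_wpM2l K0); rewrite exchange_big/= DeltaE mulr_sumr.
    apply: ler_sum => j _.
    rewrite (card_dyadic_label j (fun l => ell j * \sum_(0 <= m < 2 ^ (j + e)) haar_amp p n j (j + e) l m ^+ 2))// mulr_sumr.
    apply: ler_sum => l _; rewrite !mulr_sumr; apply: ler_sum => m _.
    by have [] := amp_energy p j l m n0 e1.
  have -> : \sum_(0 <= y < n) \sum_(0 <= k < n.+1)
      slope ((fun x y => \sum_(0 <= j < J) \sum_(0 <= l < 2 ^ j)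
         \sum_(0 <= m < 2 ^ (j + e)) H j l m x y)^~ y.+1) k ^+ 2
    = \sum_(0 <= y < n) \sum_(0 <= k < n.+1)
      slope (fun x => \sum_(0 <= j < J) \sum_(0 <= m < 2 ^ (j + e))
         \sum_(0 <= l < 2 ^ j) H j l m x y.+1) k ^+ 2.
    apply: eq_bigr => y _; apply: eq_bigr => k _; congr (_ ^+ 2); rewrite /slope.
    by congr (_ - _); apply: eq_bigr => j _; rewrite exchange_big.
  have bound' j m l y x : `|H j l m x y| <= 240 * ell j * haar_amp p n j (j + e) l m.
    have [_ Hy] := Hbnd j l m.
    apply: (@le_trans _ _ (block_size R n j l * (120 * haar_amp p n j (j + e) l m))).
      apply: (bend_support_bound (g := (H j l m)^~ y)) (Hy y) => x' x'l; apply: Hsup.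
      by apply: contra x'l => /and5P[_ -> -> _ _].
    have [->|An] := eqVneq (haar_amp p n j (j + e) l m) 0; first by rewrite !mulr0.
    have [X2 _ _ _] := level_sizes n0 e1 An; rewrite -/(ell j) in X2.
    have -> : 240 * ell j * haar_amp p n j (j + e) l m = (2 * ell j) * (120 * haar_amp p n j (j + e) l m) by ring.
    by rewrite ler_wpM2r// mulr_ge0.
  apply: le_trans (@family_energy R n J (fun j => 2 ^ (j + e))%N (fun j => 2 ^ j)%N
      (fun j => dyadic_label n (j + e)) (dyadic_label n) (fun j m l y x => H j l m x y)
      (fun j m l => haar_amp p n j (j + e) l m) ell 120 240
      (fun j => @dyadic_label_homo n j) _ _ _ _ (fun j m l => A0 j l m) (fun j m l => (Hbnd j l m).2)
      bound' _ _ ell0 ellE) _ => //.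
  - by move=> i j x y ij; apply: dyadic_label_nested.
  - by move=> j k; apply: dyadic_label_lt.
  - by move=> j k; apply: dyadic_label_lt.
  - by move=> j m l y x yx; apply: box; apply: contra yx => /and5P[-> -> -> -> /andP[-> ->]].
  - by lra.
  apply: (ler_wpM2l K0); rewrite exchange_big/= DeltaE mulr_sumr.
  apply: ler_sum => j _.
  rewrite (card_dyadic_label (j + e) (fun m => ell j * \sum_(0 <= l < 2 ^ j) haar_amp p n j (j + e) l m ^+ 2))// mulr_sumr.
  rewrite [leRHS](eq_bigr (fun l => \sum_(0 <= m < 2 ^ (j + e)) 18 * haar_energy p n j (j + e) l m)); last first.
    by move=> l _; rewrite mulr_sumr.
  rewrite [leRHS]exchange_big/=.
  apply: ler_sum => m _; rewrite !mulr_sumr; apply: ler_sum => l _.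
  by have [] := amp_energy p j l m n0 e1.
exists (fun x y => \sum_(0 <= j < J) \sum_(0 <= l < 2 ^ j)
       \sum_(0 <= m < 2 ^ (j + e)) F j l m x y).
exists (fun x y => \sum_(0 <= j < J) \sum_(0 <= l < 2 ^ j)
       \sum_(0 <= m < 2 ^ (j + e)) G j l m x y).
split; [| | | exact: key | exact: key].
- move=> x y xy; rewrite big1// => j _; rewrite big_nat_cond big1// => l /andP[/andP[_ lj] _].
  rewrite big_nat_cond big1// => m /andP[/andP[_ mj] _].
  have [H _ _ _ _] := FGin j l m lj mj; apply: H; apply: contra xy.
  have := dyadic_break_homo j n0 lj; have := dyadic_break_homo (j + e) n0 mj; rewrite !dyadic_break_max; lia.
- move=> x y xy; rewrite big1// => j _; rewrite big_nat_cond big1// => l /andP[/andP[_ lj] _].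
  rewrite big_nat_cond big1// => m /andP[/andP[_ mj] _].
  have [_ H _ _ _] := FGin j l m lj mj; apply: H; apply: contra xy.
  have := dyadic_break_homo j n0 lj; have := dyadic_break_homo (j + e) n0 mj; rewrite !dyadic_break_max; lia.
- move=> x y xn yn; rewrite -!sumrB -big_split/=; apply: eq_bigr => j _.
  rewrite -box_average_step// -!sumrB -big_split/= big_nat_cond [RHS]big_nat_cond.
  apply: eq_bigr => l /andP[/andP[_ lj] _].
  rewrite -!sumrB -big_split/= big_nat_cond [RHS]big_nat_cond.
  apply: eq_bigr => m /andP[/andP[_ mj] _].
  by have [_ _ H _ _] := FGin j l m lj mj; rewrite H.
Qed.

Definition transposed (R : realFieldType) (p : nat -> nat -> R) x y := p y x.

Lemma box_mass_transposed (R : realFieldType) (p : nat -> nat -> R) n j k l m :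
  box_mass (transposed p) n j k l m = box_mass p n k j m l.
Proof. by rewrite /box_mass /boxsum exchange_big. Qed.

Lemma box_average_transposed (R : realFieldType) (p : nat -> nat -> R) n j k x y :
  box_average (transposed p) n j k x y = box_average p n k j y x.
Proof. by rewrite /box_average box_mass_transposed [block_size R n j _ * _]mulrC. Qed.

Lemma average_energy_transposed (R : realFieldType) (p : nat -> nat -> R) n j k :
  average_energy (transposed p) n j k = average_energy p n k j.
Proof.
rewrite /average_energy exchange_big; apply: eq_bigr => l _; apply: eq_bigr => m _.
by rewrite box_mass_transposed [block_size R n j _ * _]mulrC.
Qed.

Lemma average_energyE (R : realFieldType) (p : nat -> nat -> R) n j k : (0 < n)%N ->
  average_energy p n j k = \sum_(0 <= x < n) \sum_(0 <= y < n) box_average p n j k x y ^+ 2.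
Proof.
move=> n0; pose F l m := (box_mass p n j k l m / (block_size R n j l * block_size R n k m)) ^+ 2.
under [RHS]eq_bigr => x _ do rewrite (card_dyadic_label k (fun m => F (dyadic_label n j x) m) n0).
rewrite (card_dyadic_label j (fun l => \sum_(0 <= m < 2 ^ k) (dyadic_break n k m.+1 - dyadic_break n k m)%:R * F l m) n0).
apply: eq_bigr => l _; rewrite mulr_sumr; apply: eq_bigr => m _; rewrite /F.
rewrite -!/(block_size R _ _ _).
have [X0|X0] := eqVneq (block_size R n j l) 0.
  by rewrite (box_mass0x p k m X0) X0 !(mul0r, expr0n).
have [Y0|Y0] := eqVneq (block_size R n k m) 0.
  by rewrite (box_mass0y p j l Y0) Y0 !(mul0r, mulr0, expr0n).
by field; rewrite X0 Y0.
Qed.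

(** As [n < 2 ^ n], level [n] separates all points. *)
Lemma dyadic_break_finest n x : (x < n)%N -> dyadic_break n n (dyadic_label n n x) = x /\ dyadic_break n n (dyadic_label n n x).+1 = x.+1.
Proof.
move=> xn; have n0 : (0 < n)%N by lia.
have xb : (dyadic_break n n (dyadic_label n n x) <= x < dyadic_break n n (dyadic_label n n x).+1)%N by rewrite -dyadic_label_eq.
have d0 : (n %/ 2 ^ n = 0)%N by apply: divn_small; apply: ltn_expl.
have := dyadic_break_size n (dyadic_label n n x) n0; rewrite d0 addn0 addn1; move: xb.
by move: (dyadic_break n n (dyadic_label n n x)) (dyadic_break n n (dyadic_label n n x).+1) => a b; clear; lia.
Qed.

Lemma box_average_finest (R : realFieldType) (p : nat -> nat -> R) n x y :
  (x < n)%N -> (y < n)%N -> box_average p n n n x y = p x y.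
Proof.
move=> xn yn; rewrite /box_average /box_mass /block_size.
have [-> ->] := dyadic_break_finest xn; have [-> ->] := dyadic_break_finest yn.
by rewrite /boxsum !big_nat1 !subSnn mulr1 divr1.
Qed.

(** The coarsest average is the mean of [p]. *)
Lemma box_average_coarsest (R : realFieldType) (p : nat -> nat -> R) n x y :
  \sum_(0 <= x < n) \sum_(0 <= y < n) p x y = 0 -> (x < n)%N -> (y < n)%N ->
  box_average p n 0 0 x y = 0.
Proof.
move=> p0 xn yn; rewrite /box_average.
have L z : (z < n)%N -> dyadic_label n 0 z = 0%N by move=> zn; rewrite /dyadic_label expn0 muln1 divn_small.
rewrite !L// /box_mass dyadic_break0 -[1%N]/(2 ^ 0)%N dyadic_break_max /boxsum p0 mul0r//.
Qed.

Lemma padded_energyD (R : realFieldType) n (V W : nat -> nat -> R) :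
  padded_energy n (fun x y => V x y + W x y) <= 2 * padded_energy n V + 2 * padded_energy n W.
Proof.
rewrite /padded_energy.
set a := (X in X + _ <= _); set b := (X in _ + X <= _).
set c := (X in _ <= 2 * (X + _) + _); set d := (X in _ <= 2 * (_ + X) + _).
set e := (X in _ <= _ + 2 * (X + _)); set f := (X in _ <= _ + 2 * (_ + X)).
have sq (u v : R) : (u + v) ^+ 2 <= 2 * u ^+ 2 + 2 * v ^+ 2.
  by rewrite -subr_ge0 (_ : _ - _ = (u - v) ^+ 2) ?sqr_ge0//; ring.
have H1 : a <= 2 * c + 2 * e.
  rewrite /a /c /e !mulr_sumr -big_split/=; apply: ler_sum => x _.
  rewrite !mulr_sumr -big_split/=; apply: ler_sum => k _.
  by apply: le_trans (sq _ _); rewrite /slope opprD addrACA.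
have H2 : b <= 2 * d + 2 * f.
  rewrite /b /d /f !mulr_sumr -big_split/=; apply: ler_sum => x _.
  rewrite !mulr_sumr -big_split/=; apply: ler_sum => k _.
  by apply: le_trans (sq _ _); rewrite /slope opprD addrACA.
by lra.
Qed.

Lemma padded_energy_transposed (R : realFieldType) n (V : nat -> nat -> R) :
  padded_energy n (transposed V) = padded_energy n V.
Proof. by rewrite /padded_energy addrC. Qed.

(** Halving alternately in the two directions goes from the average over the
    grid, which is 0, to [p] itself.  The vertical halvings are the horizontal
    ones of the transposed function.  The energies of the two families telescope
    to the square norm of [p]. *)
Theorem staggered_right_inverse (R : realFieldType) :
  exists2 C : R, 0 <= C & forall n (p : nat -> nat -> R), (0 < n)%N ->
  \sum_(0 <= x < n) \sum_(0 <= y < n) p x y = 0 ->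
  exists W1 W2 : nat -> nat -> R,
  [/\ forall x y, ~~ ((0 < x < n) && (0 < y <= n))%N -> W1 x y = 0,
      forall x y, ~~ ((0 < x <= n) && (0 < y < n))%N -> W2 x y = 0,
      forall x y, (x < n)%N -> (y < n)%N ->
        W1 x.+1 y.+1 - W1 x y.+1 + (W2 x.+1 y.+1 - W2 x.+1 y) = p x y,
      padded_energy n W1 <= C * \sum_(0 <= x < n) \sum_(0 <= y < n) p x y ^+ 2
    & padded_energy n W2 <= C * \sum_(0 <= x < n) \sum_(0 <= y < n) p x y ^+ 2].
Proof.
pose K : R := 864 * 120 * 240 ^+ 2.
have K0 : 0 <= K by rewrite /K; lra.
exists (2 * K); first by rewrite mulr_ge0.
move=> n p n0 p0.
have [W1 [W2 [W10 W20 Wd W1e W2e]]] := level_field p n n0 (leq0n 1).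
have [V1 [V2 [V10 V20 Vd V1e V2e]]] := level_field (transposed p) n n0 (leqnn 1).
pose D0 := \sum_(0 <= j < n) (average_energy p n j.+1 (j + 0) - average_energy p n j (j + 0)).
pose D1 := \sum_(0 <= j < n) (average_energy (transposed p) n j.+1 (j + 1) - average_energy (transposed p) n j (j + 1)).
rewrite -/K -/D0 in W1e W2e; rewrite -/K -/D1 in V1e V2e.
clearbody K.
have pE : \sum_(0 <= x < n) \sum_(0 <= y < n) p x y ^+ 2 = average_energy p n n n.
  rewrite average_energyE// big_nat_cond [RHS]big_nat_cond; apply: eq_bigr => x /andP[/andP[_ xn] _].
  rewrite big_nat_cond [RHS]big_nat_cond; apply: eq_bigr => y /andP[/andP[_ yn] _].
  by rewrite box_average_finest.
have D01 : D0 + D1 <= average_energy p n n n.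
  have -> : D0 + D1 = average_energy p n n n - average_energy p n 0 0.
    rewrite /D0 /D1 -big_split/= -[RHS](telescope_sumr (fun j => average_energy p n j j) (leq0n n)).
    by apply: eq_bigr => j _; rewrite !(average_energy_transposed p) addn0 addn1; lra.
  rewrite gerBl /average_energy; apply: sumr_ge0 => l _; apply: sumr_ge0 => m _.
  by rewrite divr_ge0 ?sqr_ge0 ?mulr_ge0 ?block_size_ge0.
exists (fun x y => W1 x y + transposed V2 x y), (fun x y => W2 x y + transposed V1 x y); split.
- move=> x y xy; rewrite W10// /transposed V20 ?addr0//; by move: xy; rewrite andbC.
- move=> x y xy; rewrite W20// /transposed V10 ?addr0//; by move: xy; rewrite andbC.
- move=> x y xn yn; have := Wd x y xn yn; have := Vd y x yn xn; rewrite /transposed => E1 E2.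
  transitivity (\sum_(0 <= j < n) (box_average p n j.+1 j.+1 x y - box_average p n j j x y)).
    have -> : W1 x.+1 y.+1 + V2 y.+1 x.+1 - (W1 x y.+1 + V2 y.+1 x) +
       (W2 x.+1 y.+1 + V1 y.+1 x.+1 - (W2 x.+1 y + V1 y x.+1))
      = (W1 x.+1 y.+1 - W1 x y.+1 + (W2 x.+1 y.+1 - W2 x.+1 y))
      + (V1 y.+1 x.+1 - V1 y x.+1 + (V2 y.+1 x.+1 - V2 y.+1 x)) by ring.
    rewrite E1 E2 -big_split/=; apply: eq_bigr => j _.
    by rewrite !(box_average_transposed p) addn0 addn1; ring.
  rewrite (telescope_sumr (fun j => box_average p n j j x y) (leq0n n)) box_average_finest//.
  by rewrite box_average_coarsest// subr0.
- apply: le_trans (padded_energyD _ _ _) _; rewrite padded_energy_transposed pE.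
  apply: (@le_trans _ _ (2 * K * (D0 + D1))); first by lra.
  by rewrite ler_wpM2l// mulr_ge0.
- apply: le_trans (padded_energyD _ _ _) _; rewrite padded_energy_transposed pE.
  apply: (@le_trans _ _ (2 * K * (D0 + D1))); first by lra.
  by rewrite ler_wpM2l// mulr_ge0.
Qed.

(** * Dirichlet forms on lines and grids *)

(** The last two terms add to the slopes at both ends, so that a
    boundary value enters with the coefficient 2 of the scheme. *)
Definition line_form (R : realFieldType) (n : nat) (b v : nat -> R) : R :=
  \sum_(0 <= k < n.+1) slope b k * slope v k + b 1%N * v 1%N + b n * v n.

Definition dirichlet_form (R : realFieldType) (n : nat) (u v : nat -> nat -> R) : R :=
  \sum_(0 <= y < n) line_form n (u^~ y.+1) (v^~ y.+1)
  + \sum_(0 <= x < n) line_form n (u x.+1) (v x.+1).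

Definition line_laplacian (R : realFieldType) (n : nat) (b : nat -> R) (x : nat) : R :=
  (b x - b x.-1) + (b x - b x.+1) + (x == 1%N)%:R * b x + (x == n)%:R * b x.

(** Differences are taken across interior edges only: the discrete gradient of
    the pressure does not see the zeros around the grid. *)
Definition inner_slope (R : realFieldType) (n : nat) (b : nat -> R) (x : nat) : R :=
  if (0 < x < n)%N then slope b x else 0.

Definition inner_mean (R : realFieldType) (n : nat) (b : nat -> R) (x : nat) : R :=
  if (0 < x < n)%N then (b x + b x.+1) / 2 else 0.

Lemma sum_line_laplacian (R : realFieldType) n (b v : nat -> R) : (0 < n)%N ->
  v 0%N = 0 -> v n.+1 = 0 ->
  \sum_(0 <= x < n) line_laplacian n b x.+1 * v x.+1 = line_form n b v.
Proof.
move=> n0 v0 vn; rewrite /line_form sum_by_parts//.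
under eq_bigr => x _ do rewrite /line_laplacian /= !mulrDl -addrA.
rewrite big_split/= -sumrN -addrA; congr (_ + _).
  by apply: eq_bigr => x _; rewrite /slope; ring.
rewrite big_split/= (eq_bigr (fun x => if x == 0%N then b 1%N * v 1%N else 0)); last first.
  by move=> x _; case: x => [|x]; rewrite ?mul1r// !mul0r.
rewrite -big_mkcond big_nat1_eq n0; congr (_ + _).
rewrite (eq_bigr (fun x => if x == n.-1 then b n * v n else 0)); last first.
  move=> x _; case: (eqVneq x n.-1) => [->|xn]; first by rewrite prednK// eqxx mul1r.
  by rewrite (_ : (x.+1 == n) = false) ?mul0r//; apply/eqP; lia.
by rewrite -big_mkcond big_nat1_eq leq0n prednK// leqnn.
Qed.

(** Summation by parts for a pressure without boundary condition against a flux
    that vanishes at both ends. *)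
Lemma abel_inner (R : realFieldType) n (p m : nat -> R) : m 0%N = 0 -> m n = 0 ->
  \sum_(0 <= x < n) inner_slope n p x * m x
  = - \sum_(0 <= x < n) p x.+1 * (m x.+1 - m x).
Proof.
move=> m0 mn.
have H k : (k <= n)%N -> \sum_(0 <= x < k) inner_slope n p x * m x =
    p k * m k - \sum_(0 <= x < k) p x.+1 * (m x.+1 - m x).
  elim: k => [|k IHk] kn; first by rewrite !big_nil m0 mulr0 subrr.
  rewrite !big_nat_recr//= IHk ?(ltnW kn)// /inner_slope kn andbT /slope.
  by case: k {IHk} kn => [|k] kn /=; rewrite ?m0; ring.
by rewrite H// mn mulr0 sub0r.
Qed.

(** The mean of the two slopes of a cell and the mean of the two values at an
    edge are adjoint: this is the duality of gradient and divergence. *)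
Lemma sum_inner_mean (R : realFieldType) n (p v : nat -> R) :
  \sum_(0 <= x < n) v x.+1 * ((inner_slope n p x.+1 + inner_slope n p x) / 2)
  = \sum_(0 <= x < n) inner_slope n p x * inner_mean n v x.
Proof.
have q0 : inner_slope n p 0 = 0 by [].
have qn : inner_slope n p n = 0 by rewrite /inner_slope ltnn andbF.
have H k : \sum_(0 <= x < k) v x.+1 * ((inner_slope n p x.+1 + inner_slope n p x) / 2)
  = \sum_(0 <= x < k) inner_slope n p x * inner_mean n v x
    + v k * inner_slope n p k / 2.
  elim: k => [|k IHk]; first by rewrite !big_nil q0 mulr0 mul0r addr0.
  rewrite !big_nat_recr//= IHk; rewrite /inner_mean /inner_slope.
  by case: ifP => _; field.
by rewrite H qn mulr0 mul0r addr0.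
Qed.

Lemma line_form_ge0 (R : realFieldType) n (b : nat -> R) : 0 <= line_form n b b.
Proof.
by rewrite /line_form !addr_ge0 ?sumr_ge0 -?expr2 ?sqr_ge0// => k _; rewrite -expr2 sqr_ge0.
Qed.

Lemma dirichlet_form_ge0 (R : realFieldType) n (u : nat -> nat -> R) : 0 <= dirichlet_form n u u.
Proof. by rewrite addr_ge0// sumr_ge0// => *; exact: line_form_ge0. Qed.

Lemma amgm (R : realFieldType) (t a b : R) : 0 < t ->
  a * b <= 2^-1 * (t * a ^+ 2 + t^-1 * b ^+ 2).
Proof.
move=> t0; rewrite -subr_ge0.
have -> : 2^-1 * (t * a ^+ 2 + t^-1 * b ^+ 2) - a * b = 2^-1 * t^-1 * (t * a - b) ^+ 2.
  by field; rewrite gt_eqF.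
by rewrite mulr_ge0 ?sqr_ge0// mulr_ge0 ?invr_ge0 ?(ltW t0).
Qed.

Lemma line_form_amgm (R : realFieldType) n (b v : nat -> R) t : 0 < t ->
  line_form n b v <= 2^-1 * (t * line_form n b b + t^-1 * line_form n v v).
Proof.
move=> t0; rewrite /line_form.
have -> : 2^-1 * (t * (\sum_(0 <= k < n.+1) slope b k * slope b k + b 1%N * b 1%N + b n * b n) +
   t^-1 * (\sum_(0 <= k < n.+1) slope v k * slope v k + v 1%N * v 1%N + v n * v n))
  = \sum_(0 <= k < n.+1) 2^-1 * (t * slope b k ^+ 2 + t^-1 * slope v k ^+ 2)
  + 2^-1 * (t * b 1%N ^+ 2 + t^-1 * v 1%N ^+ 2) + 2^-1 * (t * b n ^+ 2 + t^-1 * v n ^+ 2).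
  rewrite -mulr_sumr big_split/= -!mulr_sumr.
  have E (g : nat -> R) : \sum_(0 <= k < n.+1) slope g k * slope g k = \sum_(0 <= k < n.+1) slope g k ^+ 2 by apply: eq_bigr => k _; rewrite expr2.
  by rewrite !E; ring.
by rewrite !lerD ?amgm//; apply: ler_sum => k _; apply: amgm.
Qed.

Lemma dirichlet_form_amgm (R : realFieldType) n (u v : nat -> nat -> R) t : 0 < t ->
  dirichlet_form n u v <= 2^-1 * (t * dirichlet_form n u u + t^-1 * dirichlet_form n v v).
Proof.
move=> t0; rewrite /dirichlet_form.
set a := (X in X + _ <= _); set b := (X in _ + X <= _).
set c := (X in _ <= _ * (_ * (X + _) + _)); set d := (X in _ <= _ * (_ * (_ + X) + _)).
set e := (X in _ <= _ * (_ + _ * (X + _))); set f := (X in _ <= _ * (_ + _ * (_ + X))).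
have -> : 2^-1 * (t * (c + d) + t^-1 * (e + f)) = 2^-1 * (t * c + t^-1 * e) + 2^-1 * (t * d + t^-1 * f) by ring.
rewrite lerD// /a /b /c /d /e /f !mulr_sumr -big_split/= mulr_sumr; apply: ler_sum => *; exact: line_form_amgm.
Qed.

(** Cauchy and Schwarz along the line, starting from the zero at 0. *)
Lemma line_poincare (R : realFieldType) n (b : nat -> R) : b 0%N = 0 ->
  \sum_(0 <= x < n) b x.+1 ^+ 2 <= n%:R ^+ 2 * \sum_(0 <= k < n.+1) slope b k ^+ 2.
Proof.
move=> b0; set S := (X in _ * X).
have S0 : 0 <= S by apply: sumr_ge0 => k _; rewrite sqr_ge0.
have H x : (b x) ^+ 2 <= x%:R * \sum_(0 <= k < x) slope b k ^+ 2.
  elim: x => [|x IHx]; first by rewrite b0 expr0n big_nil mulr0.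
  rewrite big_nat_recr//=; have -> : b x.+1 = b x + slope b x by rewrite /slope; ring.
  have [->|x0] := eqVneq x 0%N; first by rewrite b0 add0r big_nil add0r mul1r.
  have xp : 0 < x%:R :> R by rewrite ltr0n; lia.
  have := amgm (b x) (slope b x) (t := x%:R^-1); rewrite invr_gt0 => /(_ xp).
  rewrite invrK => A.
  move: IHx; rewrite -natr1; move: (\sum_(_ <= _ < _) _) => T IHx.
  have T1 : x%:R^-1 * b x ^+ 2 <= T by rewrite mulrC ler_pdivrMr// mulrC.
  have -> : (b x + slope b x) ^+ 2 = b x ^+ 2 + 2 * (b x * slope b x) + slope b x ^+ 2 by ring.
  by lra.
apply: (@le_trans _ _ (\sum_(0 <= x < n) n%:R * S)).
  rewrite big_nat_cond [leRHS]big_nat_cond; apply: ler_sum => x /andP[/andP[_ xn] _].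
  apply: le_trans (H _) _; apply: ler_pM => //.
  - by apply: sumr_ge0 => k _; rewrite sqr_ge0.
  - by rewrite ler_nat.
  rewrite /S (big_cat_nat (leq0n x.+1) (_ : x.+1 <= n.+1)%N)//=; last by lia.
  by rewrite lerDl sumr_ge0// => k _; rewrite sqr_ge0.
by rewrite sumr_const_nat subn0 -(mulr_natl (n%:R * S)) mulrA -expr2 lexx.
Qed.

Lemma dirichlet_poincare (R : realFieldType) n (u : nat -> nat -> R) :
  (forall y, u 0%N y = 0) -> (0 < n)%N ->
  n%:R^-1 ^+ 2 * (\sum_(0 <= x < n) \sum_(0 <= y < n) u x.+1 y.+1 ^+ 2) <= dirichlet_form n u u.
Proof.
move=> u0 n0; have nR : 0 < n%:R :> R by rewrite ltr0n.
rewrite exprVn mulrC ler_pdivrMr ?exprn_gt0// exchange_big/=.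
apply: (@le_trans _ _ ((\sum_(0 <= y < n) line_form n (u^~ y.+1) (u^~ y.+1)) * n%:R ^+ 2)).
  rewrite mulr_suml; apply: ler_sum => y _; apply: le_trans (line_poincare n (b := u^~ y.+1) (u0 _)) _.
  rewrite mulrC ler_wpM2r ?exprn_ge0// /line_form -addrA.
  have -> : \sum_(0 <= k < n.+1) slope (u^~ y.+1) k ^+ 2 = \sum_(0 <= k < n.+1) slope (u^~ y.+1) k * slope (u^~ y.+1) k.
    by apply: eq_bigr => k _; rewrite expr2.
  by rewrite lerDl addr_ge0// -expr2 sqr_ge0.
rewrite ler_wpM2r ?exprn_ge0// lerDl sumr_ge0// => x _; exact: line_form_ge0.
Qed.

(** The extra boundary terms repeat the first and last slopes. *)
Lemma dirichlet_form_le_pad (R : realFieldType) n (v : nat -> nat -> R) : (0 < n)%N ->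
  (forall x y, ~~ ((0 < x <= n) && (0 < y <= n))%N -> v x y = 0) ->
  dirichlet_form n v v <= 2 * padded_energy n v.
Proof.
move=> n0 v0.
have line (b : nat -> R) : b 0%N = 0 -> b n.+1 = 0 ->
    line_form n b b <= 2 * \sum_(0 <= k < n.+1) slope b k ^+ 2.
  move=> b0 bn; rewrite /line_form.
  have -> : \sum_(0 <= k < n.+1) slope b k * slope b k = \sum_(0 <= k < n.+1) slope b k ^+ 2.
    by apply: eq_bigr => k _; rewrite expr2.
  have : b 1%N * b 1%N + b n * b n <= \sum_(0 <= k < n.+1) slope b k ^+ 2.
    rewrite big_nat_recr//= lerD//; last by rewrite /slope bn sub0r sqrrN expr2.
    case: n n0 {v v0 bn} => // n _; rewrite big_nat_recl//= {1}/slope b0 subr0 -expr2.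
    by rewrite lerDl sumr_ge0// => k _; rewrite sqr_ge0.
  by rewrite -addrA; lra.
rewrite /dirichlet_form /padded_energy addrC mulrDr !mulr_sumr lerD//; apply: ler_sum => z _; apply: line.
all: by rewrite v0// ?ltnn ?andbF.
Qed.

(** The velocity of a cell as the mean of the fluxes through its two vertical
    sides; this turns a staggered field into a collocated one. *)
Definition cell_mean_x (R : realFieldType) (W : nat -> nat -> R) (x y : nat) : R :=
  (W x y + W x.-1 y) / 2.

(** Averaging two neighbours does not increase the energy, by convexity. *)
Lemma padded_energy_mean_x (R : realFieldType) n (W : nat -> nat -> R) : 
  (forall y, W 0%N y = 0) ->
  padded_energy n (cell_mean_x W) <= padded_energy n W.
Proof.
move=> W0; rewrite /padded_energy.
have sq (a b : R) : ((a + b) / 2) ^+ 2 <= a ^+ 2 / 2 + b ^+ 2 / 2.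
  by rewrite -subr_ge0 (_ : _ - _ = ((a - b) / 2) ^+ 2) ?sqr_ge0//; field.
apply: lerD.
  pose T x := \sum_(0 <= k < n.+1) slope (W x) k ^+ 2.
  have T0 : T 0%N = 0 by rewrite /T big1// => k _; rewrite /slope !W0 subrr expr0n.
  have Tge x : 0 <= T x by rewrite sumr_ge0// => k _; rewrite sqr_ge0.
  apply: (@le_trans _ _ (\sum_(0 <= x < n) (T x.+1 / 2 + T x / 2))).
    apply: ler_sum => x _; rewrite /T !mulr_suml -big_split/=; apply: ler_sum => k _.
    apply: le_trans (sq _ _); rewrite le_eqVlt; apply/orP; left; apply/eqP.
    by rewrite /slope /cell_mean_x /=; congr (_ ^+ 2); field.
  rewrite big_split/= -!mulr_suml.
  have H m : \sum_(0 <= x < m) T x <= \sum_(0 <= x < m) T x.+1.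
    case: m => [|m]; first by rewrite !big_nil.
    by rewrite big_nat_recl//= T0 add0r big_nat_recr//= lerDl.
  by have := H n; rewrite -/(T _); lra.
apply: ler_sum => y _; case: n => [|n].
  rewrite !big_nat1 /slope /cell_mean_x /= !W0 !addr0 mul0r !subr0.
  by have := sqr_ge0 (W 1%N y.+1); rewrite expr_div_n; lra.
set s := slope (W^~ y.+1).
apply: (@le_trans _ _ (\sum_(0 <= k < n.+2) (s k ^+ 2 / 2 + (if k is k'.+1 then s k' ^+ 2 / 2 else 0)))).
  apply: ler_sum => k _; case: k => [|k].
    rewrite /s /slope /cell_mean_x /= !W0 !addr0 mul0r !subr0.
    by have := sqr_ge0 (W 1%N y.+1); rewrite expr_div_n; lra.
  apply: le_trans (sq _ _); rewrite le_eqVlt; apply/orP; left; apply/eqP.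
  by rewrite /s /slope /cell_mean_x /=; congr (_ ^+ 2); field.
rewrite big_split/= [X in _ + X]big_nat_recl//= add0r -!mulr_suml [X in X / 2 + _]big_nat_recr//= [leRHS]big_nat_recr//=.
by have := sqr_ge0 (s n.+1); lra.
Qed.

(** At an interior edge the mean of two cell means is a mean of three fluxes with
    weights 1/4, 1/2, 1/4; it differs from the flux [W] by a quarter of a second difference.  Young's
    inequality then charges the error to the jumps of [p] and to the energy of
    [W]. *)
Lemma mean_divergence_error (R : realFieldType) n (p W : nat -> R) t : 0 < t ->
  W 0%N = 0 -> W n = 0 -> W n.+1 = 0 ->
  \sum_(0 <= x < n) (W x.+1 + W x) / 2 * ((inner_slope n p x.+1 + inner_slope n p x) / 2)
  <= - \sum_(0 <= x < n) p x.+1 * (W x.+1 - W x)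
     + 8^-1 * (t * \sum_(0 <= x < n) inner_slope n p x ^+ 2
               + t^-1 * (4 * \sum_(0 <= k < n.+1) slope W k ^+ 2)).
Proof.
move=> t0 W0 Wn WSn; pose v x := (W x + W x.-1) / 2.
have := sum_inner_mean n p v; rewrite /v /= => ->.
rewrite -abel_inner// [leRHS]addrC -lerBlDr -sumrB.
pose d k := slope W k - slope W k.-1.
apply: (@le_trans _ _ (\sum_(0 <= x < n) 8^-1 * (t * inner_slope n p x ^+ 2 + t^-1 * (d x) ^+ 2))).
  apply: ler_sum => x _; rewrite /inner_mean /inner_slope; case: ifP => [/andP[x0 xn]|_]; last first.
    by rewrite !mul0r subrr mulr_ge0 ?invr_ge0// addr_ge0// mulr_ge0 ?sqr_ge0 ?invr_ge0 ?(ltW t0).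
  have := amgm (slope p x) (d x) t0; rewrite /d /slope; case: x x0 xn => // x _ _ /=.
  by lra.
rewrite -mulr_sumr big_split/= -!mulr_sumr ler_wpM2l ?invr_ge0// lerD//.
rewrite ler_wpM2l ?invr_ge0 ?(ltW t0)//.
pose T k := slope W k ^+ 2.
apply: (@le_trans _ _ (\sum_(0 <= k < n) (2 * T k + (if k is k'.+1 then 2 * T k' else 0)))).
  apply: ler_sum => k _; rewrite /d /T; case: k => [|k] /=.
    by rewrite subrr expr0n /= addr0 mulr_ge0 ?sqr_ge0.
  by have := sqr_ge0 (slope W k.+1 + slope W k); lra.
have T0 k : 0 <= T k by rewrite sqr_ge0.
case: n {Wn WSn} => [|n]; first by rewrite big_nil mulr_ge0// sumr_ge0// => k _; exact: T0.
rewrite big_split/= [X in _ + X]big_nat_recl//= add0r -!mulr_sumr.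
rewrite [X in 2 * X + _]big_nat_recr//= [leRHS]mulr_sumr big_nat_recr//= big_nat_recr//= -mulr_sumr -/(T _) -/(T _).
have S0 : 0 <= \sum_(0 <= i < n) T i by rewrite sumr_ge0.
by have := T0 n; have := T0 n.+1; lra.
Qed.

(** * The stabilised Stokes system on a padded grid *)

Definition grid_sum (R : realFieldType) (n : nat) (F : nat -> nat -> R) : R :=
  \sum_(0 <= x < n) \sum_(0 <= y < n) F x y.

Lemma eq_grid_sum (R : realFieldType) n (F G : nat -> nat -> R) :
  (forall x y, (x < n)%N -> (y < n)%N -> F x y = G x y) -> grid_sum n F = grid_sum n G.
Proof.
move=> FG; rewrite /grid_sum big_nat_cond [RHS]big_nat_cond.
apply: eq_bigr => x /andP[/andP[_ xn] _]; rewrite big_nat_cond [RHS]big_nat_cond.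
by apply: eq_bigr => y /andP[/andP[_ yn] _]; apply: FG.
Qed.

Lemma grid_sumD (R : realFieldType) n (F G : nat -> nat -> R) :
  grid_sum n (fun x y => F x y + G x y) = grid_sum n F + grid_sum n G.
Proof. by rewrite /grid_sum -big_split/=; apply: eq_bigr => x _; rewrite big_split. Qed.

Lemma grid_sumZ (R : realFieldType) n c (F : nat -> nat -> R) :
  grid_sum n (fun x y => c * F x y) = c * grid_sum n F.
Proof. by rewrite /grid_sum mulr_sumr; apply: eq_bigr => x _; rewrite mulr_sumr. Qed.

Lemma grid_sum_transposed (R : realFieldType) n (F : nat -> nat -> R) :
  grid_sum n F = grid_sum n (fun x y => F y x).
Proof. by rewrite /grid_sum exchange_big. Qed.

Lemma ler_grid_sum (R : realFieldType) n (F G : nat -> nat -> R) :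
  (forall x y, F x y <= G x y) -> grid_sum n F <= grid_sum n G.
Proof. by move=> FG; apply: ler_sum => x _; apply: ler_sum => y _. Qed.

Lemma grid_sum_ge0 (R : realFieldType) n (F : nat -> nat -> R) :
  (forall x y, 0 <= F x y) -> 0 <= grid_sum n F.
Proof. by move=> F0; apply: sumr_ge0 => x _; apply: sumr_ge0 => y _. Qed.

(** Cell [(i, j)] sits at position [(i + 1, j + 1)], with zeros all around. *)
Definition padded (R : realFieldType) n (v : nat -> nat -> R) : Prop :=
  forall x y, ~~ ((0 < x <= n) && (0 < y <= n))%N -> v x y = 0.

Definition grid_laplacian (R : realFieldType) n (u : nat -> nat -> R) x y : R :=
  line_laplacian n (u^~ y.+1) x.+1 + line_laplacian n (u x.+1) y.+1.

Definition grid_dx (R : realFieldType) n (p : nat -> nat -> R) x y : R :=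
  (inner_slope n (p^~ y.+1) x.+1 + inner_slope n (p^~ y.+1) x) / 2.

Definition grid_divx (R : realFieldType) n (u : nat -> nat -> R) x y : R :=
  inner_mean n (u^~ y.+1) x.+1 - inner_mean n (u^~ y.+1) x.

Definition grid_stab (R : realFieldType) n (p : nat -> nat -> R) x y : R :=
  inner_slope n (p^~ y.+1) x - inner_slope n (p^~ y.+1) x.+1
  + (inner_slope n (p x.+1) y - inner_slope n (p x.+1) y.+1).

Definition inner_seminorm (R : realFieldType) n (p : nat -> nat -> R) : R :=
  grid_sum n (fun x y => inner_slope n (p^~ y.+1) x ^+ 2)
  + grid_sum n (fun x y => inner_slope n (p x.+1) y ^+ 2).

Lemma sum_grid_laplacian (R : realFieldType) n (u v : nat -> nat -> R) :
  (0 < n)%N -> padded n v ->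
  grid_sum n (fun x y => grid_laplacian n u x y * v x.+1 y.+1) = dirichlet_form n u v.
Proof.
move=> n0 v0; rewrite /dirichlet_form.
under eq_bigr => y _ do rewrite -sum_line_laplacian ?v0 ?ltnn ?andbF//.
under [X in _ + X]eq_bigr => y _ do rewrite -sum_line_laplacian ?v0 ?ltnn ?andbF//.
rewrite exchange_big/= -grid_sumD; apply: eq_grid_sum => x y _ _.
by rewrite /grid_laplacian mulrDl.
Qed.

(** Duality of the discrete gradient and divergence. *)
Lemma sum_grid_dx (R : realFieldType) n (p v : nat -> nat -> R) :
  grid_sum n (fun x y => v x.+1 y.+1 * grid_dx n p x y)
  = - grid_sum n (fun x y => p x.+1 y.+1 * grid_divx n v x y).
Proof.
rewrite grid_sum_transposed [in RHS]grid_sum_transposed -sumrN; apply: eq_bigr => y _.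
rewrite /grid_dx (sum_inner_mean n (p^~ y.+1) (v^~ y.+1)) abel_inner//.
by rewrite /inner_mean ltnn andbF.
Qed.

Lemma sum_grid_stab (R : realFieldType) n (p : nat -> nat -> R) :
  grid_sum n (fun x y => p x.+1 y.+1 * grid_stab n p x y) = inner_seminorm n p.
Proof.
transitivity (grid_sum n (fun x y =>
   p x.+1 y.+1 * (inner_slope n (p^~ y.+1) x - inner_slope n (p^~ y.+1) x.+1)
   + p x.+1 y.+1 * (inner_slope n (p x.+1) y - inner_slope n (p x.+1) y.+1))).
  by apply: eq_grid_sum => x y _ _; rewrite -mulrDr.
rewrite grid_sumD /inner_seminorm; congr (_ + _).
  rewrite grid_sum_transposed [in RHS]grid_sum_transposed; apply: eq_bigr => y _.
  under [RHS]eq_bigr do rewrite expr2.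
  rewrite abel_inner ?/inner_slope ?ltnn ?andbF// -sumrN.
  by apply: eq_bigr => x _; rewrite -mulrN opprB.
apply: eq_bigr => x _.
under [RHS]eq_bigr do rewrite expr2.
rewrite abel_inner ?/inner_slope ?ltnn ?andbF// -sumrN.
by apply: eq_bigr => y _; rewrite -mulrN opprB.
Qed.

(** The scheme in grid form.  The momentum equations are multiplied by the
    square of the mesh step [n%:R^-1], the mass equation by the mesh step; the
    vertical derivative is the horizontal one of the transposed grid. *)
Record stokes_grid (R : realFieldType) n (lambda : R) (f1 f2 U1 U2 P : nat -> nat -> R) : Prop := {
  pad1 : padded n U1; pad2 : padded n U2; padp : padded n P;
  momentum1 : forall x y, (x < n)%N -> (y < n)%N ->
    grid_laplacian n U1 x y + n%:R^-1 * grid_dx n P x y = n%:R^-1 ^+ 2 * f1 x y;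
  momentum2 : forall x y, (x < n)%N -> (y < n)%N ->
    grid_laplacian n U2 x y + n%:R^-1 * grid_dx n (transposed P) y x = n%:R^-1 ^+ 2 * f2 x y;
  mass_eq : forall x y, (x < n)%N -> (y < n)%N ->
    grid_divx n U1 x y + grid_divx n (transposed U2) y x + lambda * n%:R^-1 * grid_stab n P x y = 0 }.

Lemma momentum_tested (R : realFieldType) n lambda (f1 f2 U1 U2 P v1 v2 : nat -> nat -> R) :
  (0 < n)%N -> stokes_grid n lambda f1 f2 U1 U2 P -> padded n v1 -> padded n v2 ->
  dirichlet_form n U1 v1 + dirichlet_form n U2 v2
  + n%:R^-1 * (grid_sum n (fun x y => v1 x.+1 y.+1 * grid_dx n P x y)
             + grid_sum n (fun x y => v2 x.+1 y.+1 * grid_dx n (transposed P) y x))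
  = n%:R^-1 ^+ 2 * (grid_sum n (fun x y => f1 x y * v1 x.+1 y.+1) + grid_sum n (fun x y => f2 x y * v2 x.+1 y.+1)).
Proof.
move=> n0 [_ _ _ m1 m2 _] v10 v20.
rewrite -!sum_grid_laplacian// !mulrDr -!grid_sumZ addrACA -!grid_sumD.
apply: eq_grid_sum => x y xn yn; rewrite !(mulrA (n%:R^-1 ^+ 2)) -m1// -m2//; ring.
Qed.

(** Test with the solution: by duality and the mass equation the pressure term
    equals the stabilisation energy, and Poincare absorbs the velocity from the
    right-hand side. *)
Lemma grid_energy (R : realFieldType) n lambda (f1 f2 U1 U2 P : nat -> nat -> R) :
  (0 < n)%N -> stokes_grid n lambda f1 f2 U1 U2 P ->
  dirichlet_form n U1 U1 + dirichlet_form n U2 U2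
    + 2 * lambda * n%:R^-1 ^+ 2 * inner_seminorm n P
  <= n%:R^-1 ^+ 2 * (grid_sum n (fun x y => f1 x y ^+ 2) + grid_sum n (fun x y => f2 x y ^+ 2)).
Proof.
move=> n0 sol; have [p1 p2 pp m1 m2 me] := sol.
have := momentum_tested n0 sol p1 p2.
set h := n%:R^-1; have h0 : 0 <= h by rewrite invr_ge0.
have -> : grid_sum n (fun x y => U1 x.+1 y.+1 * grid_dx n P x y)
     + grid_sum n (fun x y => U2 x.+1 y.+1 * grid_dx n (transposed P) y x)
   = lambda * h * inner_seminorm n P.
  have E2 : grid_sum n (fun x y => U2 x.+1 y.+1 * grid_dx n (transposed P) y x)
      = - grid_sum n (fun x y => P x.+1 y.+1 * grid_divx n (transposed U2) y x).
    by rewrite grid_sum_transposed; have := sum_grid_dx n (transposed P) (transposed U2) => ->; rewrite grid_sum_transposed.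
  rewrite sum_grid_dx E2 -opprD -grid_sumD -sum_grid_stab -grid_sumZ -[LHS]mulN1r -grid_sumZ.
  apply: eq_grid_sum => x y xn yn.
  have -> : grid_divx n U1 x y = - grid_divx n (transposed U2) y x - lambda * h * grid_stab n P x y.
    by have := me x y xn yn; rewrite -/h; lra.
  by ring.
have po1 : h ^+ 2 * grid_sum n (fun x y => U1 x.+1 y.+1 ^+ 2) <= dirichlet_form n U1 U1.
  by apply: dirichlet_poincare => // y; apply: p1.
have po2 : h ^+ 2 * grid_sum n (fun x y => U2 x.+1 y.+1 ^+ 2) <= dirichlet_form n U2 U2.
  by apply: dirichlet_poincare => // y; apply: p2.
have young (f U : nat -> nat -> R) : grid_sum n (fun x y => f x y * U x.+1 y.+1) <=
    2^-1 * grid_sum n (fun x y => f x y ^+ 2) + 2^-1 * grid_sum n (fun x y => U x.+1 y.+1 ^+ 2).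
  rewrite -!grid_sumZ -grid_sumD; apply: ler_grid_sum => x y.
  by have := @amgm R 1 (f x y) (U x.+1 y.+1) ltr01; rewrite invr1 !mul1r mulrDr.
have y1 := ler_wpM2l (sqr_ge0 h) (young f1 U1); have y2 := ler_wpM2l (sqr_ge0 h) (young f2 U2).
by move=> E; lra.
Qed.

Lemma inner_seminorm_ge0 (R : realFieldType) n (p : nat -> nat -> R) : 0 <= inner_seminorm n p.
Proof. by apply: addr_ge0; apply: grid_sum_ge0 => x y; exact: sqr_ge0. Qed.

(** Test the momentum equation with the averaged staggered field whose
    divergence is the pressure.  This produces [S], the square norm of the
    pressure; every other term is split by Young's inequality into a part that
    [S] absorbs and a part that [grid_energy] controls. *)
Theorem grid_estimate (R : realFieldType) (lambda : R) : 0 < lambda ->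
  exists2 C : R, 0 <= C & forall n (f1 f2 U1 U2 P : nat -> nat -> R), (0 < n)%N ->
  stokes_grid n lambda f1 f2 U1 U2 P -> grid_sum n (fun x y => P x.+1 y.+1) = 0 ->
  n%:R^-1 ^+ 2 * grid_sum n (fun x y => P x.+1 y.+1 ^+ 2)
  <= C * (n%:R^-1 ^+ 2 * (grid_sum n (fun x y => f1 x y ^+ 2) + grid_sum n (fun x y => f2 x y ^+ 2))).
Proof.
move=> l0; have [C0 C00 inv] := staggered_right_inverse R.
exists (20 * (C0 + 1) * (1 + (16 * lambda)^-1)).
  rewrite !mulr_ge0 ?addr_ge0// invr_ge0 mulr_ge0// ltW//.
move=> n f1 f2 U1 U2 P n0 sol P0.
have [W1 [W2 [W10 W20 Wd W1e W2e]]] := inv n (fun x y => P x.+1 y.+1) n0 P0.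
move: W1e W2e; rewrite -/(grid_sum n _); set S := grid_sum n _ => W1e W2e.
have S0 : 0 <= S by apply: grid_sum_ge0 => x y; exact: sqr_ge0.
have energy := grid_energy n0 sol.
set Phi := (X in _ <= _ * X); move: energy; set h := n%:R^-1; set Q := inner_seminorm n P => energy.
have h0 : 0 < h by rewrite invr_gt0 ltr0n.
have Q0 : 0 <= Q by apply: inner_seminorm_ge0.
pose v1 := cell_mean_x W1; pose v2 := transposed (cell_mean_x (transposed W2)).
have v10 : padded n v1.
  move=> x y xy; rewrite /v1 /cell_mean_x !W10 ?addr0 ?mul0r//; apply: contra xy; clear; lia.
have v20 : padded n v2.
  move=> x y xy; rewrite /v2 /transposed /cell_mean_x /transposed !W20 ?addr0 ?mul0r//; apply: contra xy; clear; lia.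
have D1 : dirichlet_form n v1 v1 <= 2 * (C0 * S).
  apply: le_trans (dirichlet_form_le_pad n0 v10) _; rewrite ler_wpM2l//.
  by apply: le_trans (padded_energy_mean_x n _) W1e => y; apply: W10.
have D2 : dirichlet_form n v2 v2 <= 2 * (C0 * S).
  apply: le_trans (dirichlet_form_le_pad n0 v20) _; rewrite ler_wpM2l// padded_energy_transposed.
  apply: le_trans (padded_energy_mean_x n _) _; first by move=> y; rewrite /transposed W20// andbF.
  by rewrite padded_energy_transposed.
have P1 : h ^+ 2 * grid_sum n (fun x y => v1 x.+1 y.+1 ^+ 2) <= 2 * (C0 * S).
  by apply: le_trans D1; apply: dirichlet_poincare => // y; apply: v10.
have P2 : h ^+ 2 * grid_sum n (fun x y => v2 x.+1 y.+1 ^+ 2) <= 2 * (C0 * S).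
  by apply: le_trans D2; apply: dirichlet_poincare => // y; apply: v20.
(* the terms that the pressure must absorb add up to at most 5 C0 S / t,
   which this choice makes at most h S / 2 *)
pose t := 10 * (C0 + 1) / h.
have C01 : 0 < C0 + 1 by lra.
have t0 : 0 < t by rewrite divr_gt0// mulr_gt0.
have th0 : 0 < t * h by rewrite mulr_gt0.
have := momentum_tested n0 sol v10 v20; rewrite -/h.
have G : grid_sum n (fun x y => v1 x.+1 y.+1 * grid_dx n P x y)
     + grid_sum n (fun x y => v2 x.+1 y.+1 * grid_dx n (transposed P) y x)
   <= - S + 8^-1 * (t * h * Q + (t * h)^-1 * (4 * (padded_energy n W1 + padded_energy n W2))).
  pose A1 := grid_sum n (fun x y => P x.+1 y.+1 * (W1 x.+1 y.+1 - W1 x y.+1)).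
  pose A2 := grid_sum n (fun x y => P x.+1 y.+1 * (W2 x.+1 y.+1 - W2 x.+1 y)).
  have SA : S = A1 + A2.
    by rewrite -grid_sumD; apply: eq_grid_sum => x y xn yn; rewrite -mulrDr Wd// expr2.
  have H1 : grid_sum n (fun x y => v1 x.+1 y.+1 * grid_dx n P x y) <=
    - A1 + 8^-1 * (t * h * grid_sum n (fun x y => inner_slope n (P^~ y.+1) x ^+ 2)
                   + (t * h)^-1 * (4 * padded_energy n W1)).
    rewrite grid_sum_transposed.
    apply: (@le_trans _ _ (\sum_(0 <= y < n)
      (- (\sum_(0 <= x < n) P x.+1 y.+1 * (W1 x.+1 y.+1 - W1 x y.+1))
     + 8^-1 * (t * h * \sum_(0 <= x < n) inner_slope n (P^~ y.+1) x ^+ 2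
               + (t * h)^-1 * (4 * \sum_(0 <= k < n.+1) slope (W1^~ y.+1) k ^+ 2))))).
      apply: ler_sum => y _.
      by apply: (mean_divergence_error (P^~ y.+1) (W := W1^~ y.+1) th0); apply: W10; clear; lia.
    rewrite big_split/= sumrN -mulr_sumr big_split/= -!mulr_sumr.
    apply: lerD; first by rewrite /A1 grid_sum_transposed.
    rewrite ler_wpM2l ?invr_ge0//; apply: lerD; first by rewrite [in leRHS]grid_sum_transposed.
    rewrite ler_wpM2l ?invr_ge0 ?(ltW th0)// ler_wpM2l// /padded_energy lerDr.
    by apply: sumr_ge0 => x _; apply: sumr_ge0 => k _; exact: sqr_ge0.
  have H2 : grid_sum n (fun x y => v2 x.+1 y.+1 * grid_dx n (transposed P) y x) <=
    - A2 + 8^-1 * (t * h * grid_sum n (fun x y => inner_slope n (P x.+1) y ^+ 2)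
                   + (t * h)^-1 * (4 * padded_energy n W2)).
    apply: (@le_trans _ _ (\sum_(0 <= x < n)
      (- (\sum_(0 <= y < n) P x.+1 y.+1 * (W2 x.+1 y.+1 - W2 x.+1 y))
     + 8^-1 * (t * h * \sum_(0 <= y < n) inner_slope n (P x.+1) y ^+ 2
               + (t * h)^-1 * (4 * \sum_(0 <= k < n.+1) slope (W2 x.+1) k ^+ 2))))).
      apply: ler_sum => x _.
      by apply: (mean_divergence_error (P x.+1) (W := W2 x.+1) th0); apply: W20; clear; lia.
    rewrite big_split/= sumrN -mulr_sumr big_split/= -!mulr_sumr.
    apply: lerD; first by [].
    rewrite ler_wpM2l ?invr_ge0//; apply: lerD; first by [].
    rewrite ler_wpM2l ?invr_ge0 ?(ltW th0)// ler_wpM2l// /padded_energy lerDl.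
    by apply: sumr_ge0 => x _; apply: sumr_ge0 => k _; exact: sqr_ge0.
  by rewrite SA /Q /inner_seminorm; lra.
have young (f v : nat -> nat -> R) : - grid_sum n (fun x y => f x y * v x.+1 y.+1) <=
    2^-1 * (t * grid_sum n (fun x y => f x y ^+ 2)) + 2^-1 * (t^-1 * grid_sum n (fun x y => v x.+1 y.+1 ^+ 2)).
  rewrite -mulN1r -!grid_sumZ -grid_sumD; apply: ler_grid_sum => x y.
  by have := amgm (f x y) (- v x.+1 y.+1) t0; rewrite sqrrN; lra.
have y1 := ler_wpM2l (sqr_ge0 h) (young f1 v1); have y2 := ler_wpM2l (sqr_ge0 h) (young f2 v2).
have a1 := dirichlet_form_amgm n U1 v1 t0; have a2 := dirichlet_form_amgm n U2 v2 t0.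
have ti0 : 0 < t^-1 by rewrite invr_gt0.
have PhiE : Phi = h ^+ 2 * (grid_sum n (fun x y => f1 x y ^+ 2) + grid_sum n (fun x y => f2 x y ^+ 2)) by [].
have e10 := dirichlet_form_ge0 n U1; have e20 := dirichlet_form_ge0 n U2.
move=> E; move: energy y1 y2 a1 a2 PhiE G P1 P2 D1 D2 W1e W2e E e10 e20; move: Phi => Phi.
move: (grid_sum n (fun x y => f1 x y ^+ 2)) (grid_sum n (fun x y => f2 x y ^+ 2)) => F1 F2.
move: (grid_sum n (fun x y => v1 x.+1 y.+1 * _)) (grid_sum n (fun x y => v2 x.+1 y.+1 * _)) => g1 g2.
move: (grid_sum n (fun x y => f1 x y * _)) (grid_sum n (fun x y => f2 x y * _)) => z1 z2.
move: (grid_sum n (fun x y => v1 _ _ ^+ 2)) (grid_sum n (fun x y => v2 _ _ ^+ 2)) => s1 s2.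
move: (dirichlet_form n U1 v1) (dirichlet_form n U2 v2) (dirichlet_form n U1 U1) (dirichlet_form n U2 U2)
  (dirichlet_form n v1 v1) (dirichlet_form n v2 v2) (padded_energy n W1) (padded_energy n W2) => d1 d2 e1 e2 b1 b2 w1 w2.
move=> energy y1 y2 a1 a2 PhiE G P1 P2 D1 D2 W1e W2e E e10 e20.
have hG : h * (g1 + g2) <= - (h * S) + 8^-1 * (t * (h ^+ 2 * Q)) + t^-1 * (C0 * S).
  apply: le_trans (ler_wpM2l (ltW h0) G) _.
  have -> : h * (- S + 8^-1 * (t * h * Q + (t * h)^-1 * (4 * (w1 + w2)))) =
    - (h * S) + 8^-1 * (t * (h ^+ 2 * Q)) + 2^-1 * t^-1 * (w1 + w2) by field; rewrite !gt_eqF.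
  rewrite lerD2l -mulrA mulrCA ler_wpM2l ?(ltW ti0)//; lra.
have tb1 := ler_wpM2l (ltW ti0) D1; have tb2 := ler_wpM2l (ltW ti0) D2.
have tp1 := ler_wpM2l (ltW ti0) P1; have tp2 := ler_wpM2l (ltW ti0) P2.
have lQ : 2 * lambda * (h ^+ 2 * Q) <= Phi - (e1 + e2) by rewrite PhiE; lra.
have Qb : h ^+ 2 * Q <= (2 * lambda)^-1 * (Phi - (e1 + e2)).
  by rewrite [leRHS]mulrC ler_pdivlMr ?mulr_gt0// mulrC.
have Qh : 0 <= 2 * lambda * (h ^+ 2 * Q).
  by apply: mulr_ge0; rewrite mulr_ge0 ?(ltW l0) ?sqr_ge0.
have ePhi : e1 + e2 <= Phi by lra.
have te := ler_wpM2l (ltW t0) ePhi.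
have tQ : t * (h ^+ 2 * Q) <= (2 * lambda)^-1 * (t * Phi).
  rewrite [leRHS]mulrCA; apply: ler_wpM2l; first exact: ltW.
  apply: le_trans Qb _.
  by apply: ler_wpM2l; [rewrite invr_ge0 mulr_ge0 ?(ltW l0)|lra].
have tC : 10 * (t^-1 * (C0 * S)) <= h * S.
  have -> : 10 * (t^-1 * (C0 * S)) = h * S * (C0 / (C0 + 1)) by rewrite /t; field; rewrite !gt_eqF.
  by rewrite ler_piMr ?mulr_ge0 ?(ltW h0)// ler_pdivrMr// mul1r; lra.
have tPhiE : t * Phi = h ^+ 2 * t * (F1 + F2) by rewrite PhiE; ring.
have main : h * S <= 2 * (t * Phi) + 2 * (8^-1 * ((2 * lambda)^-1 * (t * Phi))) by lra.
have := ler_wpM2l (ltW h0) main.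
have -> : h * (h * S) = h ^+ 2 * S by ring.
move=> /le_trans; apply; rewrite le_eqVlt; apply/orP; left; apply/eqP.
by rewrite /t; field; rewrite !gt_eqF.
Qed.

(** * From cell functions to padded grids *)

(** The values of a cell function at positions shifted by one, and 0 elsewhere. *)
Definition padded_grid (R : realFieldType) (n : nat) (a : cell n -> R) (x y : nat) : R :=
  if x is i.+1 then if y is j.+1 then
    if insub i is Some i' then if insub j is Some j' then a (i', j') else 0 else 0
  else 0 else 0.

Lemma padded_gridE (R : realFieldType) n (a : cell n -> R) (i j : 'I_n) :
  padded_grid a i.+1 j.+1 = a (i, j).
Proof. by rewrite /padded_grid !valK. Qed.

Lemma padded_grid_padded (R : realFieldType) n (a : cell n -> R) : padded n (padded_grid a).
Proof.
move=> [|i] [|j] //= ij; case: insubP => // i' /= i'n _; case: insubP => // j' /= j'n _.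
by rewrite i'n j'n in ij.
Qed.

Lemma sum_cells (R : realFieldType) n (F : nat -> nat -> R) :
  \sum_(K : cell n) F K.1 K.2 = grid_sum n F.
Proof.
rewrite /grid_sum big_mkord (eq_bigr (fun i : 'I_n => \sum_(j < n) F i j)); last first.
  by move=> i _; rewrite big_mkord.
by rewrite pair_big.
Qed.

Lemma east_cell (R : realFieldType) (T : Type) n (a : cell n -> R) (K : cell n) (g : R -> T) z :
  (if neighbour K East is Some L then g (a L) else z)
  = if (K.1.+1 < n)%N then g (padded_grid a K.1.+2 K.2.+1) else z.
Proof.
case: K => i j; rewrite /= /ord_succ; case: insubP => [i' i'n i'E|].
  by rewrite i'n /= valK.
by move/negPf->.
Qed.

Lemma north_cell (R : realFieldType) (T : Type) n (a : cell n -> R) (K : cell n) (g : R -> T) z :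
  (if neighbour K North is Some L then g (a L) else z)
  = if (K.2.+1 < n)%N then g (padded_grid a K.1.+1 K.2.+2) else z.
Proof.
case: K => i j; rewrite /= /ord_succ; case: insubP => [j' j'n j'E|].
  by rewrite j'n /= valK.
by move/negPf->.
Qed.

Lemma west_cell (R : realFieldType) (T : Type) n (a : cell n -> R) (K : cell n) (g : R -> T) z :
  (if neighbour K West is Some L then g (a L) else z)
  = if (0 < K.1)%N then g (padded_grid a K.1 K.2.+1) else z.
Proof.
case: K => [[[|i] ilt] j] //=; rewrite /ord_prec /=.
by have H := ltnW ilt; rewrite (insubT (fun m => (m < n)%N) H) /= valK.
Qed.

Lemma south_cell (R : realFieldType) (T : Type) n (a : cell n -> R) (K : cell n) (g : R -> T) z :
  (if neighbour K South is Some L then g (a L) else z)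
  = if (0 < K.2)%N then g (padded_grid a K.1.+1 K.2) else z.
Proof.
case: K => [i [[|j] jlt]] //=; rewrite /ord_prec /=.
by have H := ltnW jlt; rewrite (insubT (fun m => (m < n)%N) H) /= valK.
Qed.

(** Read off the four descriptions of the neighbours, with a constant function of
    the neighbour. *)
Lemma external_sides n (K : cell n) :
  [/\ (neighbour K West == None) = ~~ (0 < K.1)%N, (neighbour K East == None) = ~~ (K.1.+1 < n)%N,
      (neighbour K South == None) = ~~ (0 < K.2)%N & (neighbour K North == None) = ~~ (K.2.+1 < n)%N].
Proof.
have E (o : option (cell n)) (b : bool) : (if o is Some L then true else false) = b -> (o == None) = ~~ b.
  by case: o => [L|] <-.
split; apply: E.
- by have := west_cell (fun _ : cell n => 0 : rat) K (fun _ => true) false; case: neighbour => [?|] ->; case: ifP.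
- by have := east_cell (fun _ : cell n => 0 : rat) K (fun _ => true) false; case: neighbour => [?|] ->; case: ifP.
- by have := south_cell (fun _ : cell n => 0 : rat) K (fun _ => true) false; case: neighbour => [?|] ->; case: ifP.
- by have := north_cell (fun _ : cell n => 0 : rat) K (fun _ => true) false; case: neighbour => [?|] ->; case: ifP.
Qed.

(** Internal and external edges together give one alternative per side. *)
Lemma sum_sides (R : realFieldType) n (a : cell n -> R) (K : cell n)
    (g : side -> R -> R) (e : side -> R) :
  \sum_(s <- sides) (if neighbour K s is Some L then g s (a L) else 0)
  + \sum_(s <- sides | neighbour K s == None) e s
  = (if (0 < K.1)%N then g West (padded_grid a K.1 K.2.+1) else e West)
  + (if (K.1.+1 < n)%N then g East (padded_grid a K.1.+2 K.2.+1) else e East)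
  + ((if (0 < K.2)%N then g South (padded_grid a K.1.+1 K.2) else e South)
  + (if (K.2.+1 < n)%N then g North (padded_grid a K.1.+1 K.2.+2) else e North)).
Proof.
have [W E S N] := external_sides K.
rewrite (big_mkcond (fun s => neighbour K s == None)) /sides !big_cons !big_nil.
rewrite W E S N west_cell east_cell south_cell north_cell.
by case: ifP => _; case: ifP => _; case: ifP => _; case: ifP => _; rewrite /=; ring.
Qed.

Lemma sum_sides_inner (R : realFieldType) n (a : cell n -> R) (K : cell n)
    (g : side -> R -> R) :
  \sum_(s <- sides) (if neighbour K s is Some L then g s (a L) else 0)
  = (if (0 < K.1)%N then g West (padded_grid a K.1 K.2.+1) else 0)
  + (if (K.1.+1 < n)%N then g East (padded_grid a K.1.+2 K.2.+1) else 0)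
  + ((if (0 < K.2)%N then g South (padded_grid a K.1.+1 K.2) else 0)
  + (if (K.2.+1 < n)%N then g North (padded_grid a K.1.+1 K.2.+2) else 0)).
Proof. by rewrite -(sum_sides a K g (fun _ => 0)) [X in _ + X]big1 ?addr0. Qed.

Lemma entry_sum (R : realFieldType) n (K : cell n) (V : side -> cell n -> 'rV[R]_2) c :
  (\sum_(s <- sides) (if neighbour K s is Some L then V s L else 0)) ord0 c
  = \sum_(s <- sides) (if neighbour K s is Some L then V s L ord0 c else 0).
Proof.
by rewrite summxE; apply: eq_bigr => s _; case: neighbour => [//|]; rewrite mxE.
Qed.

Lemma line_laplacian_cases (R : realFieldType) n (b : nat -> R) x : (x < n)%N ->
  b 0%N = 0 -> b n.+1 = 0 ->
  line_laplacian n b x.+1 = (if (0 < x)%N then b x.+1 - b x else 2 * b x.+1)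
    + (if (x.+1 < n)%N then b x.+1 - b x.+2 else 2 * b x.+1).
Proof.
move=> xn b0 bn; rewrite /line_laplacian /=.
have -> : (x.+1 == n) = ~~ (x.+1 < n)%N by lia.
case: (ltnP x.+1 n) => xn'; first by case: x {xn xn'} => [|x]; rewrite ?b0 /=; ring.
have -> : x.+2 = n.+1 by lia.
by rewrite bn; case: x {xn xn'} => [|x]; rewrite ?b0 /=; ring.
Qed.

Lemma step2V (R : realType) n : (step R n ^+ 2)^-1 = n%:R ^+ 2.
Proof. by rewrite /step exprVn invrK. Qed.

Lemma neg_laplacian_grid (R : realType) n (u : {ffun cell n -> 'rV[R]_2}) (K : cell n) c :
  neg_laplacian u K ord0 c = n%:R ^+ 2 * grid_laplacian n (padded_grid (component u c)) K.1 K.2.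
Proof.
rewrite /neg_laplacian !mxE entry_sum summxE step2V mul1r.
set a := component u c.
have -> : \sum_(s <- sides) (if neighbour K s is Some L then (u K - u L) ord0 c else 0)
    = \sum_(s <- sides) (if neighbour K s is Some L then a K - a L else 0).
  by apply: eq_bigr => s _; case: neighbour => // L; rewrite !mxE.
have -> : \sum_(s <- sides | neighbour K s == None) u K ord0 c
   = 2^-1 * \sum_(s <- sides | neighbour K s == None) 2 * a K.
  by rewrite mulr_sumr; apply: eq_bigr => s _; rewrite /a /component; field.
have -> (x y : R) : n%:R ^+ 2 * x + 2 * n%:R ^+ 2 * (2^-1 * y) = n%:R ^+ 2 * (x + y) by field.
rewrite (sum_sides a K (fun _ z => a K - z)); congr (_ * _).
have aE : a K = padded_grid a K.1.+1 K.2.+1 by rewrite padded_gridE -surjective_pairing.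
by rewrite -/(component u c _) -/a aE /grid_laplacian !line_laplacian_cases// ?padded_grid_padded ?ltnn ?andbF.
Qed.

Lemma neg_laplacian_S_grid (R : realType) n (p : {ffun cell n -> R}) (K : cell n) :
  neg_laplacian_S p K = n%:R ^+ 2 * grid_stab n (padded_grid p) K.1 K.2.
Proof.
rewrite /neg_laplacian_S step2V mul1r; congr (_ * _).
rewrite (sum_sides_inner p K (fun _ z => p K - z)).
have -> : p K = padded_grid p K.1.+1 K.2.+1 by rewrite padded_gridE -surjective_pairing.
rewrite /grid_stab /inner_slope /slope !ltn_ord !andbT /=.
by case: ifP => _; case: ifP => _; case: ifP => _; case: ifP => _; ring.
Qed.

Definition normal_entry (R : realType) (s : side) (c : 'I_2) : R := outward_normal R s ord0 c.

Lemma normal_entryE (R : realType) :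
  [/\ normal_entry R West ord0 = -1, normal_entry R East ord0 = 1,
      normal_entry R South ord0 = 0 & normal_entry R North ord0 = 0] /\
  [/\ normal_entry R West ord_max = 0, normal_entry R East ord_max = 0,
      normal_entry R South ord_max = -1 & normal_entry R North ord_max = 1].
Proof. by split; split; rewrite /normal_entry /= !mxE /= ?oppr0. Qed.

Lemma gradient_entry (R : realType) n (p : {ffun cell n -> R}) (K : cell n) c :
  gradient p K ord0 c = n%:R *
   ((if (0 < K.1)%N then (padded_grid p K.1.+1 K.2.+1 + padded_grid p K.1 K.2.+1) / 2 else padded_grid p K.1.+1 K.2.+1) * normal_entry R West c
  + (if (K.1.+1 < n)%N then (padded_grid p K.1.+1 K.2.+1 + padded_grid p K.1.+2 K.2.+1) / 2 else padded_grid p K.1.+1 K.2.+1) * normal_entry R East c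
  + ((if (0 < K.2)%N then (padded_grid p K.1.+1 K.2.+1 + padded_grid p K.1.+1 K.2) / 2 else padded_grid p K.1.+1 K.2.+1) * normal_entry R South c
  + (if (K.2.+1 < n)%N then (padded_grid p K.1.+1 K.2.+1 + padded_grid p K.1.+1 K.2.+2) / 2 else padded_grid p K.1.+1 K.2.+1) * normal_entry R North c)).
Proof.
have n0 : n%:R != 0 :> R by rewrite pnatr_eq0 -lt0n (leq_ltn_trans _ (ltn_ord K.1)).
rewrite /gradient !mxE entry_sum summxE step2V mul1r -mulrDr.
have -> : \sum_(s <- sides) (if neighbour K s is Some L then
     ((step R n * ((p K + p L) / 2)) *: outward_normal R s) ord0 c else 0)
   = \sum_(s <- sides) (if neighbour K s is Some L then
     step R n * ((p K + p L) / 2) * normal_entry R s c else 0).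
  by apply: eq_bigr => s _; case: neighbour => // L; rewrite !mxE.
have -> : \sum_(s <- sides | neighbour K s == None) ((step R n * p K) *: outward_normal R s) ord0 c
  = \sum_(s <- sides | neighbour K s == None) step R n * p K * normal_entry R s c.
  by apply: eq_bigr => s _; rewrite !mxE.
rewrite (sum_sides p K (fun s z => step R n * ((p K + z) / 2) * normal_entry R s c)).
have -> : p K = padded_grid p K.1.+1 K.2.+1 by rewrite padded_gridE -surjective_pairing.
rewrite /step.
by case: ifP => _; case: ifP => _; case: ifP => _; case: ifP => _; field.
Qed.

Lemma gradient_x_grid (R : realType) n (p : {ffun cell n -> R}) (K : cell n) :
  gradient p K ord0 ord0 = n%:R * grid_dx n (padded_grid p) K.1 K.2.
Proof.
rewrite gradient_entry; have [[-> -> -> ->] _] := normal_entryE R; congr (_ * _).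
rewrite /grid_dx /inner_slope /slope ltn_ord andbT /=.
by case: (ltnP 0 K.1) => _; case: (ltnP K.1.+1 n) => _; rewrite !mulr0 !addr0 mulr1 mulrN1; field.
Qed.

Lemma gradient_y_grid (R : realType) n (p : {ffun cell n -> R}) (K : cell n) :
  gradient p K ord0 ord_max = n%:R * grid_dx n (transposed (padded_grid p)) K.2 K.1.
Proof.
rewrite gradient_entry; have [_ [-> -> -> ->]] := normal_entryE R; congr (_ * _).
rewrite /grid_dx /inner_slope /slope /transposed ltn_ord andbT /=.
by case: (ltnP 0 K.2) => _; case: (ltnP K.2.+1 n) => _; rewrite !mulr0 !add0r mulr1 mulrN1; field.
Qed.

Lemma divergence_grid (R : realType) n (u : {ffun cell n -> 'rV[R]_2}) (K : cell n) :
  divergence u K = n%:R * (grid_divx n (padded_grid (component u ord0)) K.1 K.2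
    + grid_divx n (transposed (padded_grid (component u ord_max))) K.2 K.1).
Proof.
have n0 : n%:R != 0 :> R by rewrite pnatr_eq0 -lt0n (leq_ltn_trans _ (ltn_ord K.1)).
rewrite /divergence step2V mul1r.
have dotE (x y : 'rV[R]_2) : dot x y = x ord0 ord0 * y ord0 ord0 + x ord0 ord_max * y ord0 ord_max.
  rewrite /dot mxE big_ord_recl big_ord1 !mxE; congr (_ + _ * _); congr (_ _ _); exact: val_inj.
pose a := component u ord0; pose b := component u ord_max.
have -> : \sum_(s <- sides) (if neighbour K s is Some L then
     step R n * dot (2^-1 *: (u K + u L)) (outward_normal R s) else 0)
  = \sum_(s <- sides) (if neighbour K s is Some L then
     step R n * (2^-1 * (a K + a L)) * normal_entry R s ord0 else 0)
  + \sum_(s <- sides) (if neighbour K s is Some L then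
     step R n * (2^-1 * (b K + b L)) * normal_entry R s ord_max else 0).
  rewrite -big_split/=; apply: eq_bigr => s _; case: neighbour => [L|]; last by rewrite addr0.
  by rewrite dotE !mxE /a /b /component /normal_entry; ring.
rewrite (sum_sides_inner a K (fun s z => step R n * (2^-1 * (a K + z)) * normal_entry R s ord0)).
rewrite (sum_sides_inner b K (fun s z => step R n * (2^-1 * (b K + z)) * normal_entry R s ord_max)).
have [[-> -> -> ->] [-> -> -> ->]] := normal_entryE R.
have -> : a K = padded_grid a K.1.+1 K.2.+1 by rewrite padded_gridE -surjective_pairing.
have -> : b K = padded_grid b K.1.+1 K.2.+1 by rewrite padded_gridE -surjective_pairing.
rewrite -/a -/b; move: (padded_grid a) (padded_grid b) => A B.
rewrite /grid_divx /inner_mean /transposed !ltn_ord !andbT /= /step.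
by case: (ltnP 0 K.1) => _; case: (ltnP K.1.+1 n) => _; case: (ltnP 0 K.2) => _; case: (ltnP K.2.+1 n) => _; field.
Qed.

Arguments padded_grid : simpl never.

(** Regroups the form by cells, each cell being charged for the edge that
    follows it and for the external edges. *)
Lemma line_form_cases (R : realFieldType) n (b : nat -> R) : (0 < n)%N ->
  b 0%N = 0 -> b n.+1 = 0 ->
  line_form n b b = \sum_(0 <= x < n)
    ((if (x.+1 < n)%N then (b x.+1 - b x.+2) ^+ 2 else 2 * b x.+1 ^+ 2)
     + (if (0 < x)%N then 0 else 2 * b x.+1 ^+ 2)).
Proof.
case: n => // n _ b0 bn; rewrite /line_form.
rewrite [in LHS]big_nat_recl// [in LHS]big_nat_recr//= big_split/=.
rewrite [X in _ = _ + X]big_nat_recl//= [X in _ = _ + (_ + X)]big1 ?addr0; last first.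
  by move=> i _.
rewrite [X in _ = X + _]big_nat_recr//= ltnn.
have -> : \sum_(0 <= i < n) (if (i.+1 < n.+1)%N then (b i.+1 - b i.+2) ^+ 2 else 2 * b i.+1 ^+ 2)
   = \sum_(0 <= i < n) slope b i.+1 * slope b i.+1.
  rewrite big_nat_cond [RHS]big_nat_cond; apply: eq_bigr => i /andP[/andP[_ im] _].
  by rewrite ltnS im /slope; ring.
by rewrite /slope b0 bn; ring.
Qed.

Lemma discrete_H1_sq_grid (R : realType) n (v : cell n -> R) : (0 < n)%N ->
  discrete_H1_sq v = dirichlet_form n (padded_grid v) (padded_grid v).
Proof.
move=> n0; have V0 := padded_grid_padded v.
rewrite /dirichlet_form.
under eq_bigr => y _ do rewrite line_form_cases ?V0 ?ltnn ?andbF//.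
under [X in _ + X]eq_bigr => x _ do rewrite line_form_cases ?V0 ?ltnn ?andbF//.
rewrite exchange_big/= -grid_sumD -sum_cells /discrete_H1_sq -big_split/=.
apply: eq_bigr => K _; have [W E S N] := external_sides K.
rewrite (big_mkcond (fun s => neighbour K s == None)) /sides !big_cons !big_nil W E S N.
rewrite (east_cell v K (fun z => (v K - z) ^+ 2)) (north_cell v K (fun z => (v K - z) ^+ 2)).
have -> : v K = padded_grid v K.1.+1 K.2.+1 by rewrite padded_gridE -surjective_pairing.
rewrite /=.
by case: (ltnP 0 K.1) => _; case: (ltnP K.1.+1 n) => _; case: (ltnP 0 K.2) => _; case: (ltnP K.2.+1 n) => _; rewrite /=; ring.
Qed.

Lemma stokes_system_grid (R : realType) n (lambda : R) (F : cell n -> 'rV[R]_2)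
    (u : {ffun cell n -> 'rV[R]_2}) (p : {ffun cell n -> R}) : (0 < n)%N ->
  (forall K : cell n, neg_laplacian u K + gradient p K = F K /\
    divergence u K + lambda * step R n ^+ 2 * neg_laplacian_S p K = 0) ->
  stokes_grid n lambda (fun x y => padded_grid (component F ord0) x.+1 y.+1)
    (fun x y => padded_grid (component F ord_max) x.+1 y.+1)
    (padded_grid (component u ord0)) (padded_grid (component u ord_max)) (padded_grid p).
Proof.
move=> n0 H; have nR : n%:R != 0 :> R by rewrite pnatr_eq0 -lt0n.
split; try exact: padded_grid_padded.
- move=> x y xn yn; pose K : cell n := (Ordinal xn, Ordinal yn).
  have [/(congr1 (fun A : 'rV[R]_2 => A ord0 ord0)) E _] := H K.
  rewrite mxE neg_laplacian_grid gradient_x_grid in E.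
  have := padded_gridE (component F ord0) (Ordinal xn) (Ordinal yn) => /= ->.
  by rewrite /component -E /=; field.
- move=> x y xn yn; pose K : cell n := (Ordinal xn, Ordinal yn).
  have [/(congr1 (fun A : 'rV[R]_2 => A ord0 ord_max)) E _] := H K.
  rewrite mxE neg_laplacian_grid gradient_y_grid in E.
  have := padded_gridE (component F ord_max) (Ordinal xn) (Ordinal yn) => /= ->.
  by rewrite /component -E /=; field.
- move=> x y xn yn; pose K : cell n := (Ordinal xn, Ordinal yn).
  have [_] := H K; rewrite divergence_grid neg_laplacian_S_grid /= => E.
  by apply: (mulfI nR); rewrite mulr0 -[RHS]E /step; field.
Qed.

Lemma padded_grid_linear (R : realFieldType) n (a : R) (v w : cell n -> R) :
  padded_grid (fun K => a * v K + w K) = (fun x y => a * padded_grid v x y + padded_grid w x y).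
Proof.
apply/funext => -[|x]; apply/funext => -[|y]; rewrite /padded_grid /=; rewrite ?mulr0 ?addr0//.
by case: insub => [i|]; [case: insub => [j|]|]; rewrite ?mulr0 ?addr0.
Qed.

Lemma grid_laplacian_linear (R : realFieldType) n (a : R) (v w : nat -> nat -> R) x y :
  grid_laplacian n (fun x y => a * v x y + w x y) x y = a * grid_laplacian n v x y + grid_laplacian n w x y.
Proof. by rewrite /grid_laplacian /line_laplacian; ring. Qed.

Lemma grid_dx_linear (R : realFieldType) n (a : R) (v w : nat -> nat -> R) x y :
  grid_dx n (fun x y => a * v x y + w x y) x y = a * grid_dx n v x y + grid_dx n w x y.
Proof.
by rewrite /grid_dx /inner_slope /slope; case: ifP => _; case: ifP => _; field.
Qed.

Lemma grid_divx_linear (R : realFieldType) n (a : R) (v w : nat -> nat -> R) x y :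
  grid_divx n (fun x y => a * v x y + w x y) x y = a * grid_divx n v x y + grid_divx n w x y.
Proof.
by rewrite /grid_divx /inner_mean; case: ifP => _; case: ifP => _; field.
Qed.

Lemma grid_stab_linear (R : realFieldType) n (a : R) (v w : nat -> nat -> R) x y :
  grid_stab n (fun x y => a * v x y + w x y) x y = a * grid_stab n v x y + grid_stab n w x y.
Proof.
by rewrite /grid_stab /inner_slope /slope; case: ifP => _; case: ifP => _; case: ifP => _; case: ifP => _; ring.
Qed.

Lemma grid_sum_padded_grid (R : realType) n (v : cell n -> R) :
  grid_sum n (fun x y => padded_grid v x.+1 y.+1) = \sum_K v K.
Proof.
by rewrite -sum_cells; apply: eq_bigr => K _; rewrite padded_gridE -surjective_pairing.
Qed.

(** The fluxes telescope and none crosses the boundary. *)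
Lemma sum_divergence (R : realType) n (u : {ffun cell n -> 'rV[R]_2}) :
  \sum_K divergence u K = 0.
Proof.
have tele (b : nat -> R) : \sum_(0 <= x < n) (inner_mean n b x.+1 - inner_mean n b x) = 0.
  rewrite (telescope_sumr (inner_mean n b) (leq0n n)).
  by rewrite /inner_mean ltnn andbF subrr.
under eq_bigr do rewrite divergence_grid.
rewrite -mulr_sumr (sum_cells n (fun x y => grid_divx n (padded_grid (component u ord0)) x y + grid_divx n (transposed (padded_grid (component u ord_max))) y x)).
rewrite grid_sumD grid_sum_transposed /grid_sum !big1 ?addr0 ?mulr0// => y _; exact: tele.
Qed.

Lemma sum_neg_laplacian_S (R : realType) n (p : {ffun cell n -> R}) :
  \sum_K neg_laplacian_S p K = 0.
Proof.
have tele (b : nat -> R) : \sum_(0 <= x < n) (inner_slope n b x - inner_slope n b x.+1) = 0.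
  under eq_bigr do rewrite -opprB.
  rewrite sumrN (telescope_sumr (inner_slope n b) (leq0n n)).
  by rewrite /inner_slope ltnn andbF subrr oppr0.
under eq_bigr do rewrite neg_laplacian_S_grid.
rewrite -mulr_sumr (sum_cells n (grid_stab n (padded_grid p))) /grid_stab grid_sumD grid_sum_transposed /grid_sum.
by rewrite !big1 ?addr0 ?mulr0// => y _; exact: tele.
Qed.

(** * Unique solvability and discrete estimates *)

Definition stokes_system (R : realType) n (lambda : R) (F : cell n -> 'rV[R]_2)
    (u : {ffun cell n -> 'rV[R]_2}) (p : {ffun cell n -> R}) : Prop :=
  forall K : cell n, neg_laplacian u K + gradient p K = F K /\
    divergence u K + lambda * step R n ^+ 2 * neg_laplacian_S p K = 0.

Definition data_energy (R : realType) n (F : cell n -> 'rV[R]_2) : R :=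
  step R n ^+ 2 * \sum_(c < 2) \sum_K component F c K ^+ 2.

Lemma ord2_cases (c : 'I_2) : c = ord0 \/ c = ord_max.
Proof. by case: c => [[|[|//]] ?]; [left|right]; exact: val_inj. Qed.

Lemma sum_ord2 (R : realType) (G : 'I_2 -> R) : \sum_(c < 2) G c = G ord0 + G ord_max.
Proof. by rewrite big_ord_recl big_ord1; congr (_ + G _); exact: val_inj. Qed.

Lemma data_energy_grid (R : realType) n (F : cell n -> 'rV[R]_2) :
  data_energy F = n%:R^-1 ^+ 2 *
   (grid_sum n (fun x y => padded_grid (component F ord0) x.+1 y.+1 ^+ 2)
   + grid_sum n (fun x y => padded_grid (component F ord_max) x.+1 y.+1 ^+ 2)).
Proof.
rewrite /data_energy sum_ord2 -!sum_cells; congr (_ * (_ + _)).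
all: by apply: eq_bigr => K _; rewrite padded_gridE -surjective_pairing.
Qed.

Lemma discrete_energy (R : realType) n (lambda : R) (F : cell n -> 'rV[R]_2)
    (u : {ffun cell n -> 'rV[R]_2}) (p : {ffun cell n -> R}) :
  0 < lambda -> (0 < n)%N -> stokes_system lambda F u p ->
  \sum_(c < 2) discrete_H1_sq (component u c) <= data_energy F.
Proof.
move=> l0 n0 sys; have := grid_energy n0 (stokes_system_grid n0 sys).
rewrite data_energy_grid sum_ord2 !discrete_H1_sq_grid//; apply: le_trans.
by rewrite lerDl mulr_ge0 ?inner_seminorm_ge0// mulr_ge0 ?sqr_ge0// mulr_ge0// ltW.
Qed.

Lemma discrete_pressure (R : realType) (lambda : R) : 0 < lambda ->
  exists2 C : R, 0 <= C & forall n (F : cell n -> 'rV[R]_2)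
    (u : {ffun cell n -> 'rV[R]_2}) (p : {ffun cell n -> R}), (0 < n)%N ->
    stokes_system lambda F u p -> \sum_K p K = 0 ->
    step R n ^+ 2 * \sum_K p K ^+ 2 <= C * data_energy F.
Proof.
move=> l0; have [C C0 est] := grid_estimate l0; exists C => // n F u p n0 sys p0.
have := est n _ _ _ _ _ n0 (stokes_system_grid n0 sys).
rewrite grid_sum_padded_grid p0 => /(_ erefl); rewrite -data_energy_grid; apply: le_trans.
rewrite le_eqVlt -sum_cells; apply/orP; left; apply/eqP; congr (_ * _).
by apply: eq_bigr => K _; rewrite padded_gridE -surjective_pairing.
Qed.

Lemma linear_inj_surj (R : fieldType) (V : vectType R) (phi : V -> V) :
  linear phi -> (forall v, phi v = 0 -> v = 0) -> forall w, exists v, phi v = w.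
Proof.
move=> lin inj w.
pose phiL := GRing.isLinear.Build R V V *:%R phi lin.
pose f : {linear V -> V} := HB.pack phi phiL.
have fE v : linfun f v = phi v by rewrite lfunE.
have ker : lker (linfun f) == 0%VS.
  apply/lker0P => v1 v2; rewrite !fE => E; apply/eqP; rewrite -subr_eq0; apply/eqP.
  by apply: inj; rewrite -fE linearB /= !fE E subrr.
have : w \in limg (linfun f) by rewrite (lker0_limgf ker) memvf.
by move=> /memv_imgP[v _ ->]; exists v; rewrite fE.
Qed.

(** Adding the sum of the pressure to the mass equation makes the system
    square.  Since the other two terms of that equation have zero sum, it
    also forces the zero mean. *)
Definition stokes_op (R : realType) n (lambda : R)
    (up : {ffun cell n -> 'rV[R]_2} * {ffun cell n -> R^o})
  : {ffun cell n -> 'rV[R]_2} * {ffun cell n -> R^o} :=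
  ([ffun K => neg_laplacian up.1 K + gradient up.2 K],
   [ffun K => divergence up.1 K + lambda * step R n ^+ 2 * neg_laplacian_S up.2 K
              + \sum_K' (up.2 K' : R)]).

Lemma component_linear (R : realType) n (a : R) (u v : {ffun cell n -> 'rV[R]_2}) c :
  component (a *: u + v) c = fun K => a * component u c K + component v c K.
Proof. by apply/funext => K; rewrite /component !ffunE !mxE. Qed.

Lemma stokes_op_linear (R : realType) n (lambda : R) : linear (@stokes_op R n lambda).
Proof.
move=> a [u p] [v q]; rewrite /stokes_op.
have pqE : (a *: p + q : {ffun cell n -> R}) = (fun K => a * p K + q K) :> (cell n -> R).
  by apply/funext => K; rewrite !ffunE.
apply/pair_eqP; rewrite /=; apply/andP; split; apply/eqP/ffunP => K; rewrite !ffunE /=.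
  apply/rowP => c.
  have addE (A B : 'rV[R]_2) : (A + B) ord0 c = A ord0 c + B ord0 c by rewrite mxE.
  have scaleE (A : 'rV[R]_2) : (a *: A) ord0 c = a * A ord0 c by rewrite mxE.
  rewrite (addE (neg_laplacian (a *: u + v) K)) (addE (a *: _)) (scaleE (neg_laplacian u K + _)).
  rewrite (addE (neg_laplacian u K)) (addE (neg_laplacian v K)).
  rewrite !neg_laplacian_grid component_linear padded_grid_linear grid_laplacian_linear.
  have [->|->] := ord2_cases c.
    rewrite !gradient_x_grid pqE padded_grid_linear grid_dx_linear; ring.
  rewrite !gradient_y_grid pqE padded_grid_linear.
  have -> : transposed (fun x y => a * padded_grid p x y + padded_grid q x y) = (fun x y => a * transposed (padded_grid p) x y + transposed (padded_grid q) x y) by [].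
  rewrite grid_dx_linear; ring.
rewrite !divergence_grid !neg_laplacian_S_grid !component_linear !padded_grid_linear pqE padded_grid_linear.
have -> : transposed (fun x y => a * padded_grid (component u ord_max) x y + padded_grid (component v ord_max) x y)
  = (fun x y => a * transposed (padded_grid (component u ord_max)) x y + transposed (padded_grid (component v ord_max)) x y) by [].
rewrite !grid_divx_linear grid_stab_linear.
have -> : \sum_K' (a * p K' + q K') = a * (\sum_K' p K') + \sum_K' q K' by rewrite big_split mulr_sumr.
rewrite /GRing.scale /=; ring.
Qed.

Lemma sum_stokes_op (R : realType) n (lambda : R) up : (0 < n)%N ->
  (forall K, (@stokes_op R n lambda up).2 K = 0) -> \sum_K (up.2 K : R) = 0.
Proof.
move=> n0 H.
have : \sum_K ((@stokes_op R n lambda up).2 K : R) = 0 by rewrite big1.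
under eq_bigr do rewrite ffunE.
rewrite !big_split/= sum_divergence -mulr_sumr sum_neg_laplacian_S mulr0 !add0r sumr_const.
move/eqP; rewrite mulrn_eq0 => /orP[|/eqP//].
by rewrite card_prod card_ord muln_eq0 orbb eqn0Ngt n0.
Qed.

(** The estimates with zero data. *)
Lemma stokes_op_inj (R : realType) n (lambda : R) up : 0 < lambda -> (0 < n)%N ->
  @stokes_op R n lambda up = 0 -> up = 0.
Proof.
case: up => u p l0 n0 E.
have E1 K : neg_laplacian u K + gradient p K = 0.
  by have /(congr1 fst)/ffunP/(_ K) := E; rewrite !ffunE.
have E2 K : (@stokes_op R n lambda (u, p)).2 K = 0 by rewrite E ffunE.
have p0 : \sum_K (p K : R) = 0 := sum_stokes_op n0 E2.
have sys : stokes_system lambda (fun _ => 0) u p.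
  move=> K; split; first exact: E1.
  by have := E2 K; rewrite ffunE /= p0 addr0.
have d0 : data_energy (fun _ : cell n => (0 : 'rV[R]_2)) = 0.
  by rewrite /data_energy big1 ?mulr0// => c _; rewrite big1// => K _; rewrite /component mxE expr0n.
have h0 : 0 < step R n ^+ 2 by rewrite exprn_gt0// invr_gt0 ltr0n.
have [C _ est] := discrete_pressure l0.
have pz : p = 0.
  have := est n _ _ _ n0 sys p0; rewrite d0 mulr0 pmulr_rle0// => S0.
  have : \sum_K p K ^+ 2 == 0 by rewrite eq_le S0 sumr_ge0// => K _; rewrite sqr_ge0.
  rewrite psumr_eq0 => [/allP P|K _]; last exact: sqr_ge0.
  apply/ffunP => K; rewrite ffunE; apply/eqP; have := P K; rewrite mem_index_enum => /(_ isT).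
  by rewrite /= sqrf_eq0.
have uz : u = 0.
  have := discrete_energy l0 n0 sys; rewrite d0 sum_ord2 !discrete_H1_sq_grid// => D0.
  have Dc c : dirichlet_form n (padded_grid (component u c)) (padded_grid (component u c)) <= 0.
    have D1 := dirichlet_form_ge0 n (padded_grid (component u ord0)).
    have D2 := dirichlet_form_ge0 n (padded_grid (component u ord_max)).
    by have [->|->] := ord2_cases c; lra.
  apply/ffunP => K; apply/rowP => c; rewrite ffunE mxE.
  have := dirichlet_poincare (u := padded_grid (component u c)) (fun y => padded_grid_padded _ (erefl : ~~ ((0 < 0 <= n) && (0 < y <= n))%N)) n0.
  move=> /le_trans/(_ (Dc c)); rewrite pmulr_rle0// => S0.
  have : \sum_K component u c K ^+ 2 == 0.
    rewrite eq_le; apply/andP; split; last by apply: sumr_ge0 => K' _; rewrite sqr_ge0.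
    apply: le_trans S0; rewrite -/(grid_sum _ _) -sum_cells le_eqVlt; apply/orP; left; apply/eqP.
    by apply: eq_bigr => K' _; rewrite padded_gridE -surjective_pairing.
  rewrite psumr_eq0 => [/allP P|K' _]; last exact: sqr_ge0.
  by have := P K; rewrite mem_index_enum => /(_ isT); rewrite /= sqrf_eq0 => /eqP.
by rewrite uz pz.
Qed.

Lemma stokes_system_unique_exists (R : realType) n (lambda : R) (F : cell n -> 'rV[R]_2) :
  0 < lambda -> (0 < n)%N ->
  exists! up : {ffun cell n -> 'rV[R]_2} * {ffun cell n -> R},
    \sum_K up.2 K = 0 /\ stokes_system lambda F up.1 up.2.
Proof.
move=> l0 n0.
have inj up : @stokes_op R n lambda up = 0 -> up = 0 by apply: stokes_op_inj.
have opE (up : {ffun cell n -> 'rV[R]_2} * {ffun cell n -> R^o}) :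
    (\sum_K (up.2 K : R) = 0 /\ stokes_system lambda F up.1 up.2)
    <-> stokes_op lambda up = ([ffun K => F K], 0).
  split=> [[p0 sys]|E].
    rewrite /stokes_op p0; congr pair; apply/ffunP => K; rewrite !ffunE.
      by have [] := sys K.
    by have [_ ->] := sys K; rewrite add0r.
  have E2 K : (stokes_op lambda up).2 K = 0 by rewrite E ffunE.
  have p0 := sum_stokes_op n0 E2; split=> // K; split.
    by have /(congr1 fst)/ffunP/(_ K) := E; rewrite !ffunE.
  by have := E2 K; rewrite ffunE p0 addr0.
have [up upE] := linear_inj_surj (@stokes_op_linear R n lambda) inj ([ffun K => F K], 0).
exists up; split; first by apply/opE.
move=> vq /opE vqE; apply/eqP; rewrite -subr_eq0; apply/eqP; apply: inj.
have := @stokes_op_linear R n lambda (-1) vq up; rewrite vqE upE !scaleN1r !addNr.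
by rewrite addrC.
Qed.

(** * Piecewise constant functions and cell means in L2 *)

Local Open Scope classical_set_scope.
Local Open Scope ring_scope.

Lemma measurable_control_volume (R : realType) n (K : cell n) :
  measurable (control_volume K : set (plane R)).
Proof. by apply: measurableX; exact: measurable_itv. Qed.

Lemma lebesgue2_control_volume (R : realType) n (K : cell n) :
  lebesgue2 R (control_volume K) = (step R n ^+ 2)%:E.
Proof.
have n0 : (0 < n)%N by apply: leq_ltn_trans (ltn_ord K.1).
have len (i : nat) : @lebesgue_measure R `]i%:R * step R n, i.+1%:R * step R n[ = (step R n)%:E.
  rewrite lebesgue_measure_itv /= lte_fin ltr_pM2r ?invr_gt0 ?ltr0n// ltr_nat ltnSn.
  by rewrite -EFinD -mulrBl -natr1 addrAC subrr add0r mul1r.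
rewrite /control_volume; apply: etrans (product_measure1E _ _ _ _) _; try exact: measurable_itv.
transitivity ((step R n)%:E * (step R n)%:E)%E; first by congr (_ * _)%E; exact: len.
by rewrite -EFinM -expr2.
Qed.

Lemma control_volume_sub (R : realType) n (K : cell n) :
  control_volume K `<=` (Omega : set (plane R)).
Proof.
have n0 : 0 < n%:R :> R by rewrite ltr0n; apply: leq_ltn_trans (ltn_ord K.1).
have sub (i : 'I_n) (x : R) : x \in `]i%:R * step R n, i.+1%:R * step R n[ -> x \in `]0, 1[.
  rewrite !in_itv/= => /andP[x1 x2]; apply/andP; split.
    by apply: le_lt_trans x1; rewrite mulr_ge0// invr_ge0 ltW.
  by apply: lt_le_trans x2 _; rewrite ler_pdivrMr// mul1r ler_nat.
by move=> x [/= x1 x2]; split => /=; [exact: sub x1|exact: sub x2].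
Qed.

Lemma control_volume_disjoint (R : realType) n (K L : cell n) (x : plane R) :
  control_volume K x -> control_volume L x -> K = L.
Proof.
have n0 : 0 < n%:R :> R by rewrite ltr0n; apply: leq_ltn_trans (ltn_ord K.1).
have le (i j : 'I_n) (y : R) : y \in `]i%:R * step R n, i.+1%:R * step R n[ ->
    y \in `]j%:R * step R n, j.+1%:R * step R n[ -> (i <= j)%N.
  rewrite !in_itv/= => /andP[y1 _] /andP[_ y2].
  by have := lt_trans y1 y2; rewrite ltr_pM2r ?invr_gt0// ltr_nat ltnS.
move=> [/= k1 k2] [/= l1 l2]; rewrite [K]surjective_pairing [L]surjective_pairing.
by congr pair; apply/val_inj/eqP; rewrite eqn_leq; apply/andP; split;
  [exact: le k1 l1|exact: le l1 k1|exact: le k2 l2|exact: le l2 k2].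
Qed.

(** At each point at most one cell contributes.  Stated for all coefficients at
    once, so that several sums can be evaluated at the same cell. *)
Lemma sum_indic_cells (R : realType) n (x : plane R) :
  (exists2 K0 : cell n, control_volume K0 x & forall a : cell n -> R, \sum_K a K * \1_(control_volume K) x = a K0)
  \/ (forall a : cell n -> R, \sum_K a K * \1_(control_volume K) x = 0).
Proof.
have [[K0 K0x]|noK] := pselect (exists K0 : cell n, control_volume K0 x); [left|right].
  exists K0 => // a; rewrite (bigD1 K0)//= big1 ?addr0 ?indicE ?mem_set ?mulr1// => K KK0.
  rewrite indicE memNset ?mulr0// => Kx.
  by move/eqP: KK0; apply; apply: control_volume_disjoint Kx K0x.
by move=> a; rewrite big1// => K _; rewrite indicE memNset ?mulr0// => Kx; apply: noK; exists K.
Qed.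

Lemma zero_extension_piecewise (R : realType) n (v : {ffun cell n -> R}) :
  zero_extension (piecewise_constant v) = piecewise_constant v.
Proof.
apply/funext => x; rewrite /zero_extension /piecewise_constant mulr_suml.
apply: eq_bigr => K _; rewrite -mulrA !indicE.
have [/set_mem xK|_] := boolP (x \in control_volume K); last by rewrite mul0r.
by rewrite (mem_set (control_volume_sub xK)) mulr1.
Qed.

Lemma integrable_indic_cell (R : realType) n (K : cell n) :
  (lebesgue2 R).-integrable setT (EFin \o (\1_(control_volume K) : plane R -> R)).
Proof.
apply/integrableP; split.
  by apply/measurable_EFinP; apply: measurable_indic; exact: measurable_control_volume.
rewrite (eq_integral (fun x => (\1_(control_volume K) x)%:E)); last first.
  by move=> t _; rewrite gee0_abs// lee_fin.
rewrite integral_indic ?setIT//; last exact: measurable_control_volume.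
by rewrite lebesgue2_control_volume ltry.
Qed.

Lemma Rintegral_indic_cell (R : realType) n (K : cell n) :
  \int[lebesgue2 R]_x \1_(control_volume K) x = step R n ^+ 2.
Proof.
rewrite /Rintegral integral_indic ?setIT//; last exact: measurable_control_volume.
by rewrite lebesgue2_control_volume.
Qed.

Lemma integrable_sum_plane (R : realType) (I : Type) (s : seq I) (f : I -> plane R -> R) :
  (forall i, (lebesgue2 R).-integrable setT (EFin \o f i)) ->
  (lebesgue2 R).-integrable setT (EFin \o (fun x => \sum_(i <- s) f i x)).
Proof.
move=> fi; have := @integrable_sum _ _ _ (lebesgue2 R) setT measurableT I s xpredT (fun i => EFin \o f i) (fun i _ => fi i).
by apply: eq_integrable => // x _; rewrite /= sumEFin.
Qed.

Lemma Rintegral_sum_plane (R : realType) (I : Type) (s : seq I) (f : I -> plane R -> R) :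
  (forall i, (lebesgue2 R).-integrable setT (EFin \o f i)) ->
  \int[lebesgue2 R]_x (\sum_(i <- s) f i x) = \sum_(i <- s) \int[lebesgue2 R]_x f i x.
Proof.
move=> fi; elim: s => [|i s IHs].
  by under eq_Rintegral do rewrite big_nil; rewrite big_nil Rintegral_cst// mul0r.
under eq_Rintegral do rewrite big_cons; rewrite big_cons -IHs RintegralD//.
exact: integrable_sum_plane.
Qed.

Lemma integrableZ_plane (R : realType) (f : plane R -> R) a :
  (lebesgue2 R).-integrable setT (EFin \o f) ->
  (lebesgue2 R).-integrable setT (EFin \o (fun x => a * f x)).
Proof.
move=> fi; have := integrableZl measurableT a fi.
by apply: eq_integrable => // x _; rewrite /= EFinM.
Qed.

Lemma Rintegral_cells (R : realType) n (a : cell n -> R) :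
  \int[lebesgue2 R]_x (\sum_K a K * \1_(control_volume K) x) = step R n ^+ 2 * \sum_K a K.
Proof.
rewrite Rintegral_sum_plane => [|K]; last exact/integrableZ_plane/integrable_indic_cell.
rewrite mulr_sumr; apply: eq_bigr => K _.
by rewrite RintegralZl ?Rintegral_indic_cell 1?mulrC//; exact: integrable_indic_cell.
Qed.

Lemma integrable_cells (R : realType) n (a : cell n -> R) :
  (lebesgue2 R).-integrable setT (EFin \o (fun x => \sum_K a K * \1_(control_volume K) x)).
Proof. by apply: integrable_sum_plane => K; exact/integrableZ_plane/integrable_indic_cell. Qed.

Lemma zero_meanE (R : realType) n (p : {ffun cell n -> R}) : (0 < n)%N ->
  zero_mean p <-> \sum_K p K = 0.
Proof.
move=> n0; rewrite /zero_mean.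
have -> : \int[lebesgue2 R]_(x in Omega) piecewise_constant p x
    = \int[lebesgue2 R]_x zero_extension (piecewise_constant p) x.
  rewrite Rintegral_mkcond; apply: eq_Rintegral => x _.
  by rewrite patchE /zero_extension indicE; case: ifP => _; rewrite ?mulr1 ?mulr0.
rewrite zero_extension_piecewise /piecewise_constant Rintegral_cells.
have h0 : step R n ^+ 2 != 0 by rewrite expf_neq0// invr_neq0// pnatr_eq0 -lt0n.
by split=> [/eqP|->]; [rewrite mulf_eq0 (negPf h0) => /eqP|rewrite mulr0].
Qed.

Lemma L2norm_ge0 (R : realType) (g : plane R -> R) : 0 <= L2norm g.
Proof. by rewrite fine_ge0// Lnorm_ge0. Qed.

(** Integrability is what makes the norm, a finite part of an extended real,
    meaningful. *)
Lemma L2norm_sqr (R : realType) (g : plane R -> R) :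
  (lebesgue2 R).-integrable setT (EFin \o (fun x => zero_extension g x ^+ 2)) ->
  L2norm g ^+ 2 = \int[lebesgue2 R]_x (zero_extension g x ^+ 2).
Proof.
move=> gi; rewrite /L2norm.
have N0 := @Lnorm_ge0 _ _ _ (lebesgue2 R) 2%:E (EFin \o zero_extension g).
have two0 : (2 : R) != 0 by rewrite pnatr_eq0.
have := @poweR_Lnorm _ _ _ (lebesgue2 R) (EFin \o zero_extension g) 2 two0.
rewrite (eq_integral (fun x => (zero_extension g x ^+ 2)%:E)); last first.
  by move=> x _; rewrite /= powR_mulrn// real_normK ?num_real.
have fin := integrable_fin_num measurableT gi.
rewrite /Rintegral; move: N0; case: ('N[_]_ _ [_])%E => [r| |]//.
  rewrite lee_fin => r0 /= E.
  by rewrite -E /= powR_mulrn.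
by move=> _; rewrite poweRyr// => E; rewrite -E in fin.
Qed.

Lemma piecewise_sqr (R : realType) n (a : cell n -> R) (x : plane R) :
  (\sum_K a K * \1_(control_volume K) x) ^+ 2 = \sum_K a K ^+ 2 * \1_(control_volume K) x.
Proof.
have [[K0 _ E]|E] := sum_indic_cells n x.
  by rewrite (E a) (E (fun K => a K ^+ 2)).
by rewrite (E a) (E (fun K => a K ^+ 2)) expr0n.
Qed.

Lemma L2norm_piecewise (R : realType) n (p : {ffun cell n -> R}) :
  L2norm (piecewise_constant p) ^+ 2 = step R n ^+ 2 * \sum_K p K ^+ 2.
Proof.
rewrite L2norm_sqr zero_extension_piecewise /piecewise_constant.
  by under eq_Rintegral do rewrite piecewise_sqr; rewrite Rintegral_cells.
have := integrable_cells (fun K => p K ^+ 2); apply: eq_integrable => // x _.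
by rewrite /= piecewise_sqr.
Qed.

(** On a set of finite measure a square integrable function is integrable, being
    at most [1 + g^2]. *)
Lemma L2_integrable_cell (R : realType) (g : plane R -> R) n (K : cell n) : L2 g ->
  (lebesgue2 R).-integrable setT (EFin \o (fun x => zero_extension g x * \1_(control_volume K) x)).
Proof.
move=> gL; have g2 := Lfun2_integrable_sqr gL.
have mg : measurable_fun setT (zero_extension g).
  by move: gL; rewrite /L2 inE => /andP[]; rewrite inE.
have mK : measurable (control_volume K : set (plane R)) := measurable_control_volume K.
have dom := integrableD measurableT (integrable_indic_cell R K) g2.
apply: le_integrable dom => //.
  by apply/measurable_EFinP/measurable_funM => //; exact: measurable_indic.
move=> x _; rewrite /= lee_fin normrM.
rewrite [leRHS]ger0_norm ?addr_ge0 ?sqr_ge0//.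
rewrite indicE; case: (_ \in _) => /=; last by rewrite normr0 mulr0 add0r sqr_ge0.
rewrite normr1 mulr1 -[X in _ <= _ + X]real_normK ?num_real//.
set y := `|_|; have := sqr_ge0 (y - 1); have : 0 <= y by rewrite normr_ge0.
by rewrite sqrrB mulr1 expr1n; nra.
Qed.

(** Jensen's inequality for all cells at once: with [m] the mean of [F] over the
    cell, [F^2 >= 2 m F - m^2], and the right-hand side integrates to [m^2] times
    the area. *)
Lemma cell_mean_energy (R : realType) (f : plane R -> 'rV[R]_2) n c : L2 (component f c) ->
  step R n ^+ 2 * \sum_(K : cell n) component (cell_mean f (n := n)) c K ^+ 2
  <= L2norm (component f c) ^+ 2.
Proof.
move=> fL; have [n0|n0] := posnP n.
  by rewrite big_pred0 ?mulr0 ?sqr_ge0// => -[i j]; case: i => i ilt; exfalso; move: ilt; rewrite n0.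
have f2 := Lfun2_integrable_sqr fL.
have h0 : 0 < step R n ^+ 2 by rewrite exprn_gt0// invr_gt0 ltr0n.
set F := zero_extension (component f c); set m := fun K => component (cell_mean f (n := n)) c K.
rewrite L2norm_sqr// -/F.
have FK (K : cell n) : \int[lebesgue2 R]_x (F x * \1_(control_volume K) x) = step R n ^+ 2 * m K.
  rewrite /m /component /cell_mean mxE lebesgue2_control_volume /= mulrA mulfV ?gt_eqF// mul1r.
  rewrite [RHS]Rintegral_mkcond; apply: eq_Rintegral => x _; rewrite patchE indicE /F /zero_extension.
  case: ifPn => [/set_mem xK|_]; last by rewrite mulr0.
  by rewrite indicE (mem_set (control_volume_sub xK)) !mulr1.
have FKi (K : cell n) := L2_integrable_cell K fL; rewrite -/F in FKi.
pose G (K : cell n) x := 2 * m K * (F x * \1_(control_volume K) x) - m K ^+ 2 * \1_(control_volume K) x.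
have Gi K : (lebesgue2 R).-integrable setT (EFin \o G K).
  have := integrableB measurableT (integrableZ_plane (2 * m K) (FKi K)) (integrableZ_plane (m K ^+ 2) (integrable_indic_cell R K)).
  by apply: eq_integrable.
have GK K : \int[lebesgue2 R]_x G K x = step R n ^+ 2 * m K ^+ 2.
  rewrite /G RintegralB//; [|exact/integrableZ_plane|exact/integrableZ_plane/integrable_indic_cell].
  rewrite !RintegralZl ?FK ?Rintegral_indic_cell//; last exact: integrable_indic_cell.
  by ring.
rewrite mulr_sumr -(eq_bigr _ (fun K _ => GK K)) -Rintegral_sum_plane//.
apply: le_Rintegral => //; first exact: integrable_sum_plane.
move=> x _; have -> : \sum_K G K x = \sum_K (2 * m K * F x - m K ^+ 2) * \1_(control_volume K) x.
  by apply: eq_bigr => K _; rewrite /G; ring.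
have [[K0 _ E]|E] := sum_indic_cells n x.
  rewrite E -subr_ge0 (_ : _ - _ = (F x - m K0) ^+ 2) ?sqr_ge0//; ring.
by rewrite E sqr_ge0.
Qed.

(** * Well-posedness and stability *)

Local Close Scope classical_set_scope.

Theorem theorem2p3 (R : realType) (lambda : R) (lambda_gt0 : 0 < lambda) :
  (forall (n : nat) (f : plane R -> 'rV[R]_2), (0 < n)%N -> L2vec f ->
     exists! up : {ffun cell n -> 'rV[R]_2} * {ffun cell n -> R},
       stokes_solution lambda f up.1 up.2) /\
  (exists c : R, forall (n : nat) (f : plane R -> 'rV[R]_2)
       (u : {ffun cell n -> 'rV[R]_2}) (p : {ffun cell n -> R}),
     (0 < n)%N -> L2vec f -> stokes_solution lambda f u p ->
     discrete_H1_norm u + L2norm (piecewise_constant p) <= c * L2vec_norm f).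
Proof.
split.
  move=> n f n0 _.
  have [up [[p0 sys] uniq]] := stokes_system_unique_exists (cell_mean f (n := n)) lambda_gt0 n0.
  exists up; split; first by split; [exact/zero_meanE|exact: sys].
  by move=> vq [q0 vqs]; apply: uniq; split; [exact/zero_meanE|exact: vqs].
have [C C0 pressure] := discrete_pressure lambda_gt0.
exists (1 + Num.sqrt C) => n f u p n0 fL [/(zero_meanE _ n0) p0 sys].
have data : data_energy (cell_mean f (n := n)) <= L2vec_norm f ^+ 2.
  rewrite /L2vec_norm sqr_sqrtr; last by apply: sumr_ge0 => c _; exact: sqr_ge0.
  rewrite /data_energy mulr_sumr; apply: ler_sum => c _.
  by apply: cell_mean_energy; exact: fL.
have N0 : 0 <= L2vec_norm f by exact: sqrtr_ge0.
rewrite mulrDl mul1r; apply: lerD.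
  rewrite /discrete_H1_norm -[leRHS](ger0_norm N0) -sqrtr_sqr ler_wsqrtr//.
  exact: le_trans (discrete_energy lambda_gt0 n0 sys) data.
rewrite -[leLHS](ger0_norm (L2norm_ge0 _)) -[in leRHS](ger0_norm N0) -!sqrtr_sqr -sqrtrM//.
rewrite ler_wsqrtr// L2norm_piecewise.
apply: le_trans (pressure n (cell_mean f (n := n)) u p n0 sys p0) _.
by rewrite ler_wpM2l.
Qed.
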